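(* Let $N>1$ be an integer, let $\boldsymbol{K}=K_1+iK_2$ with $K_1,K_2\in\mathbb{R}$ constants, and let $f_j=u_j+iv_j$ ($0\le j\le N$) be holomorphic functions on $\mathbb{C}$ that are real-valued on the real line. Let $A_j,B_j$ ($0\le j\le N$) be real random variables, with the convention $A_{-1}=B_{-1}=0$, such that the increments $A_k-A_{k-1}$ and $B_k-B_{k-1}$ ($0\le k\le N$) are mutually independent normal random variables with mean zero and variances $\operatorname{Var}(A_k-A_{k-1})=\sigma_{a_k}^2$, $\operatorname{Var}(B_k-B_{k-1})=\sigma_{b_k}^2$. Let $$S_N(z)=\sum_{j=0}^N(A_j+iB_j)f_j(z).$$ Define $Y_1,Y_2,Y_3,D_0,D_1,D_2,D_3$ as in the context. Let $T\subset\mathbb{C}$ be compact with $D_0(z)>0$ for all $z\in T$, and let $N_{\boldsymbol{K}}^{S_N}(T)$ be the number of solutions $z\in T$, counted with multiplicity, of $S_N(z)=\boldsymbol{K}$. Then $$E\bigl(N_{\boldsymbol{K}}^{S_N}(T)\bigr)=\int_Th_{N,\boldsymbol{K}}(z)\,dx\,dy\qquad(z=x+iy),$$ where $$\begin{aligned} h_{N,\boldsymbol{K}}={}&\frac{1}{2\pi D_0}\exp\left(-\frac{K_1^2Y_3+K_2^2Y_1-2K_1K_2Y_2}{2D_0^2}\right)\\ &\times\Biggl\{D_3-\frac{|D_1|^2}{D_0}\left(\frac{Y_2+Y_3}{D_0}-\frac{(K_1Y_3-K_2Y_2)\bigl(K_1(Y_2+Y_3)-K_2(Y_1+Y_2)\bigr)}{D_0^3}\right)\\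 &\quad-\frac{|D_2|^2}{D_0}\left(\frac{Y_1+Y_2}{D_0}-\frac{(K_1Y_2-K_2Y_1)\bigl(K_1(Y_2+Y_3)-K_2(Y_1+Y_2)\bigr)}{D_0^3}\right)\\ &\quad+\frac{|D_1+iD_2|^2}{D_0}\left(\frac{Y_2}{D_0}-\frac{(K_1Y_3-K_2Y_2)(K_1Y_2-K_2Y_1)}{D_0^3}\right)\Biggr\}, \end{aligned}$$ all functions on the right-hand side being evaluated at $z$.
   Context: Write $z=x+iy$ and $f_j(z)=u_j(x,y)+iv_j(x,y)$ with $u_j,v_j$ real-valued; $E$ denotes expectation. With $\Delta_k=(A_k-A_{k-1})+i(B_k-B_{k-1})$ and $F_k(z)=\sum_{j=k}^Nu_j(x,y)+i\sum_{j=k}^Nv_j(x,y)$ one has $S_N(z)=\sum_{k=0}^NF_k(z)\Delta_k$; the sequence $A_j+iB_j$ is interpreted as successive observations of a Brownian motion. Define $$Y_1(z)=\sum_{k=0}^N\left(\sigma_{a_k}^2\Bigl(\sum_{j=k}^Nu_j\Bigr)^2+\sigma_{b_k}^2\Bigl(\sum_{j=k}^Nv_j\Bigr)^2\right),\qquad Y_2(z)=\sum_{k=0}^N(\sigma_{a_k}^2-\sigma_{b_k}^2)\Bigl(\sum_{j=k}^Nu_j\Bigr)\Bigl(\sum_{j=k}^Nv_j\Bigr),$$ $$Y_3(z)=\sum_{k=0}^N\left(\sigma_{b_k}^2\Bigl(\sum_{j=k}^Nu_j\Bigr)^2+\sigma_{a_k}^2\Bigl(\sum_{j=k}^Nv_j\Bigr)^2\right),\qquad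 D_0(z)=\sqrt{Y_1(z)Y_3(z)-Y_2(z)^2},$$ $$D_1(z)=\sum_{k=0}^N\left(\sigma_{a_k}^2\sum_{j=k}^Nu_j-i\sigma_{b_k}^2\sum_{j=k}^Nv_j\right)\left(\sum_{j=k}^N\frac{\partial u_j}{\partial x}+i\sum_{j=k}^N\frac{\partial v_j}{\partial x}\right),$$ $$D_2(z)=\sum_{k=0}^N\left(\sigma_{b_k}^2\sum_{j=k}^Nu_j-i\sigma_{a_k}^2\sum_{j=k}^Nv_j\right)\left(\sum_{j=k}^N\frac{\partial u_j}{\partial x}+i\sum_{j=k}^N\frac{\partial v_j}{\partial x}\right),$$ $$D_3(z)=\sum_{k=0}^N(\sigma_{a_k}^2+\sigma_{b_k}^2)\left(\Bigl(\sum_{j=k}^N\frac{\partial u_j}{\partial x}\Bigr)^2+\Bigl(\sum_{j=k}^N\frac{\partial v_j}{\partial x}\Bigr)^2\right).$$ The function $h_{N,\boldsymbol{K}}$ is called the expected density of the complex zeros of $S_N(z)=\boldsymbol{K}$. *)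

(* Defs.v *)
From HB Require Import structures.
From mathcomp Require Export all_boot all_order all_algebra.
From mathcomp Require Export all_classical all_reals ereal topology normedtype.
From mathcomp Require Export sequences esum derive exp trigo measure.
From mathcomp Require Export measurable_realfun lebesgue_measure.
From mathcomp Require Export lebesgue_integral probability.
From mathcomp Require Export complex.
Export Order.TTheory GRing.Theory Num.Theory.
Export numFieldNormedType.Exports.

Set Implicit Arguments.
Unset Strict Implicit.
Unset Printing Implicit Defensive.

Local Open Scope classical_set_scope.
Local Open Scope ring_scope.
Local Open Scope complex_scope.

(* The regular algebra [R[i]^o] carries the topology of the modulus and the
   structure of normed space over R[i]; hence [derivable], [derive1] and
   [derive1n] for functions [cplx R -> cplx R] are complex derivatives. *)
Notation cplx R := (R[i]^o).

Definition holomorphic (R : realType) (f : cplx R -> cplx R) : Prop :=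
  forall z, derivable f z 1.

(* The least order of a nonvanishing derivative of g at z, and +oo if there is
   none; it is 0 when g z != 0. *)
Definition multiplicity (R : realType) (g : cplx R -> cplx R) (z : cplx R) :
    \bar R :=
  ereal_sup [set n%:R%:E | n in
    [set n : nat | forall m, (m < n)%N -> derive1n m g z = 0]].

Definition nb_solutions (R : realType) (g : cplx R -> cplx R) (K : cplx R)
    (T : set (cplx R)) : \bar R :=
  \esum_(z in [set z | T z /\ g z = K]) multiplicity (fun w => g w - K) z.

Section random_variables.
Context d (Omega : measurableType d) (R : realType) (P : probability Omega R).

Definition mutually_independent (I : finType) (X : I -> {RV P >-> R}) : Prop :=
  forall (J : {set I}) (E : I -> set R),
    (forall i, i \in J -> measurable (E i)) ->
    P (\bigcap_(i in [set i | i \in J]) X i @^-1` E i) =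
    (\prod_(i in J) P (X i @^-1` E i))%E.

(* The normal law of mean 0 and variance s ^+ 2. The point mass at 0 has to be
   singled out because [normal_prob 0 0] is the uniform law on [0, 1]. *)
Definition centered_normal (s : R) (E : set R) : \bar R :=
  if s == 0 then \d_(0 : R) E else normal_prob 0 s E.

Definition has_centered_normal_law (X : {RV P >-> R}) (s : R) : Prop :=
  forall E : set R, measurable E -> distribution P X E = centered_normal s E.

(* A k - A (k - 1), with the convention A (-1) = 0. *)
Definition increment (A : nat -> {RV P >-> R}) (k : nat) : {RV P >-> R} :=
  if k is k'.+1 then A k - A k' else A 0%N.

Definition increments (N : nat) (A B : nat -> {RV P >-> R})
    (i : 'I_N.+1 + 'I_N.+1) : {RV P >-> R} :=
  match i with inl k => increment A k | inr k => increment B k end.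

Definition random_sum (N : nat) (A B : nat -> {RV P >-> R})
    (f : nat -> cplx R -> cplx R) (w : Omega) (z : cplx R) : cplx R :=
  \sum_(0 <= j < N.+1) (A j w +i* B j w) * f j z.

End random_variables.

Section density.
Context (R : realType) (N : nat) (sa sb : nat -> R).
Context (f : nat -> cplx R -> cplx R).

Definition u (j : nat) (x y : R) : R := complex.Re (f j (x +i* y)).
Definition v (j : nat) (x y : R) : R := complex.Im (f j (x +i* y)).
Definition dux (j : nat) (x y : R) : R := derive1 (fun t => u j t y) x.
Definition dvx (j : nat) (x y : R) : R := derive1 (fun t => v j t y) x.

Definition U (k : nat) (x y : R) : R := \sum_(k <= j < N.+1) u j x y.
Definition V (k : nat) (x y : R) : R := \sum_(k <= j < N.+1) v j x y.
Definition Ux (k : nat) (x y : R) : R := \sum_(k <= j < N.+1) dux j x y.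
Definition Vx (k : nat) (x y : R) : R := \sum_(k <= j < N.+1) dvx j x y.

Definition Y1 (x y : R) : R := \sum_(0 <= k < N.+1)
  (sa k ^+ 2 * U k x y ^+ 2 + sb k ^+ 2 * V k x y ^+ 2).
Definition Y2 (x y : R) : R := \sum_(0 <= k < N.+1)
  (sa k ^+ 2 - sb k ^+ 2) * U k x y * V k x y.
Definition Y3 (x y : R) : R := \sum_(0 <= k < N.+1)
  (sb k ^+ 2 * U k x y ^+ 2 + sa k ^+ 2 * V k x y ^+ 2).

Definition D0 (x y : R) : R := Num.sqrt (Y1 x y * Y3 x y - Y2 x y ^+ 2).
Definition D1 (x y : R) : R[i] := \sum_(0 <= k < N.+1)
  ((sa k ^+ 2 * U k x y) -i* (sb k ^+ 2 * V k x y)) *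
  (Ux k x y +i* Vx k x y).
Definition D2 (x y : R) : R[i] := \sum_(0 <= k < N.+1)
  ((sb k ^+ 2 * U k x y) -i* (sa k ^+ 2 * V k x y)) *
  (Ux k x y +i* Vx k x y).
Definition D3 (x y : R) : R := \sum_(0 <= k < N.+1)
  (sa k ^+ 2 + sb k ^+ 2) * (Ux k x y ^+ 2 + Vx k x y ^+ 2).

Definition zero_density (K1 K2 : R) (x y : R) : R :=
  let y1 := Y1 x y in let y2 := Y2 x y in let y3 := Y3 x y in
  let d0 := D0 x y in let d1 := D1 x y in let d2 := D2 x y in
  let d3 := D3 x y in
  (2 * pi * d0)^-1 *
  expR (- ((K1 ^+ 2 * y3 + K2 ^+ 2 * y1 - 2 * K1 * K2 * y2)
           / (2 * d0 ^+ 2))) *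
  (d3
   - Normc.normc d1 ^+ 2 / d0 *
     ((y2 + y3) / d0 -
      (K1 * y3 - K2 * y2) * (K1 * (y2 + y3) - K2 * (y1 + y2)) / d0 ^+ 3)
   - Normc.normc d2 ^+ 2 / d0 *
     ((y1 + y2) / d0 -
      (K1 * y2 - K2 * y1) * (K1 * (y2 + y3) - K2 * (y1 + y2)) / d0 ^+ 3)
   + Normc.normc (d1 + 'i%C * d2) ^+ 2 / d0 *
     (y2 / d0 -
      (K1 * y3 - K2 * y2) * (K1 * y2 - K2 * y1) / d0 ^+ 3)).

End density.

(* Main.v *)
From HB Require Import structures.
Require Import Defs.
From mathcomp Require Import fsbigop numfun realfun charge ring lra.

(** Summation by parts writes the random sum in terms of the increments, and
    division by their standard deviations turns it into a combination
    S(z) = sum_j zeta_j a_j(z) of entire functions a_j with independent standard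
    normal zeta_j ([random_sumE], [normalized_gauss_family]); increments of zero
    variance vanish almost surely and are dropped. At each z the values S(z) and
    S'(z) are jointly Gaussian, and D_0(z) > 0 says that S(z) has a density on the
    plane.

    The formula is of Kac-Rice type. In a small square of side r at z0 the map S is
    nearly affine with slope S'(z0), so that S - K vanishes there if and only if
    K - S(z0) lies in the image of a square of side r under multiplication by S'(z0),
    a square of area r^2 |S'(z0)|^2. The probability of this is r^2 h(z0) to leading
    order, where h(z) is the density of S(z) at K times the conditional
    expectation of |S'(z)|^2 given S(z) = K. The expression in the theorem is h,
    written with the covariances of S and S' ([kr_density], [zero_densityE]).

    The estimate with error O(r^3) is [cell_probability]. An orthogonal change of
    the Gaussian variables makes S(z0) depend on two of them only and splits S'(z0)
    into a part that depends on these two and a part independent of them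
    ([regression_exists]). With the second part frozen, the event is squeezed
    between two squares in the plane of the first two variables, rotated by the
    argument of the slope ([zero_in_cell_window], [window_zero_in_cell]), whose
    Gaussian measure is explicit up to lower order; averaging over the frozen part
    gives h. In the same way both S - K and S' vanish in the cell with probability
    O(r^4) only. These estimates need bounds on S' and on its Lipschitz constant,
    for functions that are merely assumed to be complex differentiable; they follow
    from Goursat's theorem on squares and a Cauchy estimate on the unit circle
    ([boundary_integral_eq0], [deriv_bound], [entire_C11]).

    To globalize, cut a bounded open set into the cells of a grid. The number of
    cells that contain a zero is at most the number of zeros and converges to it
    as the mesh tends to 0, while its expectation is a Riemann sum of h up to a
    term of the order of the mesh. Fatou's lemma and dominated convergence give
    [expected_nb_zeros_open]. Summed over the cells, the O(r^4) bound shows that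
    almost surely all zeros are simple, so that multiplicities do not matter
    ([negligible_double_zero]). Finally a compact T is the difference G \ (G \ T)
    of two open sets, where G is a bounded neighborhood of T on which D_0 stays
    away from 0, and the two expectations are finite ([expected_nb_zeros]). *)

Set Implicit Arguments.
Unset Strict Implicit.
Unset Printing Implicit Defensive.

Local Open Scope classical_set_scope.
Local Open Scope ring_scope.

(** * Linear changes of variables for the Lebesgue measure of the plane *)
(** Packages the pushforward as a measure, so that it can be fed to the
    uniqueness theorems for measures without carrying its measurability proof. *)
Lemma pushforward_measure_exists d1 d2 (T1 : measurableType d1)
    (T2 : measurableType d2) (R : realType) (m : {measure set T1 -> \bar R})
    (f : T1 -> T2) : measurable_fun setT f ->
  exists nu : {measure set T2 -> \bar R}, forall A, nu A = m (f @^-1` A).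
Proof.
move=> mf.
by exists (measure_function_pushforward__canonical__measure_function_Measure m mf).
Qed.

Section plane_measure.
Context {R : realType}.
Local Notation mu := (@lebesgue_measure R).
Local Notation mu2 := (mu \x mu)%E.

Lemma measurable_affine (a b : R) : measurable_fun setT (fun t : R => a * t + b).
Proof. by apply: measurable_funD => //; apply: measurable_funM. Qed.

(** Both sides are measures in E up to the factor |a|, and they agree on
    half-open intervals. *)
Lemma lebesgue_measure_affine (a b : R) (E : set R) : a != 0 -> measurable E ->
  mu ((fun t => a * t + b) @^-1` E) = (`|a|^-1%:E * mu E)%E.
Proof.
move=> a0 mE.
have na0 : 0 < `|a| by rewrite normr_gt0.
pose T t : measurableTypeR R := a * t + b.
have mT : measurable_fun setT T by exact: measurable_affine.
have [nu0 nu0E] := pushforward_measure_exists mu mT.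
pose nu : {measure set (measurableTypeR R) -> \bar R} := mscale (NngNum (ltW na0)) nu0.
have -> : mu E = nu E.
  apply: (@lebesgue_measure_unique _ nu) => // _ [[x y]] _ <-.
  rewrite /nu /= /mscale /= nu0E lebesgue_measure_itv /=.
  have [ap|an] := ltP 0 a.
    rewrite (_ : T @^-1` _ = `](x - b) / a, (y - b) / a]%classic); last first.
      apply/seteqP; split=> t /=; rewrite !in_itv /= /T ltr_pdivrMr// ler_pdivlMr//.
        by move=> /andP[? ?]; apply/andP; split; lra.
      by move=> /andP[? ?]; apply/andP; split; lra.
    rewrite lebesgue_measure_itv /= !lte_fin ltr_pM2r ?invr_gt0// ltrD2r.
    case: ifP => _; last by rewrite mule0.
    rewrite -!EFinB -EFinM gtr0_norm//; congr (_%:E); field; exact: a0.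
  have an' : a < 0 by rewrite lt_neqAle a0.
  rewrite (_ : T @^-1` _ = `[(y - b) / a, (x - b) / a[%classic); last first.
    apply/seteqP; split=> t /=; rewrite !in_itv /= /T ltr_ndivlMr// ler_ndivrMr//.
      by move=> /andP[? ?]; apply/andP; split; lra.
    by move=> /andP[? ?]; apply/andP; split; lra.
  rewrite lebesgue_measure_itv /= !lte_fin ltr_nM2r ?invr_lt0// ltrD2r.
  case: ifP => _; last by rewrite mule0.
  rewrite -!EFinB -EFinM ltr0_norm//; congr (_%:E); field; exact: a0.
rewrite /nu /= /mscale /= nu0E muleA -EFinM mulVf ?mul1e//.
by rewrite gt_eqF.
Qed.

Lemma lebesgue_measure2E (A : set (R * R)) : measurable A ->
  mu2 A = (mu \x^ mu)%E A.
Proof.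
by move=> mA; apply: product_measure_unique => // B C mB mC /=; rewrite product_measure2E.
Qed.

Lemma measurable_affine2 (a b e : R) :
  measurable_fun setT (fun p : R * R => a * p.1 + b * p.2 + e).
Proof.
by apply: measurable_funD => //; apply: measurable_funD; apply: measurable_funM.
Qed.

Lemma measurable_affine_map (a b e c d f : R) :
  measurable_fun setT
    (fun p : R * R => (a * p.1 + b * p.2 + e, c * p.1 + d * p.2 + f)).
Proof. by apply/measurable_fun_pair => /=; exact: measurable_affine2. Qed.

Lemma measurable_preim d1 d2 (T1 : measurableType d1) (T2 : measurableType d2)
  (f : T1 -> T2) (A : set T2) : measurable_fun setT f -> measurable A ->
  measurable (f @^-1` A).
Proof. by move=> mf mA; rewrite -[_ @^-1` _]setTI; exact: mf. Qed.

Let shear1 (a b e : R) (A : set (R * R)) : a != 0 -> measurable A ->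
  mu2 ((fun p => (a * p.1 + b * p.2 + e, p.2)) @^-1` A) = (`|a|^-1%:E * mu2 A)%E.
Proof.
move=> a0 mA.
have mT : measurable_fun setT (fun p : R * R => (a * p.1 + b * p.2 + e, p.2)).
  by apply/measurable_fun_pair => //; exact: measurable_affine2.
rewrite !lebesgue_measure2E//; last exact: measurable_preim.
rewrite /product_measure2 -ge0_integralZl//=; last first.
  exact: measurable_fun_ysection.
apply: eq_integral => y _ /=.
rewrite -(@lebesgue_measure_affine a (b * y + e))//; last exact: measurable_ysection.
by congr (mu _); apply/seteqP; split=> x; rewrite /ysection /= !inE /= addrA.
Qed.

Let shear2 (c d f : R) (A : set (R * R)) : d != 0 -> measurable A ->
  mu2 ((fun p => (p.1, c * p.1 + d * p.2 + f)) @^-1` A) = (`|d|^-1%:E * mu2 A)%E.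
Proof.
move=> d0 mA.
have mT : measurable_fun setT (fun p : R * R => (p.1, c * p.1 + d * p.2 + f)).
  by apply/measurable_fun_pair => //; exact: measurable_affine2.
rewrite /product_measure1 -ge0_integralZl//=; last first.
  exact: measurable_fun_xsection.
apply: eq_integral => x _ /=.
rewrite -(@lebesgue_measure_affine d (c * x + f))//; last exact: measurable_xsection.
congr (mu _); apply/seteqP; split=> y; rewrite /xsection /= !inE /=.
  by rewrite (_ : d * y + _ = c * x + d * y + f)//; ring.
by rewrite (_ : d * y + _ = c * x + d * y + f)//; ring.
Qed.

(** An affine map with a nonzero entry in its upper left corner is the product of
    two shears, each of which acts on the sections parallel to an axis as an
    affine map of the line; the determinant is the product of the two dilations. *)
Lemma lebesgue_measure2_affine (a b e c d f : R) (A : set (R * R)) :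
  a * d - b * c != 0 -> measurable A ->
  mu2 ((fun p => (a * p.1 + b * p.2 + e, c * p.1 + d * p.2 + f)) @^-1` A) =
  (`|a * d - b * c|^-1%:E * mu2 A)%E.
Proof.
have key (a' b' c' d' e' f' : R) B : a' != 0 -> a' * d' - b' * c' != 0 -> measurable B ->
    mu2 ((fun p => (a' * p.1 + b' * p.2 + e', c' * p.1 + d' * p.2 + f')) @^-1` B) =
    (`|a' * d' - b' * c'|^-1%:E * mu2 B)%E.
  move=> a0 D0 mB; set D := a' * d' - b' * c' in D0 *.
  have Da : D / a' != 0 by rewrite mulf_neq0// invr_neq0.
  have -> : (fun p : R * R => (a' * p.1 + b' * p.2 + e', c' * p.1 + d' * p.2 + f')) @^-1` B =
    (fun p => (a' * p.1 + b' * p.2 + e', p.2)) @^-1`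
     ((fun p => (p.1, (c' / a') * p.1 + (D / a') * p.2 + (f' - c' / a' * e'))) @^-1` B).
    apply/seteqP; split=> -[x y] /=; (congr (B (_, _)); rewrite /D; field; exact: a0).
  rewrite shear1// ?shear2//; last first.
    apply: measurable_preim => //; apply/measurable_fun_pair => //.
    exact: measurable_affine2.
  rewrite muleA -EFinM -invfM normrM normfV; congr (_%:E * _)%E; congr (_^-1).
  by rewrite mulrCA divff ?mulr1// normr_eq0.
(* If a = 0 then b != 0, and composition with a shear of determinant 1, which
   preserves area, puts b in the corner. *)
move=> D0 mA; have [a0|a0] := eqVneq a 0; last exact: key.
have b0 : b != 0 by apply: contra_neq D0 => ->; rewrite a0; ring.
pose M p : R * R := (a * p.1 + b * p.2 + e, c * p.1 + d * p.2 + f).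
have mM : measurable (M @^-1` A).
  by apply: measurable_preim => //; exact: measurable_affine_map.
transitivity (mu2 ((fun p => (p.1, 1 * p.1 + 1 * p.2 + 0)) @^-1` (M @^-1` A))).
  by rewrite (shear2 _ _ (oner_neq0 _))// normr1 invr1 mul1e.
rewrite (_ : _ @^-1` _ = (fun p => (b * p.1 + b * p.2 + e, (c + d) * p.1 + d * p.2 + f)) @^-1` A); last first.
  by apply/seteqP; split=> -[x y]; rewrite /= /M /=; congr (A (_, _)); rewrite ?a0; ring.
rewrite key//; last by rewrite (_ : _ - _ = a * d - b * c)// a0; ring.
by rewrite (_ : b * d - b * (c + d) = a * d - b * c)// a0; ring.
Qed.

End plane_measure.

(** * The standard Gaussian measures of the line and of the plane *)
Lemma ge0_integral_density d (T : measurableType d) (R : realType)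
    (m : {sigma_finite_measure set T -> \bar R})
    (nu : {finite_measure set T -> \bar R}) (g : T -> R) :
  measurable_fun setT g -> (forall x, 0 <= g x) ->
  (forall A, measurable A -> nu A = (\int[m]_(x in A) (g x)%:E)%E) ->
  forall f : T -> \bar R, (forall x, (0 <= f x)%E) -> measurable_fun setT f ->
  (\int[nu]_x f x = \int[m]_x (f x * (g x)%:E))%E.
Proof.
move=> mg g0 nuE f f0 mf.
have mgE : measurable_fun setT (EFin \o g) by exact/measurable_EFinP.
have nm : nu `<< m.
  apply/null_content_dominatesP => A mA mA0; rewrite nuE//.
  by apply: null_set_integral => //; apply: measurable_funTS.
rewrite -(Radon_Nikodym_SigmaFinite.change_of_variables nm)//.
apply: ae_eq_integral => //; first 2 last.
- apply: ae_eqe_mul2l; apply: integral_ae_eq => //.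
  + exact: Radon_Nikodym_SigmaFinite.f_integrable.
  + by move=> A _ mA; rewrite -Radon_Nikodym_SigmaFinite.f_integral// nuE.
- apply: emeasurable_funM => //.
  exact: measurable_int (Radon_Nikodym_SigmaFinite.f_integrable _).
- exact: emeasurable_funM.
Qed.

Lemma ge0_integral_lin2 d (T : measurableType d) (R : realType)
    (m : {measure set T -> \bar R}) (f g : T -> R) (a b : R) :
  0 <= a -> 0 <= b -> (forall x, 0 <= f x) -> (forall x, 0 <= g x) ->
  measurable_fun setT f -> measurable_fun setT g ->
  (\int[m]_x (a * f x + b * g x)%:E =
   a%:E * \int[m]_x (f x)%:E + b%:E * \int[m]_x (g x)%:E)%E.
Proof.
move=> a0 b0 f0 g0 mf mg.
have mfE : measurable_fun setT (fun x => (f x)%:E) by exact/measurable_EFinP.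
have mgE : measurable_fun setT (fun x => (g x)%:E) by exact/measurable_EFinP.
rewrite -[X in (X + _)%E]ge0_integralZl//; last by move=> x _; rewrite lee_fin.
rewrite -[X in (_ + X)%E]ge0_integralZl//; last by move=> x _; rewrite lee_fin.
rewrite -ge0_integralD//.
- by move=> x _; rewrite mule_ge0// lee_fin.
- exact: emeasurable_funM.
- by move=> x _; rewrite mule_ge0// lee_fin.
- exact: emeasurable_funM.
Qed.

Lemma le_ge0_integral_EFin d (T : measurableType d) (R : realType)
    (m : {measure set T -> \bar R}) (f g : T -> R) :
  (forall x, 0 <= f x <= g x) ->
  measurable_fun setT f -> measurable_fun setT g ->
  (\int[m]_x (f x)%:E <= \int[m]_x (g x)%:E)%E.
Proof.
move=> fg mf mg; apply: ge0_le_integral => //.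
- by move=> x _; rewrite lee_fin; case/andP: (fg x).
- exact/measurable_EFinP.
- exact/measurable_EFinP.
- by move=> x _; rewrite lee_fin; case/andP: (fg x).
Qed.

Section gaussian.
Context {R : realType}.
Local Notation mu := (@lebesgue_measure R).
Local Notation mu2 := (mu \x mu)%E.

Definition gauss : probability (measurableTypeR R) R := normal_prob 0 1.
Definition gauss2 : probability (measurableTypeR R * measurableTypeR R)%type R :=
  (gauss \x gauss)%E.

Definition gauss_pdf : R -> R := normal_pdf 0 1.
Definition gauss2_pdf (p : R * R) : R := gauss_pdf p.1 * gauss_pdf p.2.

Lemma gauss_pdfE x : gauss_pdf x = (Num.sqrt (pi *+ 2))^-1 * expR (- (x ^+ 2 / 2)).
Proof.
rewrite /gauss_pdf normal_pdfE ?oner_neq0// /normal_peak /normal_fun.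
by rewrite expr1n mul1r subr0 mulNr.
Qed.

Lemma gauss2_pdfE x y :
  gauss2_pdf (x, y) = (2 * pi)^-1 * expR (- ((x ^+ 2 + y ^+ 2) / 2)).
Proof.
rewrite /gauss2_pdf !gauss_pdfE mulrACA -invfM -expr2 sqr_sqrtr; last first.
  by rewrite mulrn_wge0// pi_ge0.
rewrite -expRD; congr (_^-1 * expR _); first by rewrite mulr_natl.
by rewrite /=; lra.
Qed.

Lemma gauss2_pdf_ge0 p : 0 <= gauss2_pdf p.
Proof. by rewrite mulr_ge0// normal_pdf_ge0. Qed.

Lemma measurable_gauss_pdf : measurable_fun setT gauss_pdf.
Proof. exact: measurable_normal_pdf. Qed.

Lemma measurable_gauss2_pdf : measurable_fun setT gauss2_pdf.
Proof.
apply: measurable_funM; apply: measurableT_comp => //; exact: measurable_gauss_pdf.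
Qed.

Lemma ge0_integral_gauss (f : R -> \bar R) :
  (forall x, (0 <= f x)%E) -> measurable_fun setT f ->
  (\int[gauss]_x f x = \int[mu]_x (f x * (gauss_pdf x)%:E))%E.
Proof.
move=> f0 mf; apply: ge0_integral_density => //; first exact: measurable_gauss_pdf.
by move=> x; exact: normal_pdf_ge0.
Qed.

Lemma gauss2E A : measurable A ->
  gauss2 A = (\int[mu2]_(p in A) (gauss2_pdf p)%:E)%E.
Proof.
move=> mA; rewrite integral_mkcond.
have mg : measurable_fun setT (fun p : R * R => (gauss2_pdf p)%:E).
  by apply/measurable_EFinP; exact: measurable_gauss2_pdf.
rewrite fubini_tonelli1//; last 2 first.
- have /(_ _)/(measurable_restrictT _ mA) := measurable_funTS mg; exact.
- move=> p; rewrite patchE; case: ifP => // _; rewrite lee_fin; exact: gauss2_pdf_ge0.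
transitivity (\int[gauss]_x gauss (xsection A x))%E; first by [].
rewrite ge0_integral_gauss//; last first.
  exact: measurable_fun_xsection.
apply: eq_integral => x _; rewrite /fubini_F /=.
have mAx : measurable (xsection A x) by exact: measurable_xsection.
rewrite /gauss /= /normal_prob muleC -ge0_integralZl//; last 3 first.
- by apply: measurable_funTS; apply/measurable_EFinP; exact: measurable_gauss_pdf.
- by move=> y _; rewrite lee_fin; exact: normal_pdf_ge0.
- by rewrite lee_fin; exact: normal_pdf_ge0.
rewrite [LHS]integral_mkcond; apply: eq_integral => y _; rewrite !patchE.
by rewrite mem_xsection; case: ifP.
Qed.

Lemma gauss2_pdf_rotation (c s x y : R) : c ^+ 2 + s ^+ 2 = 1 ->
  gauss2_pdf (c * x + s * y, - s * x + c * y) = gauss2_pdf (x, y).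
Proof.
move=> cs; rewrite !gauss2_pdfE.
rewrite (_ : (c * x + s * y) ^+ 2 + _ = x ^+ 2 + y ^+ 2)//.
transitivity ((c ^+ 2 + s ^+ 2) * (x ^+ 2 + y ^+ 2)); first by ring.
by rewrite cs mul1r.
Qed.

(** The density depends on the distance to the origin only, and rotations
    preserve the Lebesgue measure. *)
Lemma gauss2_rotation (c s : R) (A : set (measurableTypeR R * measurableTypeR R)) :
  c ^+ 2 + s ^+ 2 = 1 -> measurable A ->
  gauss2 ((fun p => (c * p.1 + s * p.2, - s * p.1 + c * p.2)) @^-1` A) = gauss2 A.
Proof.
move=> cs mA.
pose T (p : measurableTypeR R * measurableTypeR R) :
  measurableTypeR R * measurableTypeR R := (c * p.1 + s * p.2, - s * p.1 + c * p.2).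
have TE : T = fun p => (c * p.1 + s * p.2 + 0, - s * p.1 + c * p.2 + 0).
  by apply/funext => p; rewrite !addr0.
have mT : measurable_fun setT T by rewrite TE; exact: measurable_affine_map.
have det1 : c * c - s * - s = 1 by rewrite -cs; ring.
rewrite -[_ @^-1` A]/(T @^-1` A) !gauss2E//; last exact: measurable_preim.
transitivity (\int[mu2]_(p in T @^-1` A) ((EFin \o gauss2_pdf) \o T) p)%E.
  by apply: eq_integral => -[x y] _; rewrite /comp /T gauss2_pdf_rotation.
have mg : measurable_fun A (EFin \o gauss2_pdf).
  by apply: measurable_funTS; apply/measurable_EFinP; exact: measurable_gauss2_pdf.
have g0 : {in A, forall p, (0 <= (EFin \o gauss2_pdf) p)%E}.
  by move=> p _; rewrite lee_fin gauss2_pdf_ge0.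
rewrite -(ge0_integral_pushforward mT mu2 mA mg g0).
apply: eq_measure_integral => B mB _.
transitivity (mu2 (T @^-1` B)); first by [].
rewrite TE lebesgue_measure2_affine//; last by rewrite det1 oner_neq0.
by rewrite det1 normr1 invr1 mul1e.
Qed.

Lemma measurable_sqrE : measurable_fun setT (fun x : R => (x ^+ 2)%:E).
Proof. by apply/measurable_EFinP; exact: measurable_funX. Qed.

(** Comparison of the normal densities of standard deviations t and 1. The second
    moment and the bound on higher moments are both read off this formula. *)
Lemma scaled_normal_pdfE (t x : R) : 0 < t ->
  t * normal_pdf 0 t x = gauss_pdf x * expR ((1 - t ^- 2) * x ^+ 2 / 2).
Proof.
move=> t0; have tn0 : t != 0 by rewrite gt_eqF.
rewrite gauss_pdfE normal_pdfE// /normal_peak /normal_fun subr0 -[RHS]mulrA -expRD.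
rewrite mulrA -mulrnAr sqrtrM ?sqr_ge0// sqrtr_sqr gtr0_norm// invfM mulrA.
by rewrite divff// mul1r; congr (_ * expR _); field.
Qed.

(** The integral over x of t times the normal density of deviation t is t. By the
    formula for that function and exp u >= 1 + u, this integral is at least
    1 + ((1 - t^-2) / 2) m, where m is the second moment. For t > 1 and t < 1
    the factor of m has opposite signs; letting t tend to 1 from both sides
    squeezes m to 1, with no integration by parts. *)
Lemma gauss_variance : (\int[gauss]_x (x ^+ 2)%:E = 1)%E.
Proof.
rewrite ge0_integral_gauss; last 2 first.
- by move=> x; rewrite lee_fin sqr_ge0.
- exact: measurable_sqrE.
have -> : (\int[mu]_x ((x ^+ 2)%:E * (gauss_pdf x)%:E) =
  \int[mu]_x (x ^+ 2 * gauss_pdf x)%:E)%E by [].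
set m := (X in X = _).
have sq0 x : 0 <= x ^+ 2 * gauss_pdf x by rewrite mulr_ge0 ?sqr_ge0 ?normal_pdf_ge0.
have m0 : (0 <= m)%E by apply: integral_ge0 => x _; rewrite lee_fin.
have mpdf t : measurable_fun setT (fun x : measurableTypeR R => normal_pdf 0 t x).
  exact: measurable_normal_pdf.
have msq : measurable_fun setT (fun x : measurableTypeR R => x ^+ 2 * gauss_pdf x).
  by apply: measurable_funM; [exact: measurable_funX|exact: mpdf].
have lin (t c : R) : 0 <= t -> 0 <= c ->
    (\int[mu]_x (t * normal_pdf 0 t x + c * (x ^+ 2 * gauss_pdf x))%:E
     = t%:E + c%:E * m)%E.
  move=> t0 c0; rewrite ge0_integral_lin2// ?integral_normal_pdf ?mule1//.
  by move=> x; exact: normal_pdf_ge0.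
have up (t : R) : 1 < t -> (1 + ((1 - t ^- 2) / 2)%:E * m <= t%:E)%E.
  move=> t1; have t0 : 0 < t by lra.
  have c0 : 0 <= (1 - t ^- 2) / 2.
    by rewrite divr_ge0// subr_ge0 invf_le1 ?exprn_gt0// exprn_ege1// ltW.
  have := lin t 0 (ltW t0) (lexx _); rewrite mul0e adde0 => <-.
  rewrite -lin//; apply: le_ge0_integral_EFin => //.
  - move=> x; apply/andP; split.
      by rewrite addr_ge0// mulr_ge0// normal_pdf_ge0.
    rewrite mul0r addr0 (@scaled_normal_pdfE t)// mul1r.
    have := ler_wpM2l (normal_pdf_ge0 0 1 x) (expR_ge1Dx ((1 - t ^- 2) * x ^+ 2 / 2)).
    rewrite /gauss_pdf; move: (t ^- 2) => q.
    by move: (normal_pdf _ _ _) (expR _) => g e; lra.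
  - by apply: measurable_funD; apply: measurable_funM.
  - by apply: measurable_funD; apply: measurable_funM.
have dn (t : R) : 0 < t < 1 -> (1 <= t%:E + ((t ^- 2 - 1) / 2)%:E * m)%E.
  move=> /andP[t0 t1].
  have c0 : 0 <= (t ^- 2 - 1) / 2.
    by rewrite divr_ge0// subr_ge0 invf_ge1 ?exprn_gt0// expr_le1// ltW.
  have := lin 1 0 ler01 (lexx _); rewrite mul0e adde0 => <-.
  rewrite -(lin t _ (ltW t0) c0); apply: le_ge0_integral_EFin => //.
  - move=> x; rewrite mul0r addr0 mul1r; apply/andP; split.
      exact: normal_pdf_ge0.
    rewrite (@scaled_normal_pdfE t)//.
    have := ler_wpM2l (normal_pdf_ge0 0 1 x) (expR_ge1Dx ((1 - t ^- 2) * x ^+ 2 / 2)).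
    rewrite /gauss_pdf; move: (t ^- 2) => q.
    by move: (normal_pdf _ _ _) (expR _) => g e; lra.
  - by apply: measurable_funD; apply: measurable_funM.
  - by apply: measurable_funD; apply: measurable_funM.
have mfin : m \is a fin_num.
  rewrite ge0_fin_numE//; have := up 2; rewrite ltr1n => /(_ isT).
  have c0 : 0 < (1 - (2 : R) ^- 2) / 2 by lra.
  move=> h; rewrite ltey; apply/eqP => my; move: h.
  by rewrite my gt0_muley ?lte_fin// addey// leye_eq.
move: m0 up dn; rewrite -(fineK mfin); move: (fine m) => {mfin msq sq0 lin} r.
rewrite lee_fin => r0 up dn; congr (_%:E).
have {}up (e : R) : 0 < e -> r <= (1 + e) ^+ 2.
  move=> e0; have := up (1 + e); rewrite ltrDl => /(_ e0).
  rewrite -EFinM -EFinD lee_fin => h.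
  have t0 : 0 < 1 + e by lra.
  have : e * (2 + e) * r <= 2 * e * (1 + e) ^+ 2.
    have -> : e * (2 + e) * r = 2 * (1 + e) ^+ 2 * ((1 - (1 + e) ^- 2) / 2 * r).
      by field; rewrite gt_eqF.
    have := exprn_gt0 2 t0; set q := (1 + e) ^+ 2 in h *.
    by move=> q0; nra.
  by have := exprn_gt0 2 t0; set q := (1 + e) ^+ 2; nra.
have {}dn (e : R) : 0 < e < 1 -> (1 - e) ^+ 2 <= r.
  move=> /andP[e0 e1]; have := dn (1 - e); rewrite subr_gt0 e1 ltrBlDr ltrDl e0.
  move=> /(_ isT); rewrite -EFinM -EFinD lee_fin => h.
  have t0 : 0 < 1 - e by lra.
  have : 2 * e * (1 - e) ^+ 2 <= e * (2 - e) * r.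
    have -> : e * (2 - e) * r = 2 * (1 - e) ^+ 2 * (((1 - e) ^- 2 - 1) / 2 * r).
      by field; rewrite gt_eqF.
    have := exprn_gt0 2 t0; set q := (1 - e) ^+ 2 in h *.
    by move=> q0; nra.
  by have := exprn_gt0 2 t0; set q := (1 - e) ^+ 2; nra.
apply/eqP; rewrite eq_le; apply/andP; split; rewrite leNgt; apply/negP => h.
  have e0 : 0 < (r - 1) / 4 by rewrite divr_gt0 ?subr_gt0.
  have := up _ e0; have [e1|e1] := leP 1 ((r - 1) / 4).
    by have := up _ ltr01; lra.
  have -> : r = 1 + 4 * ((r - 1) / 4) by field.
  move: ((r - 1) / 4) e0 e1 => e e0 e1.
  rewrite (_ : 1 + 4 * e - 1 = 4 * e); last by ring.
  rewrite mulrAC mulfV ?mul1r; last by [].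
  by move=> ?; nra.
have e0 : 0 < (1 - r) / 4 by rewrite divr_gt0 ?subr_gt0.
have := dn ((1 - r) / 4); rewrite e0/=.
have -> : (1 - r) / 4 < 1 by lra.
by move=> /(_ isT) ?; nra.
Qed.

(** Symmetry of the Gaussian measure. *)
Lemma ge0_integral_gaussN (f : R -> \bar R) :
  (forall x, (0 <= f x)%E) -> measurable_fun setT f ->
  (\int[gauss]_x f (- x)%R = \int[gauss]_x f x)%E.
Proof.
move=> f0 mf.
have mN : measurable_fun setT (-%R : measurableTypeR R -> measurableTypeR R) by [].
have f0' : {in setT, forall y, (0 <= f y)%E} by move=> y _.
rewrite -[LHS](ge0_integral_pushforward mN gauss measurableT mf f0').
apply: eq_measure_integral => A mA _.
transitivity (gauss (-%R @^-1` A)); first by [].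
have mNA : measurable (-%R @^-1` A : set (measurableTypeR R)) by exact: measurable_preim.
have mg (B : set (measurableTypeR R)) : measurable_fun B (fun x => (gauss_pdf x)%:E).
  by apply: measurable_funTS; apply/measurable_EFinP; exact: measurable_gauss_pdf.
transitivity (\int[mu]_(x in A) (gauss_pdf x)%:E)%E; last by [].
transitivity (\int[mu]_(x in -%R @^-1` A) (((fun x => (gauss_pdf x)%:E) \o -%R) x))%E.
  apply: eq_integral => x _; congr (_%:E).
  have gN : gauss_pdf x = gauss_pdf (- (x : R)) by rewrite !gauss_pdfE sqrrN.
  exact: gN.
have g0 : {in A, forall y, (0 <= (gauss_pdf y)%:E)%E}.
  by move=> y _; rewrite lee_fin normal_pdf_ge0.
rewrite -(ge0_integral_pushforward mN mu mA (mg A) g0).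
by apply: eq_measure_integral => B mB _; rewrite -[RHS]lebesgue_measureN.
Qed.

(** Adding the integral to its image under x -> - x cancels the cross term, whose
    own integrability is then never in question. *)
Lemma integral_gauss_sqr_affine (v k : R) :
  (\int[gauss]_x ((v + k * x) ^+ 2)%:E = (v ^+ 2 + k ^+ 2)%:E)%E.
Proof.
have mq (a : R) : measurable_fun setT (fun x : measurableTypeR R => (v + a * x) ^+ 2).
  by apply: measurable_funX; apply: measurable_funD => //; exact: measurable_funM.
set X := (X in X = _).
have XN : X = (\int[gauss]_x ((v + - k * x) ^+ 2)%:E)%E.
  rewrite /X -[LHS](@ge0_integral_gaussN (fun x => ((v + k * x) ^+ 2)%:E)).
  - by apply: eq_integral => x _; rewrite mulrN mulNr.
  - by move=> x; rewrite lee_fin sqr_ge0.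
  - by apply/measurable_EFinP; exact: mq.
have : (1%:E * X + 1%:E * X = (v ^+ 2 + k ^+ 2)%:E + (v ^+ 2 + k ^+ 2)%:E)%E.
  rewrite [X in (_ + _ * X)%E]XN.
  rewrite -(ge0_integral_lin2 gauss ler01 ler01 (fun x => sqr_ge0 (v + k * x))
    (fun x => sqr_ge0 (v + - k * x)) (mq k) (mq (- k))).
  transitivity (\int[gauss]_x ((2 * v ^+ 2) * 1 + (2 * k ^+ 2) * x ^+ 2)%:E)%E.
    by apply: eq_integral => x _; congr (_%:E); ring.
  have h (a : R) : 0 <= 2 * a ^+ 2 by rewrite mulr_ge0// sqr_ge0.
  have m2 : measurable_fun setT (fun x : measurableTypeR R => x ^+ 2).
    exact: measurable_funX.
  rewrite (ge0_integral_lin2 gauss (h v) (h k) (fun=> ler01) (@sqr_ge0 R) _ m2)//.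
  rewrite gauss_variance integral_cst//= probability_setT !mule1 -!EFinD.
  by congr (_%:E); ring.
rewrite mul1e; have : (0 <= X)%E by apply: integral_ge0 => x _; rewrite lee_fin sqr_ge0.
move: X {XN} => [x| |]//= x0; rewrite -!EFinD => -[] ?; congr (_%:E); lra.
Qed.

(** Since 1 + x^2 <= (32/3) (1 + 3 x^2 / 32) <= (32/3) exp (3 x^2 / 32), the fourth
    power is at most a multiple of exp (3 x^2 / 8), which is twice the ratio of the
    normal density of deviation 2 to the standard one. *)
Lemma gauss_moment8 : exists C : R,
  0 <= C /\ (\int[gauss]_x ((1 + x ^+ 2) ^+ 4)%:E <= C%:E)%E.
Proof.
pose C : R := (32 / 3) ^+ 4 * 2.
have C0 : 0 <= C by rewrite mulr_ge0// exprn_ge0// divr_ge0.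
exists C; split => //.
have mp : measurable_fun setT (fun x : measurableTypeR R => (1 + x ^+ 2) ^+ 4).
  by apply: measurable_funX; apply: measurable_funD => //; exact: measurable_funX.
have p0 (x : R) : 0 <= (1 + x ^+ 2) ^+ 4 by rewrite exprn_ge0// addr_ge0// sqr_ge0.
rewrite ge0_integral_gauss; last 2 first.
- by move=> x; rewrite lee_fin.
- by apply/measurable_EFinP; exact: mp.
have -> : C%:E = (\int[mu]_x (C * normal_pdf 0 2 x + 0 * normal_pdf 0 2 x)%:E)%E.
  have m2 : measurable_fun setT (fun x : measurableTypeR R => normal_pdf 0 2 x).
    exact: measurable_normal_pdf.
  have h := @normal_pdf_ge0 R 0 2.
  rewrite (ge0_integral_lin2 mu C0 (lexx 0) h h m2 m2).
  by rewrite integral_normal_pdf mul0e adde0 mule1.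
apply: (@le_trans _ _ (\int[mu]_x ((1 + x ^+ 2) ^+ 4 * gauss_pdf x)%:E)%E); first by [].
apply: le_ge0_integral_EFin.
- move=> x; rewrite mulr_ge0 ?normal_pdf_ge0//= mul0r addr0.
  rewrite /C -[X in _ <= X]mulrA (@scaled_normal_pdfE 2)// mulrCA mulrC.
  rewrite ler_wpM2l ?normal_pdf_ge0//.
  have -> : (1 - 2 ^- 2) * x ^+ 2 / 2 = 4%:R * (3 / 32 * x ^+ 2) :> R by field.
  rewrite expRM_natl -exprMn lerXn2r ?nnegrE ?mulr_ge0 ?addr_ge0 ?sqr_ge0 ?expR_ge0//.
  by have := expR_ge1Dx (3 / 32 * x ^+ 2); have := sqr_ge0 x; lra.
- by apply: measurable_funM => //; exact: measurable_gauss_pdf.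
- by apply: measurable_funD; apply: measurable_funM => //; exact: measurable_normal_pdf.
Qed.

End gaussian.

(** * Independent standard Gaussian families *)

Lemma finite_measure_unique d (T : measurableType d) (R : realType)
    (G : set (set T)) (m1 m2 : {measure set T -> \bar R}) :
  G `<=` measurable -> setI_closed G -> G setT -> (m1 setT < +oo)%E ->
  (forall A, G A -> m1 A = m2 A) -> forall A, <<s G >> A -> m1 A = m2 A.
Proof.
move=> Gm GI GT m1oo m12 A GA.
apply: (@g_sigma_algebra_measure_unique _ _ _ G Gm (fun=> setT)) => //.
by rewrite bigcup_const.
Qed.

(** Rectangles form a pi-system that generates the product sigma-algebra. *)
Lemma measure_unique_rectangles d1 d2 (T1 : measurableType d1)
    (T2 : measurableType d2) (R : realType)
    (m1 m2 : {measure set (T1 * T2) -> \bar R}) :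
  (m1 setT < +oo)%E ->
  (forall A B, measurable A -> measurable B -> m1 (A `*` B) = m2 (A `*` B)) ->
  forall X, measurable X -> m1 X = m2 X.
Proof.
move=> m1oo m12 X mX.
pose C : set (set (T1 * T2)) := [set A `*` B | A in measurable & B in measurable].
apply: (@finite_measure_unique _ _ _ C) => //.
- by move=> _ [A mA [B mB <-]]; exact: measurableX.
- move=> _ _ [A mA [B mB <-]] [A' mA' [B' mB' <-]]; rewrite -setXI.
  by exists (A `&` A'); [exact: measurableI|exists (B `&` B') => //; exact: measurableI].
- by exists setT => //; exists setT => //; rewrite setXTT.
- by move=> _ [A mA [B mB <-]]; exact: m12.
- by rewrite -measurable_prod_measurableType.
Qed.

Lemma big_pair_split (V : nmodType) (J : finType) (F : J -> V) (i j : J) : i != j ->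
  \sum_k F k = F i + (F j + \sum_(k | (k != i) && (k != j)) F k).
Proof. by move=> ij; rewrite (bigD1 i)//= (bigD1 j)//= eq_sym. Qed.

Lemma measurable_lin2 d (T : measurableType d) (R : realType) (f g : T -> R) (a b : R) :
  measurable_fun setT (f : T -> measurableTypeR R) ->
  measurable_fun setT (g : T -> measurableTypeR R) ->
  measurable_fun setT ((fun w => a * f w + b * g w) : T -> measurableTypeR R).
Proof.
move=> mf mg.
have mf' : measurable_fun setT (f : T -> R) by exact: mf.
have mg' : measurable_fun setT (g : T -> R) by exact: mg.
have : measurable_fun setT ((fun w => a * f w + b * g w) : T -> R); last by [].
by apply: measurable_funD; apply: measurable_funM.
Qed.

(** A Givens rotation. Only these rotations are used: the law of a pair of
    coordinates is then the only one that has to be transported. *)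
Definition rotate (R : realType) (J : finType) (i j : J) (c s : R) (v : J -> R) : J -> R :=
  fun k => if k == i then c * v i + s * v j
           else if k == j then - s * v i + c * v j else v k.

Section gauss_family.
Context d (Omega : measurableType d) (R : realType) (P : probability Omega R).
Variable J : finType.
Implicit Types (X : J -> Omega -> R).
Local Notation plane := (measurableTypeR R * measurableTypeR R)%type.

(** Independent standard normal variables indexed by J. *)
Definition gauss_family X : Prop :=
  (forall j, measurable_fun setT (X j : Omega -> measurableTypeR R)) /\
  forall E : J -> set (measurableTypeR R), (forall j, measurable (E j)) ->
    P (\bigcap_(j in setT) X j @^-1` E j) = (\prod_j gauss (E j))%E.

Definition others X (i j : J) (E : J -> set (measurableTypeR R)) : set Omega :=
  \bigcap_(k in [set k | (k != i) && (k != j)]) X k @^-1` E k.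

Lemma measurable_others X i j E : gauss_family X -> (forall k, measurable (E k)) ->
  measurable (others X i j E).
Proof.
move=> [mX _] mE; apply: fin_bigcap_measurable; first exact: finite_finset.
move=> k _.
exact: measurable_preim (mX k) (mE k).
Qed.

Lemma gauss_family_pair X i j E B : gauss_family X -> i != j ->
  (forall k, measurable (E k)) -> measurable B ->
  P ([set w | B (X i w, X j w)] `&` others X i j E) =
  (gauss2 B * P (others X i j E))%E.
Proof.
move=> gX ij mE mB; have [mX PX] := gX.
have mD := measurable_others i j gX mE; set D := others X i j E in mD *.
pose XX w : plane := (X i w, X j w).
have mXX : measurable_fun setT XX by apply/measurable_fun_pair.
have [nu nuE] := pushforward_measure_exists (mrestr P mD) mXX.
have fD : P D \is a fin_num by rewrite fin_num_measure.
have pD : 0 <= fine (P D) by rewrite fine_ge0.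
pose nu2 : {measure set plane -> \bar R} := mscale (NngNum pD) gauss2.
have nu2E A : nu2 A = (gauss2 A * P D)%E.
  by rewrite /nu2 /= /mscale /= fineK// muleC.
rewrite -nu2E; transitivity (nu B); first by rewrite nuE.
apply: measure_unique_rectangles => //.
  rewrite nuE /= /mrestr preimage_setT setTI.
  by rewrite (le_lt_trans (probability_le1 P mD))// ltry.
move=> A A' mA mA'; rewrite nuE nu2E /= /mrestr.
rewrite [X in (X * _)%E](product_measure1E gauss gauss)//.
have fullE (F : J -> set (measurableTypeR R)) :
    others X i j F `&` (X i @^-1` F i `&` X j @^-1` F j) =
    \bigcap_(k in setT) X k @^-1` F k.
  apply/seteqP; split=> [w [wo [wi wj]] k _|w wa]; last first.
    by split; [move=> k _; exact: wa|split; exact: wa].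
  have [->|ki] := eqVneq k i; first exact: wi.
  have [->|kj] := eqVneq k j; first exact: wj.
  by apply: wo; rewrite /= ki kj.
pose F a b k := if k == i then a else if k == j then b else E k.
have mF a b : measurable a -> measurable b -> forall k, measurable (F a b k).
  by move=> ma mb k; rewrite /F; case: ifP => // _; case: ifP.
have oF a b : others X i j (F a b) = D.
  rewrite /others; apply: eq_bigcapr => k /= /andP[ki kj].
  by rewrite /F (negbTE ki) (negbTE kj).
have Fi a b : F a b i = a by rewrite /F eqxx.
have Fj a b : F a b j = b by rewrite /F eqxx eq_sym (negbTE ij).
have PF a b : measurable a -> measurable b ->
    P (D `&` (X i @^-1` a `&` X j @^-1` b)) =
    (gauss a * gauss b * \prod_(k | (k != i) && (k != j)) gauss (E k))%E.
  move=> ma mb; have := fullE (F a b); rewrite oF Fi Fj => ->.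
  rewrite PX; last exact: mF.
  rewrite (bigD1 i)//= (bigD1 j) 1?eq_sym//= Fi Fj muleA; congr (_ * _)%E.
  by apply: eq_bigr => k /andP[ki kj]; rewrite /F (negbTE ki) (negbTE kj).
have -> : P D = (\prod_(k | (k != i) && (k != j)) gauss (E k))%E.
  have := PF _ _ measurableT measurableT.
  by rewrite !preimage_setT !setIT !probability_setT !mul1e.
rewrite -PF//; congr (P _); rewrite setIC; congr (_ `&` _).
Qed.

(** The pair of coordinates that moves has the rotation-invariant law gauss2 and is
    independent of the coordinates that stay. *)
Lemma gauss_family_rotation X i j (c s : R) : gauss_family X -> i != j ->
  c ^+ 2 + s ^+ 2 = 1 ->
  gauss_family (fun k w => rotate i j c s (X^~ w) k).
Proof.
move=> gX ij cs; have [mX PX] := gX; split.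
  move=> k; rewrite /rotate; case: (k == i); first exact: measurable_lin2 (mX i) (mX j).
  by case: (k == j) => //; exact: measurable_lin2 (mX i) (mX j).
move=> E mE.
pose rot (p : plane) : plane := (c * p.1 + s * p.2, - s * p.1 + c * p.2).
have mrot : measurable_fun setT rot.
  have -> : rot = fun p => (c * p.1 + s * p.2 + 0, - s * p.1 + c * p.2 + 0).
    by apply/funext => p; rewrite !addr0.
  exact: measurable_affine_map.
rewrite (_ : \bigcap_(k in setT) _ =
   [set w | (rot @^-1` (E i `*` E j)) (X i w, X j w)] `&` others X i j E); last first.
  apply/seteqP; split=> [w wa|w [[wi wj] wo] k _].
    split; last first.
      move=> k /= /andP[ki kj]; have := wa k Logic.I.
      by rewrite /rotate /= (negbTE ki) (negbTE kj).
    split => /=; first by have := wa i Logic.I; rewrite /rotate /= eqxx.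
    by have := wa j Logic.I; rewrite /rotate /= eqxx eq_sym (negbTE ij).
  rewrite /rotate /=; case: ifPn => [/eqP ->|ki] //; case: ifPn => [/eqP ->|kj] //.
  by apply: wo; rewrite /= ki kj.
have mEE : measurable (E i `*` E j) by exact: measurableX.
rewrite gauss_family_pair//; last exact: measurable_preim.
rewrite gauss2_rotation// -gauss_family_pair// -PX//; congr (P _).
apply/seteqP; split=> [w [[wi wj] wo] k _|w wa].
  have [->|ki] := eqVneq k i; first exact: wi.
  have [->|kj] := eqVneq k j; first exact: wj.
  by apply: wo; rewrite /= ki kj.
by split; [split; exact: wa|move=> k _; exact: wa].
Qed.

Lemma gauss_family_marginal X i (B : set (measurableTypeR R)) :
  gauss_family X -> measurable B -> P (X i @^-1` B) = gauss B.
Proof.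
move=> [mX PX] mB; pose E k := if k == i then B else setT.
have -> : X i @^-1` B = \bigcap_(k in setT) X k @^-1` E k.
  apply/seteqP; split=> [w wB k _|w /(_ i Logic.I)]; last by rewrite /E eqxx.
  by rewrite /E; case: eqP => [->|].
rewrite PX; last by move=> k; rewrite /E; case: ifP.
rewrite (bigD1 i)//= /E eqxx big1 ?mule1// => k /negbTE ->.
by rewrite probability_setT.
Qed.

Lemma ge0_integral_gauss_family X i (f : R -> \bar R) : gauss_family X ->
  (forall x, (0 <= f x)%E) ->
  measurable_fun setT (f : measurableTypeR R -> \bar R) ->
  (\int[P]_w f (X i w) = \int[gauss]_x f x)%E.
Proof.
move=> gX f0 mf; have [mX _] := gX.
have f0' : {in [set: measurableTypeR R], forall y, (0 <= f y)%E} by move=> y _.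
rewrite -[LHS](ge0_integral_pushforward (mX i) P measurableT mf f0').
by apply: eq_measure_integral => A mA _; exact: (gauss_family_marginal i gX mA).
Qed.

(** What is kept of a product of rotations that act on the coordinates in D: the
    new variables X' are again independent standard normal, g transforms the
    coefficients of a linear form accordingly and is an isometry, coefficients
    outside D do not change, and vectors that vanish on D still do. *)
Definition change_of_coords (D : {set J}) X X' (g : (J -> R) -> (J -> R)) : Prop :=
  [/\ gauss_family X',
      (forall v w, \sum_k v k * X k w = \sum_k g v k * X' k w),
      (forall u v, \sum_k u k * v k = \sum_k g u k * g v k),
      (forall v k, k \notin D -> g v k = v k) &
      (forall v, (forall k, k \in D -> v k = 0) -> forall k, k \in D -> g v k = 0) /\
      (forall w, \sum_k X k w ^+ 2 = \sum_k X' k w ^+ 2)].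

Lemma sum_rotate i j (c s : R) (u v : J -> R) : i != j -> c ^+ 2 + s ^+ 2 = 1 ->
  \sum_k u k * v k = \sum_k rotate i j c s u k * rotate i j c s v k.
Proof.
move=> ij cs; rewrite (big_pair_split _ ij) [RHS](big_pair_split _ ij).
have ji : (j == i) = false by rewrite eq_sym; exact: negbTE.
rewrite [in RHS](eq_bigr (fun k => u k * v k)); last first.
  by move=> k /andP[ki kj]; rewrite /rotate (negbTE ki) (negbTE kj).
rewrite !addrA; congr (_ + _); rewrite /rotate !eqxx ji.
transitivity ((c ^+ 2 + s ^+ 2) * (u i * v i + u j * v j)); last by ring.
by rewrite cs mul1r.
Qed.

Lemma change_of_coords_rotate (D : {set J}) X i j (c s : R) :
  gauss_family X -> i \in D -> j \in D -> i != j -> c ^+ 2 + s ^+ 2 = 1 ->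
  change_of_coords D X (fun k w => rotate i j c s (X^~ w) k) (rotate i j c s).
Proof.
move=> gX iD jD ij cs; split.
- exact: gauss_family_rotation.
- by move=> v w; exact: sum_rotate.
- by move=> u v; exact: sum_rotate.
- move=> v k kD; rewrite /rotate; have [ki|_] := eqVneq k i; first by rewrite ki iD in kD.
  by have [kj|_] := eqVneq k j; first by rewrite kj jD in kD.
split.
  move=> v v0 k kD; rewrite /rotate !v0// !mulr0 addr0.
  by case: ifP => // _; case: ifP.
move=> w; rewrite [LHS](eq_bigr (fun k => X k w * X k w)); last by move=> k _; rewrite expr2.
by rewrite (sum_rotate _ _ ij cs); apply: eq_bigr => k _; rewrite expr2.
Qed.

Lemma change_of_coords_trans D X X' X'' g h :
  change_of_coords D X X' g -> change_of_coords D X' X'' h ->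
  change_of_coords D X X'' (h \o g).
Proof.
move=> [_ a1 a2 a3 [a4 a5]] [b b1 b2 b3 [b4 b5]]; split => //.
- by move=> v w; rewrite a1 b1.
- by move=> u v; rewrite a2 b2.
- by move=> v k kD; rewrite /= b3// a3.
split; first by move=> v v0 k kD; apply: b4 => // l lD; exact: a4.
by move=> w; rewrite a5 b5.
Qed.

(** Induction on the number of nonzero coefficients of v in D other than the i-th
    one: a rotation in the plane of i and j kills the j-th coefficient. *)
Lemma change_of_coords_align (D : {set J}) X (v : J -> R) i :
  gauss_family X -> i \in D ->
  exists X' g, change_of_coords D X X' g /\
    forall k, k \in D -> k != i -> g v k = 0.
Proof.
move=> + iD; pose S u := finset (fun k => [&& k \in D, k != i & u k != 0 :> R]).
have [n] := ubnP #|S v|; elim: n X v => // n IH X v; rewrite ltnS => vn gX.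
have [vD|] := set_0Vmem (S v).
  exists X, id; split; first by split.
  move=> k kD ki; apply/eqP; apply/negPn/negP => vk.
  by have : k \in S v; [rewrite inE kD ki|rewrite vD inE].
case=> j; rewrite inE => /and3P[jD ji vj].
pose r := Num.sqrt (v i ^+ 2 + v j ^+ 2).
have q0 : 0 < v i ^+ 2 + v j ^+ 2.
  by rewrite ltr_wpDl ?sqr_ge0// lt_neqAle eq_sym sqrf_eq0 vj sqr_ge0.
have r0 : r != 0 by rewrite gt_eqF// sqrtr_gt0.
have cs : (v i / r) ^+ 2 + (v j / r) ^+ 2 = 1.
  by rewrite !exprMn -mulrDl exprVn sqr_sqrtr ?ltW// divff// gt_eqF.
have ij : i != j by rewrite eq_sym.
have R1 := change_of_coords_rotate gX iD jD ij cs.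
have [gX1 _ _ _ _] := R1.
set X1 := (X in gauss_family X) in gX1; set g1 := rotate _ _ _ _ in R1.
have vj0 : g1 v j = 0 by rewrite /g1 /rotate (negbTE ji) eqxx; ring.
have lt1 : (#|S (g1 v)| < n)%N.
  apply: leq_trans vn; apply: proper_card; apply/properP; split; last first.
    by exists j; rewrite !inE jD ji ?vj// vj0 eqxx.
  apply/fintype.subsetP => k; rewrite !inE => /and3P[kD ki]; rewrite kD ki/=.
  by rewrite /g1 /rotate (negbTE ki); have [->|//] := eqVneq k j.
have [X' [g [Rg gv]]] := IH X1 (g1 v) lt1 gX1.
by exists X', (g \o g1); split; [exact: change_of_coords_trans R1 Rg|].
Qed.

(** After alignment, the linear form depends on a single coordinate. *)
Lemma gauss_family_sqr_affine X (v : J -> R) (a : R) (i0 : J) : gauss_family X ->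
  (\int[P]_w ((a + \sum_k v k * X k w) ^+ 2)%:E = (a ^+ 2 + \sum_k v k ^+ 2)%:E)%E.
Proof.
move=> gX; have [X' [g [[gX' gv gg _ _] g0]]] :=
  change_of_coords_align v gX (finset.in_setT i0).
have gvE w : \sum_k v k * X k w = g v i0 * X' i0 w.
  by rewrite gv (bigD1 i0)//= big1 ?addr0// => k k0; rewrite g0 ?mul0r ?finset.in_setT.
have -> : \sum_k v k ^+ 2 = g v i0 ^+ 2.
  transitivity (\sum_k v k * v k); first by apply: eq_bigr => k _; rewrite expr2.
  rewrite gg (bigD1 i0)//= big1 ?addr0 ?expr2// => k k0.
  by rewrite g0 ?mul0r ?finset.in_setT.
rewrite -integral_gauss_sqr_affine.
rewrite -[RHS](@ge0_integral_gauss_family X' i0 (fun x => ((a + g v i0 * x) ^+ 2)%:E))//.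
- by apply: eq_integral => w _; rewrite gvE.
- by move=> x; rewrite lee_fin sqr_ge0.
- apply/measurable_EFinP; apply: measurable_funX; exact: measurable_funD.
Qed.

(** A pi-system that generates the sigma-algebra of all coordinates but X i and
    X j. *)
Definition rest_events X i j : set (set Omega) :=
  [set others X i j E | E in [set E | forall k, measurable (E k)]].

Lemma rest_events_measurable X i j : gauss_family X ->
  <<s rest_events X i j >> `<=` measurable.
Proof.
move=> gX; apply: smallest_sub; first exact: sigma_algebra_measurable.
by move=> _ [E mE <-]; exact: measurable_others.
Qed.

Lemma rest_events_coord X i j k : k != i -> k != j ->
  measurable_fun (setT : set (g_sigma_algebraType (rest_events X i j)))
    (X k : _ -> measurableTypeR R).
Proof.
move=> ki kj _ B mB; rewrite setTI; apply: sub_sigma_algebra.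
exists (fun l => if l == k then B else setT).
  by move=> l /=; case: ifP.
apply/seteqP; split=> [w /(_ k)|w wB l _] /=; first by rewrite eqxx ki kj; exact.
by case: eqP => [->|].
Qed.

(** Fubini for independent variables: the quantities that depend on the other
    coordinates are frozen while the pair (X i, X j) is integrated against
    gauss2. *)
Lemma gauss_family_freeze X i j d' (T : measurableType d') (eta : Omega -> T) :
  gauss_family X -> i != j ->
  measurable_fun (setT : set (g_sigma_algebraType (rest_events X i j))) eta ->
  forall A : set (T * plane), measurable A ->
  P [set w | A (eta w, (X i w, X j w))] = (\int[P]_w gauss2 (xsection A (eta w)))%E.
Proof.
move=> gX ij meta A mA; have [mX PX] := gX.
have seta B : measurable B -> <<s rest_events X i j >> (eta @^-1` B).
  by move=> mB; have := meta measurableT B mB; rewrite setTI.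
have meta' : measurable_fun setT eta.
  move=> _ B mB; rewrite setTI; apply: (rest_events_measurable gX); exact: seta.
pose XX w : plane := (X i w, X j w).
have mXX : measurable_fun setT XX by apply/measurable_fun_pair.
have indep B D : measurable B -> <<s rest_events X i j >> D ->
    P (D `&` XX @^-1` B) = (gauss2 B * P D)%E.
  move=> mB sD; have mXB : measurable (XX @^-1` B) by exact: measurable_preim.
  have fB : gauss2 B \is a fin_num by rewrite fin_num_measure.
  have pB : 0 <= fine (gauss2 B) by rewrite fine_ge0.
  pose nu : {measure set Omega -> \bar R} := mscale (NngNum pB) P.
  transitivity (nu D); last by rewrite /nu /= /mscale /= fineK.
  transitivity (mrestr P mXB D); first by [].
  apply: (@finite_measure_unique _ _ _ (rest_events X i j)) => //.
  - by move=> _ [E mE <-]; exact: measurable_others.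
  - move=> _ _ [E mE <-] [F mF <-]; exists (fun k => E k `&` F k).
      by move=> k; exact: measurableI.
    by rewrite /others -bigcapI; apply: eq_bigcapr => k _; rewrite preimage_setI.
  - exists (fun=> setT) => //; apply/seteqP; split=> // w _ k _ //.
  - by rewrite /= /mrestr setTI (le_lt_trans (probability_le1 P mXB))// ltry.
  move=> _ [E mE <-]; rewrite /nu /= /mscale /mrestr /= fineK//.
  by rewrite -gauss_family_pair// setIC.
have [law lawE] := pushforward_measure_exists P meta'.
have mpair : measurable_fun setT (fun w => (eta w, XX w)) by apply/measurable_fun_pair.
have [nu nuE] := pushforward_measure_exists P mpair.
transitivity (nu A); first by rewrite nuE.
transitivity ((law \x gauss2)%E A).
  apply: measure_unique_rectangles => //.
    by rewrite nuE preimage_setT (le_lt_trans (probability_le1 P measurableT))// ltry.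
  move=> B C mB mC; rewrite [RHS]product_measure1E// nuE lawE muleC -indep//.
  exact: seta.
have msec : measurable_fun setT (fun t => gauss2 (xsection A t)).
  exact: measurable_fun_xsection.
transitivity (\int[law]_t gauss2 (xsection A t))%E; first by [].
have g0 : {in [set: T], forall t, (0 <= gauss2 (xsection A t))%E} by move=> t _.
rewrite -[RHS](ge0_integral_pushforward meta' P measurableT msec g0).
by apply: eq_measure_integral => B mB _; rewrite lawE.
Qed.

End gauss_family.

(** * Gaussian regression *)

Lemma sum_sqr_eq0 (R : realDomainType) (J : finType) (v : J -> R) :
  \sum_k v k ^+ 2 = 0 -> forall k, v k = 0.
Proof.
move=> /eqP; rewrite psumr_eq0; last by move=> k _; exact: sqr_ge0.
by move=> /allP h k; apply/eqP; rewrite -sqrf_eq0; apply: h; rewrite mem_index_enum.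
Qed.

(** The squared length of the component of u orthogonal to v is nonnegative. *)
Lemma cauchy_schwarz_sum (R : realFieldType) (J : finType) (u v : J -> R) :
  (\sum_k u k * v k) ^+ 2 <= (\sum_k u k ^+ 2) * (\sum_k v k ^+ 2).
Proof.
set S := \sum_k u k * v k; set U := \sum_k _ ^+ 2; set V := \sum_k v k ^+ 2.
have V0 : 0 <= V by apply: sumr_ge0 => k _; exact: sqr_ge0.
have [V1|V1] := eqVneq V 0.
  have v0 := sum_sqr_eq0 V1.
  by rewrite /S big1 ?V1 ?mulr0 ?expr0n// => k _; rewrite v0 mulr0.
have : 0 <= \sum_k (V * u k - S * v k) ^+ 2 by apply: sumr_ge0 => k _; exact: sqr_ge0.
have -> : \sum_k (V * u k - S * v k) ^+ 2 = V * (U * V - S ^+ 2).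
  transitivity (V ^+ 2 * U - 2 * V * S * S + S ^+ 2 * V); last by ring.
  have -> : V ^+ 2 * U = \sum_k V ^+ 2 * u k ^+ 2 by rewrite mulr_sumr.
  have -> : 2 * V * S * S = \sum_k 2 * V * S * (u k * v k) by rewrite mulr_sumr.
  have -> : S ^+ 2 * V = \sum_k S ^+ 2 * v k ^+ 2 by rewrite mulr_sumr.
  by rewrite -sumrB -big_split /=; apply: eq_bigr => k _; ring.
by rewrite pmulr_rge0 ?subr_ge0// lt_neqAle eq_sym V1.
Qed.

Lemma measurable_sum_cond d (T : measurableType d) (R : realType) (J : finType)
    (b : pred J) (f : J -> T -> R) :
  (forall k, b k -> measurable_fun setT (f k)) ->
  measurable_fun setT (fun w => \sum_(k | b k) f k w).
Proof.
move=> mf; under eq_fun do rewrite big_mkcond /=.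
apply: measurable_sum => k; case: (boolP (b k)) => // bk; exact: mf.
Qed.

Section regression.
Context d (Omega : measurableType d) (R : realType) (P : probability Omega R).
Variable J : finType.
Local Notation plane := (measurableTypeR R * measurableTypeR R)%type.
Local Notation Rm := (measurableTypeR R).

(** The linear forms with coefficients a, b, c, e stand for the real and imaginary
    parts of S(z) and of S'(z) at a point z. In suitable orthonormal coordinates
    S(z) depends on two of them only, x and y, in triangular form; x and y are
    standard normal. The forms c and e split into a combination of x and y and
    residuals w1, w2 that depend on the remaining coordinates, hence are
    independent of (x, y): this is the regression of S'(z) on S(z). The sum rho of
    the squares of the remaining coordinates controls the size of everything that
    is independent of S(z). The equations on p, q, t, c0, c1, e0, e1 express that
    the change of coordinates is an isometry. *)
Record regression (X : J -> Omega -> R) (a b c e : J -> R)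
    (x y w1 w2 rho : Omega -> R) (p q t c0 c1 e0 e1 : R) : Prop := Regression {
  reg_mw1 : measurable_fun setT (w1 : Omega -> Rm);
  reg_mw2 : measurable_fun setT (w2 : Omega -> Rm);
  reg_mrho : measurable_fun setT (rho : Omega -> Rm);
  reg_rho_ge0 : forall w, 0 <= rho w;
  reg_a : forall w, \sum_k a k * X k w = p * x w;
  reg_b : forall w, \sum_k b k * X k w = q * x w + t * y w;
  reg_c : forall w, \sum_k c k * X k w = c0 * x w + c1 * y w + w1 w;
  reg_e : forall w, \sum_k e k * X k w = e0 * x w + e1 * y w + w2 w;
  reg_sq : forall w, \sum_k X k w ^+ 2 = x w ^+ 2 + y w ^+ 2 + rho w;
  reg_w1_le : forall w, w1 w ^+ 2 <= (\sum_k c k ^+ 2) * rho w;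
  reg_w2_le : forall w, w2 w ^+ 2 <= (\sum_k e k ^+ 2) * rho w;
  reg_aa : \sum_k a k ^+ 2 = p ^+ 2;
  reg_ab : \sum_k a k * b k = p * q;
  reg_bb : \sum_k b k ^+ 2 = q ^+ 2 + t ^+ 2;
  reg_ac : \sum_k a k * c k = p * c0;
  reg_bc : \sum_k b k * c k = q * c0 + t * c1;
  reg_ae : \sum_k a k * e k = p * e0;
  reg_be : \sum_k b k * e k = q * e0 + t * e1;
  reg_cc : c0 ^+ 2 + c1 ^+ 2 <= \sum_k c k ^+ 2;
  reg_ee : e0 ^+ 2 + e1 ^+ 2 <= \sum_k e k ^+ 2;
  reg_E1 : forall v, (\int[P]_w ((v + w1 w) ^+ 2)%:E =
             (v ^+ 2 + (\sum_k c k ^+ 2 - c0 ^+ 2 - c1 ^+ 2))%:E)%E;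
  reg_E2 : forall v, (\int[P]_w ((v + w2 w) ^+ 2)%:E =
             (v ^+ 2 + (\sum_k e k ^+ 2 - e0 ^+ 2 - e1 ^+ 2))%:E)%E;
  reg_indep : forall A : set ((Rm * Rm * Rm) * plane), measurable A ->
    P [set w | A ((w1 w, w2 w, rho w), (x w, y w))] =
    (\int[P]_w gauss2 (xsection A (w1 w, w2 w, rho w)))%E }.

(** Two alignments, of a and then of b among the coordinates other than the first;
    this is Gram-Schmidt orthogonalization of (a, b). The Gram determinant is
    nonzero, so that b keeps a nonzero coefficient outside the first
    coordinate. *)
Lemma regression_exists (X : J -> Omega -> R) (a b c e : J -> R) :
  gauss_family P X ->
  0 < (\sum_k a k ^+ 2) * (\sum_k b k ^+ 2) - (\sum_k a k * b k) ^+ 2 ->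
  exists x y w1 w2 rho p q t c0 c1 e0 e1,
    regression X a b c e x y w1 w2 rho p q t c0 c1 e0 e1.
Proof.
move=> gX det0.
have [i0 _] : exists i0, a i0 != 0.
  apply: contrapT => /forallNP h.
  have a0 k : a k = 0 by apply/eqP/negPn/negP; exact: h.
  move: det0; have -> : \sum_k a k ^+ 2 = 0 by apply: big1 => k _; rewrite a0 expr0n.
  have -> : \sum_k a k * b k = 0 by apply: big1 => k _; rewrite a0 mul0r.
  by rewrite mul0r expr0n subrr ltxx.
have sumM (u : J -> R) : \sum_k u k ^+ 2 = \sum_k u k * u k.
  by apply: eq_bigr => k _; rewrite expr2.
(* Rotations of all coordinates reduce a to its entry at i0; rotations of the
   others, which leave that entry alone, reduce b to its entries at i0 and i1. *)
have [X1 [g1 [R1 ga]]] := change_of_coords_align a gX (finset.in_setT i0).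
have [gX1 s1 d1 _ [_ _]] := R1.
have {}ga k : k != i0 -> g1 a k = 0 by apply: ga; rewrite finset.in_setT.
have [i1 i10 b1] : exists2 i1, i1 != i0 & g1 b i1 != 0.
  apply: contrapT => /forall2NP h.
  have gb k : k != i0 -> g1 b k = 0.
    by move=> k0; apply/eqP/negPn/negP => bk; have [|] := h k; rewrite ?k0 ?bk.
  have sd (u v : J -> R) : (forall k, k != i0 -> g1 v k = 0) ->
      \sum_k u k * v k = g1 u i0 * g1 v i0.
    by move=> v0; rewrite d1 (bigD1 i0)//= big1 ?addr0// => k k0; rewrite v0 ?mulr0.
  move: det0; rewrite (sumM a) (sumM b) (sd a a ga) (sd b b gb) (sd a b gb).
  by rewrite (_ : _ - _ = 0) ?ltxx//; ring.
have i1D : i1 \in finset (fun k => k != i0) by rewrite inE.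
have [X2 [g2 [R2 gb]]] := change_of_coords_align (g1 b) gX1 i1D.
have i01 : i0 != i1 by rewrite eq_sym.
have [gX2 s2 d2 out2 [in2 sq2]] := R2.
have [_ _ _ _ [_ sq1]] := R1.
have i0D : i0 \notin finset (fun k => k != i0) by rewrite inE eqxx.
have a2 k : k != i0 -> g2 (g1 a) k = 0.
  move=> k0; apply: in2; last by rewrite inE.
  by move=> l; rewrite inE => l0; exact: ga.
have {}gb k : k != i0 -> k != i1 -> g2 (g1 b) k = 0.
  by move=> k0 k1; apply: gb => //; rewrite inE.
pose G u := g2 (g1 u).
have sG v w : \sum_k v k * X k w = \sum_k G v k * X2 k w by rewrite s1 s2.
have dG u v : \sum_k u k * v k = \sum_k G u k * G v k by rewrite d1 d2.
pose rest u k := if (k == i0) || (k == i1) then 0 else G u k.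
have rest0 u : rest u i0 = 0 by rewrite /rest eqxx.
have rest1 u : rest u i1 = 0 by rewrite /rest eqxx orbT.
have restE u (F : J -> R) : \sum_k rest u k * F k =
    \sum_(k | (k != i0) && (k != i1)) G u k * F k.
  rewrite (big_pair_split _ i01) rest0 rest1 !mul0r !add0r.
  by apply: eq_bigr => k /andP[/negbTE k0 /negbTE k1]; rewrite /rest k0 k1.
pose W u w := \sum_k rest u k * X2 k w.
pose Q w := \sum_(k | (k != i0) && (k != i1)) X2 k w ^+ 2.
have sumG u w : \sum_k u k * X k w = G u i0 * X2 i0 w + G u i1 * X2 i1 w + W u w.
  by rewrite sG (big_pair_split _ i01) addrA /W restE.
have sqG u : \sum_k u k ^+ 2 = G u i0 ^+ 2 + G u i1 ^+ 2 + \sum_k rest u k ^+ 2.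
  rewrite sumM dG (big_pair_split _ i01) -!expr2 addrA; congr (_ + _).
  rewrite [RHS](eq_bigr (fun k => rest u k * rest u k)); last by move=> k _; rewrite expr2.
  rewrite restE; apply: eq_bigr => k /andP[/negbTE k0 /negbTE k1].
  by rewrite /rest k0 k1.
have Ga0 : G a i1 = 0 by exact: a2.
have dGa u : \sum_k a k * u k = G a i0 * G u i0.
  rewrite dG (bigD1 i0)//= big1 ?addr0// => k k0.
  by rewrite [G a k]a2 ?mul0r.
have dGb u : \sum_k b k * u k = G b i0 * G u i0 + G b i1 * G u i1.
  rewrite dG (big_pair_split _ i01) big1 ?addr0// => k /andP[k0 k1].
  by rewrite [G b k]gb ?mul0r.
have resta k : rest a k = 0 by rewrite /rest; case: ifPn => // /norP[k0 _]; exact: a2.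
have restb k : rest b k = 0 by rewrite /rest; case: ifPn => // /norP[k0 k1]; exact: gb.
have Wa w : W a w = 0 by rewrite /W big1// => k _; rewrite resta mul0r.
have Wb w : W b w = 0 by rewrite /W big1// => k _; rewrite restb mul0r.
have W_le u w : W u w ^+ 2 <= (\sum_k u k ^+ 2) * Q w.
  have Q0 : 0 <= Q w by apply: sumr_ge0 => k _; exact: sqr_ge0.
  pose F k := if (k == i0) || (k == i1) then 0 else X2 k w.
  have -> : W u w = \sum_k rest u k * F k.
    apply: eq_bigr => k _; rewrite /F /rest; case: ifP => //; by rewrite !mul0r.
  have -> : Q w = \sum_k F k ^+ 2.
    rewrite (big_pair_split _ i01) /F !eqxx orbT expr0n !add0r.
    by apply: eq_bigr => k /andP[/negbTE k0 /negbTE k1]; rewrite k0 k1.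
  apply: le_trans (cauchy_schwarz_sum _ _) _; apply: ler_wpM2r.
    by apply: sumr_ge0 => k _; exact: sqr_ge0.
  by rewrite (sqG u) lerDr addr_ge0 ?sqr_ge0.
have mX2 := gX2.1.
have m2 k : measurable_fun setT (X2 k : Omega -> R) by exact: mX2.
have mWQ d' (O' : measurableType d') (e' : O' -> Omega) :
    (forall k, k != i0 -> k != i1 -> measurable_fun setT (X2 k \o e' : O' -> R)) ->
    forall u, measurable_fun setT (W u \o e' : O' -> R) /\
      measurable_fun setT (Q \o e' : O' -> R).
  move=> mO u; split; last first.
    by apply: measurable_sum_cond => k /andP[k0 k1]; apply: measurable_funX; exact: mO.
  rewrite (_ : _ \o _ = fun w => \sum_(k | (k != i0) && (k != i1)) G u k * X2 k (e' w)).
    by apply: measurable_sum_cond => k /andP[k0 k1]; apply: measurable_funM => //; exact: mO.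
  by apply/funext => w; rewrite /= /W restE.
have E u v : (\int[P]_w ((v + W u w) ^+ 2)%:E =
             (v ^+ 2 + (\sum_k u k ^+ 2 - G u i0 ^+ 2 - G u i1 ^+ 2))%:E)%E.
  rewrite (gauss_family_sqr_affine _ _ i0 gX2) (sqG u); congr (_ + _)%:E; ring.
have rest_le u : G u i0 ^+ 2 + G u i1 ^+ 2 <= \sum_k u k ^+ 2.
  by rewrite (sqG u) lerDl; apply: sumr_ge0 => k _; exact: sqr_ge0.
exists (X2 i0), (X2 i1), (W c), (W e), Q.
exists (G a i0), (G b i0), (G b i1), (G c i0), (G c i1), (G e i0), (G e i1).
split => //.
- exact: (mWQ _ _ id (fun k _ _ => m2 k) c).1.
- exact: (mWQ _ _ id (fun k _ _ => m2 k) e).1.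
- exact: (mWQ _ _ id (fun k _ _ => m2 k) e).2.
- by move=> w; apply: sumr_ge0 => k _; exact: sqr_ge0.
- by move=> w; rewrite sumG Ga0 Wa mul0r !addr0.
- by move=> w; rewrite sumG Wb addr0.
- by move=> w; rewrite sq1 sq2 (big_pair_split _ i01) addrA.
- by rewrite sumM dGa expr2.
- by rewrite sumM dGb -!expr2.
apply: gauss_family_freeze => //.
pose O' := g_sigma_algebraType (rest_events X2 i0 i1).
have mr k : k != i0 -> k != i1 -> measurable_fun (setT : set O') (X2 k : O' -> R).
  by move=> k0 k1; exact: (rest_events_coord k0 k1).
have mO u := mWQ _ O' id mr u.
have : measurable_fun (setT : set O') ((fun w => (W c w, W e w, Q w)) : O' -> (Rm * Rm * Rm)%type).
  apply/measurable_fun_pair => /=; last exact: (mO c).2.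
  by apply/measurable_fun_pair => /=; [exact: (mO c).1|exact: (mO e).1].
exact.
Qed.
End regression.

Local Open Scope complex_scope.

(** * Complex differentiability with a real-valued modulus *)
Section modulus.
Context {R : realType}.
Implicit Types z w : R[i].

(** The norm of a complex number is itself a complex number; estimates are made
    with the real number that it stands for. *)
Definition modulus z : R := Normc.normc z.
Arguments modulus : simpl never.

Lemma modulusE z : modulus z = Num.sqrt (complex.Re z ^+ 2 + complex.Im z ^+ 2).
Proof. by case: z. Qed.

Lemma modulus_sqr z : modulus z ^+ 2 = complex.Re z ^+ 2 + complex.Im z ^+ 2.
Proof. by rewrite modulusE sqr_sqrtr// addr_ge0 ?sqr_ge0. Qed.

Lemma modulus_ge0 z : 0 <= modulus z. Proof. by rewrite modulusE sqrtr_ge0. Qed.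
Lemma modulus0 : modulus 0 = 0. Proof. exact: Normc.normc0. Qed.
Lemma modulus1 : modulus 1 = 1. Proof. exact: Normc.normc1. Qed.
Lemma modulusN z : modulus (- z) = modulus z. Proof. exact: normcN. Qed.
Lemma modulusM z w : modulus (z * w) = modulus z * modulus w. Proof. exact: Normc.normcM. Qed.
Lemma modulusV z : modulus z^-1 = (modulus z)^-1. Proof. exact: Normc.normcV. Qed.
Lemma le_modulusD z w : modulus (z + w) <= modulus z + modulus w. Proof. exact: le_normcD. Qed.
Lemma le_modulusB z w : modulus (z - w) <= modulus z + modulus w.
Proof. by rewrite -(modulusN w); exact: le_modulusD. Qed.
Lemma modulus_distrC z w : modulus (z - w) = modulus (w - z).
Proof. by rewrite -modulusN opprB. Qed.
Lemma modulus_eq0 z : modulus z = 0 -> z = 0. Proof. exact: Normc.eq0_normc. Qed.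
Lemma modulus_gt0 z : z != 0 -> 0 < modulus z.
Proof.
by move=> z0; rewrite lt_neqAle modulus_ge0 andbT eq_sym; apply: contra_neq z0 => /modulus_eq0.
Qed.

Lemma modulus_Re z : `|complex.Re z| <= modulus z.
Proof. by rewrite modulusE -sqrtr_sqr ler_wsqrtr// lerDl sqr_ge0. Qed.
Lemma modulus_Im z : `|complex.Im z| <= modulus z.
Proof. by rewrite modulusE -sqrtr_sqr ler_wsqrtr// lerDr sqr_ge0. Qed.
Lemma le_modulus_ReIm z : modulus z <= `|complex.Re z| + `|complex.Im z|.
Proof.
rewrite modulusE -[leRHS]ger0_norm ?addr_ge0// -sqrtr_sqr ler_wsqrtr//.
rewrite sqrrD !real_normK ?num_real// -addrA lerD2l lerDr mulrn_wge0// mulr_ge0//.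
Qed.
Lemma modulus_real (x : R) : modulus x%:C = `|x|.
Proof. by rewrite modulusE /= expr0n /= addr0 sqrtr_sqr. Qed.
Lemma modulus_sum (I : finType) (F : I -> R[i]) :
  modulus (\sum_i F i) <= \sum_i modulus (F i).
Proof.
elim/big_ind2 : _ => //; first by rewrite modulus0.
by move=> x a y b xa yb; apply: le_trans (le_modulusD _ _) _; exact: lerD.
Qed.

Lemma normC_modulus z : `|z| = (modulus z)%:C.
Proof. by []. Qed.

(** Complex differentiability as a first-order expansion with explicit remainder,
    which avoids filters and quotients in the calculus rules and in Goursat's
    theorem. *)
Definition cdiff (f : R[i] -> R[i]) (z c : R[i]) : Prop :=
  forall e, 0 < e -> exists2 del, 0 < del &
  forall h, modulus h < del -> modulus (f (z + h) - f z - c * h) <= e * modulus h.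

Lemma derivable_cdiff (f : cplx R -> cplx R) (z : cplx R) :
  derivable f z 1 -> cdiff f z (derive1 f z).
Proof.
move=> fz e e0.
have : (fun h : cplx R => h^-1 *: (f (h + z) - f z)) @ 0^' --> derive1 f z.
  have -> : (fun h : cplx R => h^-1 *: (f (h + z) - f z)) =
            (fun h : cplx R => h^-1 *: (f (h *: 1 + z) - f z)).
    by apply/funext => h; rewrite [h *: 1]mulr1.
  rewrite derive1E; exact: fz.
move=> /cvgr_dist_le /(_ e%:C); rewrite ltcR => /(_ e0).
rewrite near_withinE => /nbhs_ballP[del /= del0 H].
have [d1 d1E] : exists d1 : R, del = d1%:C.
  exists (complex.Re del); move: del0; rewrite ltcE => /andP[/eqP h _].
  by move: h; case: (del) => a b /= ->.
exists d1; first by rewrite -ltcR -d1E.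
move=> h hd; have [->|h0] := eqVneq h 0.
  by rewrite addr0 mulr0 subr0 subrr modulus0 mulr0.
have /(_ _ h0) := H h.
rewrite /ball /= sub0r normrN normC_modulus d1E ltcR => /(_ hd).
rewrite normC_modulus lecR => L.
have hp := modulus_gt0 h0.
have -> : f (z + h) - f z - derive1 f z * h = - (h * (derive1 f z - h^-1 *: (f (h + z) - f z))).
  by rewrite mulrBr [h * (h^-1 *: _)]mulrA divff// mul1r opprB (addrC h) (mulrC h).
by rewrite modulusN modulusM mulrC ler_pM2r.
Qed.

Lemma cdiff_derive1 (f : cplx R -> cplx R) (z c : cplx R) :
  cdiff f z c -> derive1 f z = c.
Proof.
move=> fz; apply/cvg_lim => //; apply/cvgrPdist_le => e e0.
have [e1 e1E] : exists e1 : R, e = e1%:C.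
  exists (complex.Re e); move: e0; rewrite ltcE => /andP[/eqP h _].
  by move: h; case: (e) => a b /= ->.
move: e0; rewrite e1E ltcR => e10; have [del del0 H] := fz _ e10.
rewrite near_withinE; apply/nbhs_ballP; exists del%:C; first by rewrite /= ltcR.
move=> h; rewrite /ball /= sub0r normrN normC_modulus ltcR => hd h0.
rewrite normC_modulus lecR.
have := H h hd.
have -> : f (z + h) - f z - c * h = - (h * (c - h^-1 *: (f (h + z) - f z))).
  by rewrite mulrBr [h * (h^-1 *: _)]mulrA divff// mul1r opprB (addrC h) (mulrC h).
by rewrite modulusN modulusM mulrC ler_pM2r// modulus_gt0.
Qed.

End modulus.
Arguments modulus {R} z : simpl never.

(** * Differentiation rules and the complex exponential *)
Section cdiff_calculus.
Context {R : realType}.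
Implicit Types (f g : R[i] -> R[i]) (z w c k : R[i]).

Lemma cdiff_lip f z c : cdiff f z c -> exists2 del, 0 < del &
  forall h, modulus h < del -> modulus (f (z + h) - f z) <= (modulus c + 1) * modulus h.
Proof.
move=> /(_ 1 ltr01)[del d0 H]; exists del => // h hd.
rewrite -[f (z + h) - f z](subrK (c * h)); apply: le_trans (le_modulusD _ _) _.
by rewrite mulrDl addrC modulusM lerD2l; exact: H.
Qed.

Lemma cdiff_id z : cdiff id z 1.
Proof.
move=> e e0; exists 1 => // h _.
by rewrite mul1r (addrC z) addrK subrr modulus0 mulr_ge0 ?modulus_ge0// ltW.
Qed.

Lemma cdiff_cst z w : cdiff (fun=> w) z 0.
Proof.
move=> e e0; exists 1 => // h _.
by rewrite mul0r subrr subr0 modulus0 mulr_ge0 ?modulus_ge0// ltW.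
Qed.

Lemma cdiffD f g z c k : cdiff f z c -> cdiff g z k -> cdiff (fun w => f w + g w) z (c + k).
Proof.
move=> fz gz e e0; have e2 : 0 < e / 2 by rewrite divr_gt0.
have [d1 d10 H1] := fz _ e2; have [d2 d20 H2] := gz _ e2.
exists (Num.min d1 d2); first by rewrite lt_min d10.
move=> h; rewrite lt_min => /andP[h1 h2].
have -> : f (z + h) + g (z + h) - (f z + g z) - (c + k) * h =
  (f (z + h) - f z - c * h) + (g (z + h) - g z - k * h) by ring.
by apply: le_trans (le_modulusD _ _) _; have := H1 h h1; have := H2 h h2; lra.
Qed.

Lemma cdiff_comp f g z c k : cdiff g z c -> cdiff f (g z) k ->
  cdiff (fun w => f (g w)) z (k * c).
Proof.
move=> gz fz e e0.
have c1 : 0 < modulus c + 1 by have := modulus_ge0 c; lra.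
have k1 : 0 < modulus k + 1 by have := modulus_ge0 k; lra.
have [d0 d00 H0] := cdiff_lip gz.
have [|d1 d10 H1] := fz (e / 2 / (modulus c + 1)); first by rewrite !divr_gt0.
have [|d2 d20 H2] := gz (e / 2 / (modulus k + 1)); first by rewrite !divr_gt0.
exists (Num.min (Num.min d0 d2) (d1 / (modulus c + 1))).
  by rewrite !lt_min d00 d20 divr_gt0.
move=> h; rewrite !lt_min ltr_pdivlMr// => /andP[/andP[h0 h2] h1].
set u := g (z + h) - g z.
have uh : modulus u <= (modulus c + 1) * modulus h by exact: H0.
have gu : g (z + h) = g z + u by rewrite /u [RHS]addrC subrK.
rewrite gu.
have -> : f (g z + u) - f (g z) - k * c * h =
  (f (g z + u) - f (g z) - k * u) + k * (u - c * h) by ring.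
apply: le_trans (le_modulusD _ _) _.
have A : modulus (f (g z + u) - f (g z) - k * u) <= e / 2 * modulus h.
  apply: le_trans (H1 u _) _.
    by apply: le_lt_trans uh _; rewrite mulrC.
  rewrite -mulrA ler_pM2l ?divr_gt0//.
  by rewrite mulrC ler_pdivrMr// mulrC.
have B : modulus (k * (u - c * h)) <= e / 2 * modulus h.
  rewrite modulusM; apply: le_trans (ler_wpM2l (modulus_ge0 _) (H2 h h2)) _.
  rewrite mulrA ler_wpM2r ?modulus_ge0// mulrCA ler_piMr ?divr_ge0 ?ltW//.
  by rewrite ltr_pdivrMr// mul1r ltrDl.
by lra.
Qed.

Lemma cdiffM f g z c k : cdiff f z c -> cdiff g z k ->
  cdiff (fun w => f w * g w) z (c * g z + f z * k).
Proof.
move=> fz gz e e0.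
have [d0 d00 L0] := cdiff_lip fz; have [d1 d10 L1] := cdiff_lip gz.
have g1 : 0 < modulus (g z) + 1 by have := modulus_ge0 (g z); lra.
have f1 : 0 < modulus (f z) + 1 by have := modulus_ge0 (f z); lra.
have c1 : 0 < modulus c + 1 by have := modulus_ge0 c; lra.
have k1 : 0 < modulus k + 1 by have := modulus_ge0 k; lra.
have [|d2 d20 H2] := fz (e / 3 / (modulus (g z) + 1)); first by rewrite !divr_gt0.
have [|d3 d30 H3] := gz (e / 3 / (modulus (f z) + 1)); first by rewrite !divr_gt0.
pose q := (modulus c + 1) * (modulus k + 1).
have q0 : 0 < q by exact: mulr_gt0.
exists (Num.min (Num.min d0 d1) (Num.min (Num.min d2 d3) (e / 3 / q))).
  by rewrite !lt_min d00 d10 d20 d30 !divr_gt0.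
move=> h; rewrite !lt_min => /andP[/andP[h0 h1] /andP[/andP[h2 h3] h4]].
have -> : f (z + h) * g (z + h) - f z * g z - (c * g z + f z * k) * h =
  (f (z + h) - f z - c * h) * g z + f z * (g (z + h) - g z - k * h)
  + (f (z + h) - f z) * (g (z + h) - g z) by ring.
have h00 := modulus_ge0 h.
have bnd (a b r : R) : 0 <= b -> 0 < r -> a <= e / 3 / r * modulus h -> b <= r ->
    0 <= a -> a * b <= e / 3 * modulus h.
  move=> b0 r0 ar br a0; apply: le_trans (ler_wpM2l a0 br) _.
  apply: le_trans (ler_wpM2r (ltW r0) ar) _.
  by rewrite mulrAC divfK ?gt_eqF.
apply: le_trans (le_modulusD _ _) _.
apply: le_trans (lerD (le_modulusD _ _) (lexx _)) _.
rewrite !modulusM.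
have A : modulus (f (z + h) - f z - c * h) * modulus (g z) <= e / 3 * modulus h.
  by apply: (bnd _ _ (modulus (g z) + 1)); rewrite ?modulus_ge0 ?H2// lerDl.
have B : modulus (f z) * modulus (g (z + h) - g z - k * h) <= e / 3 * modulus h.
  rewrite mulrC.
  by apply: (bnd _ _ (modulus (f z) + 1)); rewrite ?modulus_ge0 ?H3// lerDl.
have C : modulus (f (z + h) - f z) * modulus (g (z + h) - g z) <= e / 3 * modulus h.
  apply: le_trans (ler_pM (modulus_ge0 _) (modulus_ge0 _) (L0 h h0) (L1 h h1)) _.
  rewrite mulrACA -/q mulrA ler_wpM2r//.
  by move: h4; rewrite ltr_pdivlMr// mulrC => /ltW.
by lra.
Qed.

Lemma cdiffMl f z c k : cdiff f z c -> cdiff (fun w => k * f w) z (k * c).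
Proof. by move=> fz; have := cdiffM (cdiff_cst z k) fz; rewrite mul0r add0r. Qed.

Lemma cdiff_sum (I : Type) (r : seq I) (F : I -> R[i] -> R[i]) (c : I -> R[i]) z :
  (forall i, cdiff (F i) z (c i)) ->
  cdiff (fun w => \sum_(i <- r) F i w) z (\sum_(i <- r) c i).
Proof.
move=> Fz; elim: r => [|i r IH].
  rewrite big_nil (_ : (fun _ => _) = fun=> 0); first exact: cdiff_cst.
  by apply/funext => w; rewrite big_nil.
rewrite big_cons (_ : (fun _ => _) = fun w => F i w + \sum_(j <- r) F j w).
  exact: cdiffD.
by apply/funext => w; rewrite big_cons.
Qed.

Definition cexp z : R[i] :=
  (expR (complex.Re z) * cos (complex.Im z)) +i* (expR (complex.Re z) * sin (complex.Im z)).

Lemma cexpD z w : cexp (z + w) = cexp z * cexp w.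
Proof.
case: z w => [a b] [c e]; rewrite /cexp /= expRD cosD sinD.
by apply/eqP; rewrite eq_complex /=; apply/andP; split; apply/eqP; ring.
Qed.

Lemma real_first_order (f : R -> R) (x df : R) : is_derive x 1 f df ->
  forall e, 0 < e -> exists2 del, 0 < del &
  forall h, `|h| < del -> `|f (x + h) - f x - df * h| <= e * `|h|.
Proof.
move=> [fx fdf] e e0.
have : (fun h : R => h^-1 *: (f (h *: 1 + x) - f x)) @ 0^' --> df by rewrite -fdf; exact: fx.
move=> /cvgrPdist_le /(_ _ e0); rewrite near_withinE => /nbhs_ballP[del /= del0 H].
exists del => // h hd; have [->|h0] := eqVneq h 0.
  by rewrite addr0 mulr0 subr0 subrr normr0 mulr0.
have /(_ _ h0) := H h; rewrite /ball /= sub0r normrN => /(_ hd).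
rewrite [h *: 1]mulr1 => L.
have -> : f (x + h) - f x - df * h = - (h * (df - h^-1 *: (f (h + x) - f x))).
  by rewrite mulrBr [h * (h^-1 *: _)]mulrA divff// mul1r opprB (addrC h) (mulrC h).
by rewrite normrN normrM mulrC ler_pM2r// normr_gt0.
Qed.

(** The first-order expansions of exp, cos and sin at 0 give that of
    e^s (cos t + i sin t). *)
Lemma cdiff_cexp0 : cdiff cexp 0 1.
Proof.
move=> e e0.
have e8 : 0 < e / 8 by rewrite divr_gt0.
have [d1 d10 H1] := real_first_order (is_derive_expR (0 : R)) e8.
have [d2 d20 H2] := real_first_order (is_derive_cos (0 : R)) e8.
have [d3 d30 H3] := real_first_order (is_derive_sin (0 : R)) e8.
have [d4 d40 H4] := real_first_order (is_derive_expR (0 : R)) ltr01.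
pose d5 : R := Num.min (1 / 2) (e / 8).
exists (Num.min (Num.min d1 d2) (Num.min (Num.min d3 d4) d5)).
  by rewrite !lt_min d10 d20 d30 d40 e8 divr_gt0.
move=> [a b] hd; set h := a +i* b in hd *.
have ah : `|a| <= modulus h by exact: modulus_Re h.
have bh : `|b| <= modulus h by exact: modulus_Im h.
move: hd; rewrite /d5 !lt_min => /andP[/andP[h1 h2] /andP[/andP[h3 h4] /andP[h5 h6]]].
have := H1 a (le_lt_trans ah h1); rewrite add0r expR0 mul1r => {}H1.
have := H2 b (le_lt_trans bh h2); rewrite add0r cos0 sin0 oppr0 mul0r subr0 => {}H2.
have := H3 b (le_lt_trans bh h3); rewrite add0r cos0 sin0 subr0 mul1r => {}H3.
have := H4 a (le_lt_trans ah h4); rewrite add0r expR0 !mul1r => {}H4.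
rewrite add0r; apply: le_trans (le_modulus_ReIm _) _.
have m0 := modulus_ge0 h.
move: (modulus h) m0 ah bh h1 h2 h3 h4 h5 h6 => m m0 ah bh h1 h2 h3 h4 h5 h6.
rewrite /cexp /= expR0 cos0 sin0 mul1r mulr0 subr0.
have ea1 : `|expR a - 1| <= 2 * m.
  by rewrite -[expR a - 1](subrK a); apply: le_trans (ler_normD _ _) _; lra.
have ea : `|expR a| <= 2.
  by rewrite -[expR a](subrK 1); apply: le_trans (ler_normD _ _) _; rewrite normr1; lra.
have em : 0 <= e * m by rewrite mulr_ge0// ltW.
have R1 : `|expR a * cos b - 1 - a| <= e / 2 * m.
  have -> : expR a * cos b - 1 - a = (expR a - 1 - a) + expR a * (cos b - 1) by ring.
  apply: le_trans (ler_normD _ _) _; rewrite normrM.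
  have := ler_pM (normr_ge0 _) (normr_ge0 _) ea H2.
  have := ler_wpM2l (ltW e8) ah; have := ler_wpM2l (ltW e8) bh; lra.
have R2 : `|expR a * sin b - 0 - b| <= e / 2 * m.
  rewrite subr0.
  have -> : expR a * sin b - b = (sin b - b) * expR a + (expR a - 1) * b by ring.
  apply: le_trans (ler_normD _ _) _; rewrite !normrM.
  have := ler_pM (normr_ge0 _) (normr_ge0 _) H3 ea.
  have := ler_pM (normr_ge0 _) (normr_ge0 _) ea1 bh.
  have := ler_wpM2l (ltW e8) bh.
  have := ler_wpM2r m0 (ltW h6); lra.
by move: R1 R2; rewrite subr0; lra.
Qed.

(** Translate the expansion at 0 with the functional equation. *)
Lemma cdiff_cexp z : cdiff cexp z (cexp z).
Proof.
move=> e e0; have c1 : 0 < modulus (cexp z) + 1 by have := modulus_ge0 (cexp z); lra.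
have [|del d0 H] := cdiff_cexp0 (e := e / (modulus (cexp z) + 1)); first exact: divr_gt0.
exists del => // h hd; have := H h hd.
rewrite add0r mul1r (_ : cexp 0 = 1); last by rewrite /cexp /= expR0 cos0 sin0 mulr0 mul1r.
move=> {}H; rewrite cexpD.
have -> : cexp z * cexp h - cexp z - cexp z * h = cexp z * (cexp h - 1 - h) by ring.
rewrite modulusM; apply: le_trans (ler_wpM2l (modulus_ge0 _) H) _.
rewrite mulrA ler_wpM2r ?modulus_ge0// mulrCA ler_piMr ?ltW//.
by rewrite ltr_pdivrMr// mul1r ltrDl.
Qed.

End cdiff_calculus.

(** * Induction on squares *)
Section cousin.
Context {R : realType}.

Lemma exists_half_pow_lt (l del : R) : 0 < l -> 0 < del ->
  exists n, l / 2 ^+ n < del.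
Proof.
move=> l0 d0; exists (Num.bound (l / del)).
rewrite ltr_pdivrMr ?exprn_gt0// mulrC -ltr_pdivrMr//.
apply: lt_trans (archi_boundP _) _; first by rewrite divr_ge0// ltW.
by rewrite -natrX ltr_nat ltn_expl.
Qed.

Lemma nested_point (s : nat -> R) (l : R) : 0 < l ->
  (forall n, s n <= s n.+1 <= s n + l / 2 ^+ n.+1) ->
  exists x, forall n, s n <= x <= s n + l / 2 ^+ n.
Proof.
move=> l0 H; have half n : l / 2 ^+ n = l / 2 ^+ n.+1 + l / 2 ^+ n.+1.
  by rewrite exprS; field; rewrite expf_neq0.
have mono m n : s n <= s (n + m)%N <= s n + l / 2 ^+ n - l / 2 ^+ (n + m).
  elim: m => [|m]; first by rewrite addn0 addrK lexx.
  by rewrite addnS; have := H (n + m)%N; have := half (n + m)%N; lra.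
have pos n : 0 < l / 2 ^+ n by rewrite divr_gt0 ?exprn_gt0.
have ub m n : s m <= s n + l / 2 ^+ n.
  have [/subnKC <-|/ltnW/subnKC <-] := leqP n m.
    by have := mono (m - n)%N n; have := pos (n + (m - n))%N; lra.
  by have := mono (n - m)%N m; have := pos (m + (n - m))%N; lra.
have ne : range s !=set0 by exists (s 0%N), 0%N.
exists (sup (range s)) => n; apply/andP; split.
  apply: ub_le_sup; last by exists n.
  by exists (s 0%N + l / 2 ^+ 0) => _ [m _ <-]; exact: ub.
by apply: ge_sup => // _ [m _ <-]; exact: ub.
Qed.

(** Cousin's lemma in the form of a bisection argument: a square that fails Q has a
    quarter that fails it, and the point common to a nested sequence of such
    squares contradicts the local hypothesis. It gives both Goursat's theorem and
    the boundedness of locally bounded functions. *)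
Lemma square_induction (Q : R -> R -> R -> Prop) :
  (forall x y m, 0 < m -> Q x y m -> Q (x + m) y m -> Q x (y + m) m ->
     Q (x + m) (y + m) m -> Q x y (m + m)) ->
  (forall x0 y0, exists2 del, 0 < del & forall x y l, 0 < l < del ->
     x <= x0 <= x + l -> y <= y0 <= y + l -> Q x y l) ->
  forall x y l, 0 < l -> Q x y l.
Proof.
move=> Q4 Qloc x y l l0; apply: contrapT => nQ.
pose bad (p : R * R) m := ~ Q p.1 p.2 m.
have next (p : R * R) m : exists q : R * R, 0 < m -> bad p (m + m) ->
    [/\ bad q m, p.1 <= q.1 <= p.1 + m & p.2 <= q.2 <= p.2 + m].
  have [m0|m0] := ltP 0 m; last by exists p.
  have [bp|bp] := pselect (bad p (m + m)); last by exists p.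
  apply: contrapT => /forallNP nq; apply: bp; apply: Q4 => //; apply: contrapT => nQ'.
  - apply: (nq p) => _ _; split=> //; lra.
  - by apply: (nq (p.1 + m, p.2)) => _ _; split=> //=; lra.
  - by apply: (nq (p.1, p.2 + m)) => _ _; split=> //=; lra.
  - by apply: (nq (p.1 + m, p.2 + m)) => _ _; split=> //=; lra.
pose nx p m := projT1 (cid (next p m)).
have nxP p m := projT2 (cid (next p m)) : 0 < m -> bad p (m + m) ->
    [/\ bad (nx p m) m, p.1 <= (nx p m).1 <= p.1 + m & p.2 <= (nx p m).2 <= p.2 + m].
pose s := fix s n := if n is n'.+1 then nx (s n') (l / 2 ^+ n) else (x, y).
have pos n : 0 < l / 2 ^+ n by rewrite divr_gt0 ?exprn_gt0.
have half n : l / 2 ^+ n = l / 2 ^+ n.+1 + l / 2 ^+ n.+1.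
  by rewrite exprS; field; rewrite expf_neq0.
have sbad n : bad (s n) (l / 2 ^+ n).
  elim: n => [|n IH]; first by rewrite /bad expr0 divr1.
  by rewrite half in IH; have [] := nxP _ _ (pos n.+1) IH.
have sP n : [/\ bad (s n.+1) (l / 2 ^+ n.+1),
    (s n).1 <= (s n.+1).1 <= (s n).1 + l / 2 ^+ n.+1 &
    (s n).2 <= (s n.+1).2 <= (s n).2 + l / 2 ^+ n.+1].
  by have := sbad n; rewrite half => IH; exact: nxP (pos n.+1) IH.
have [x0 hx] : exists x0, forall n, (s n).1 <= x0 <= (s n).1 + l / 2 ^+ n.
  by apply: (nested_point (s := fun n => (s n).1) l0) => n; have [] := sP n.
have [y0 hy] : exists y0, forall n, (s n).2 <= y0 <= (s n).2 + l / 2 ^+ n.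
  by apply: (nested_point (s := fun n => (s n).2) l0) => n; have [] := sP n.
have [del d0 H] := Qloc x0 y0.
have [n ln] := exists_half_pow_lt l0 d0.
by apply: (sbad n); apply: H => //; rewrite pos.
Qed.

End cousin.

(** * Closed forms on the plane have zero integral over squares *)
Section goursat.
Context {R : realType}.
Local Notation mu := (@lebesgue_measure R).

Definition segint (a b : R) (g : R -> R) : R := (\int[mu]_(t in `[a, b]) g t)%R.

Lemma segment_integrable (a b : R) (g : R -> R) : continuous g ->
  mu.-integrable `[a, b] (EFin \o g).
Proof.
move=> cg; apply: continuous_compact_integrable; first exact: segment_compact.
exact: continuous_subspaceT.
Qed.

Lemma segintD (a b c : R) (g : R -> R) : continuous g -> a <= b -> b <= c ->
  segint a c g = segint a b g + segint b c g.
Proof.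
move=> cg ab bc; rewrite /segint.
have := @Rintegral_itvB _ g (BLeft a) (BRight c) b (segment_integrable a c cg) ab bc.
have := @Rintegral_itv_obnd_cbnd _ b (BRight c) g.
move=> ->; first by move=> <-; rewrite addrC subrK.
apply: (integrableS _ _ _ (segment_integrable b c cg)) => //.
by apply: subset_itvr; rewrite bnd_simp.
Qed.

Lemma segint_approx (a b c e : R) (g : R -> R) : continuous g -> a <= b ->
  (forall t, a <= t <= b -> `|g t - c| <= e) ->
  `|segint a b g - c * (b - a)| <= e * (b - a).
Proof.
move=> cg ab H; rewrite /segint.
have mu_ab : fine (mu `[a, b]) = b - a.
  rewrite lebesgue_measure_itv /= lte_fin.
  by move: ab; rewrite le_eqVlt => /orP[/eqP ->|->] //; rewrite ltxx subrr.
have cI : forall r : R, mu.-integrable `[a, b] (EFin \o (fun=> r)).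
  by move=> r; apply: segment_integrable => t; exact: cvg_cst.
have -> : c * (b - a) = \int[mu]_(t in `[a, b]) c by rewrite Rintegral_cst// mu_ab.
rewrite -RintegralB//; last exact: segment_integrable.
have cgc : continuous (fun t => g t - c) by move=> t; apply: cvgB; [exact: cg|exact: cvg_cst].
apply: le_trans (le_normr_Rintegral _ _) _ => //; first exact: segment_integrable.
rewrite -mu_ab -Rintegral_cst//.
have nI : mu.-integrable `[a, b] (EFin \o (fun t => `|g t - c|)).
  by apply: segment_integrable => t; apply: cvg_norm; exact: cgc.
apply: le_Rintegral; [exact: measurable_itv|exact: nI|exact: cI|].
by move=> t; rewrite /= in_itv; exact: H.
Qed.

Lemma segintB (a b : R) (g h : R -> R) : continuous g -> continuous h ->
  segint a b (fun t => g t - h t) = segint a b g - segint a b h.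
Proof. by move=> cg ch; rewrite /segint RintegralB//; exact: segment_integrable. Qed.

(** P dx + Q dy is a form with differentiable coefficients such that the
    derivative of P in y equals the derivative of Q in x; al is their common
    value. Continuity of the derivatives is not assumed. *)
Definition closed_form (P Q : R -> R -> R) : Prop :=
  forall x y, exists al be ga, forall e, 0 < e -> exists2 del, 0 < del &
  forall h k, `|h| < del -> `|k| < del ->
    `|Q (x + h) (y + k) - Q x y - (al * h + be * k)| <= e * (`|h| + `|k|) /\
    `|P (x + h) (y + k) - P x y - (ga * h + al * k)| <= e * (`|h| + `|k|).

Definition boundary_integral (P Q : R -> R -> R) (x y l : R) : R :=
  segint y (y + l) (Q (x + l)) - segint y (y + l) (Q x)
  - (segint x (x + l) (P ^~ (y + l)) - segint x (x + l) (P ^~ y)).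

Section closed_form.
Variables P Q : R -> R -> R.
Hypothesis PQ : closed_form P Q.

Lemma closed_form_continuous :
  (forall x, continuous (Q x)) /\ (forall y, continuous (P ^~ y)).
Proof.
have key (g : R -> R) (t c : R) : (forall e, 0 < e -> exists2 del, 0 < del &
    forall h, `|h| < del -> `|g (t + h) - g t - c * h| <= e * `|h|) -> {for t, continuous g}.
  move=> /(_ 1 ltr01)[del d0 H]; apply/cvgrPdist_lt => e e0.
  apply/nbhs_ballP; exists (Num.min del (e / (`|c| + 1))).
    by rewrite /= lt_min d0 divr_gt0// ltr_wpDl.
  move=> u; rewrite /ball /= lt_min ltr_pdivlMr ?ltr_wpDl// => /andP[u1 u2].
  rewrite distrC in u1 u2; have := H (u - t) u1; rewrite (addrC t (u - t)) subrK mul1r => {}H.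
  rewrite distrC -[g u - g t](subrK (c * (u - t))).
  apply: le_lt_trans (ler_normD _ _) _; rewrite normrM.
  by apply: le_lt_trans u2; move: H; lra.
split=> [x y|y x].
  have [al [be [ga H]]] := PQ x y; apply: (key _ _ be) => e e0.
  have [del d0 {}H] := H e e0; exists del => // k kd.
  have [] := H 0 k _ kd; first by rewrite normr0.
  by rewrite addr0 mulr0 add0r normr0 add0r.
have [al [be [ga H]]] := PQ x y; apply: (key _ _ ga) => e e0.
have [del d0 {}H] := H e e0; exists del => // h hd.
have [|_] := H h 0 hd; first by rewrite normr0.
by rewrite addr0 mulr0 addr0 normr0 addr0.
Qed.

(** The affine part of P dx + Q dy at (x0, y0) contributes al l^2 - al l^2 = 0 and
    the remainder contributes less than e l^2. *)
Lemma boundary_integral_local (e x0 y0 : R) : 0 < e -> exists2 del, 0 < del &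
  forall x y l, 0 < l < del -> x <= x0 <= x + l -> y <= y0 <= y + l ->
  `|boundary_integral P Q x y l| <= e * l ^+ 2.
Proof.
move=> e0; have [cQ cP] := closed_form_continuous.
have [al [be [ga /(_ (e / 8))]]] := PQ x0 y0; rewrite divr_gt0// => /(_ isT)[del d0 H].
exists del => // x y l /andP[l0 ld] hx hy.
rewrite /boundary_integral -!segintB//.
have near (u : R) (x' y' : R) : x <= x' <= x + l -> y <= y' <= y + l ->
  `|Q x' y' - Q x0 y0 - (al * (x' - x0) + be * (y' - y0))| <= e / 4 * l /\
  `|P x' y' - P x0 y0 - (ga * (x' - x0) + al * (y' - y0))| <= e / 4 * l.
  move=> hx' hy'.
  have bx : `|x' - x0| <= l by rewrite ler_norml; apply/andP; split; lra.
  have b_y : `|y' - y0| <= l by rewrite ler_norml; apply/andP; split; lra.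
  have := H (x' - x0) (y' - y0) (le_lt_trans bx ld) (le_lt_trans b_y ld).
  rewrite (addrC x0 (x' - x0)) (addrC y0 (y' - y0)) !subrK => -[h1 h2].
  have le1 : e / 8 * (`|x' - x0| + `|y' - y0|) <= e / 4 * l.
    by have := ler_wpM2l (ltW e0) bx; have := ler_wpM2l (ltW e0) b_y; lra.
  by split; [exact: le_trans le1|exact: le_trans le1].
have A : `|segint y (y + l) (fun t => Q (x + l) t - Q x t) - al * l * (y + l - y)|
    <= e / 2 * l * (y + l - y).
  apply: segint_approx; [|lra|] => [t|t ht].
    by apply: cvgB; exact: cQ.
  have [|h1 _] := near 0 (x + l) t _ ht; first by apply/andP; split; lra.
  have [|h2 _] := near 0 x t _ ht; first by apply/andP; split; lra.
  have -> : Q (x + l) t - Q x t - al * l =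
    (Q (x + l) t - Q x0 y0 - (al * (x + l - x0) + be * (t - y0))) -
    (Q x t - Q x0 y0 - (al * (x - x0) + be * (t - y0))) by ring.
  by apply: le_trans (ler_normB _ _) _; lra.
have B : `|segint x (x + l) (fun t => P t (y + l) - P t y) - al * l * (x + l - x)|
    <= e / 2 * l * (x + l - x).
  apply: segint_approx; [|lra|] => [t|t ht].
    by apply: cvgB; exact: cP.
  have [|_ h1] := near 0 t (y + l) ht; first by apply/andP; split; lra.
  have [|_ h2] := near 0 t y ht; first by apply/andP; split; lra.
  have -> : P t (y + l) - P t y - al * l =
    (P t (y + l) - P x0 y0 - (ga * (t - x0) + al * (y + l - y0))) -
    (P t y - P x0 y0 - (ga * (t - x0) + al * (y - y0))) by ring.
  by apply: le_trans (ler_normB _ _) _; lra.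
move: A B; rewrite ![_ + l - _]addrAC !subrr !add0r.
set I1 := segint _ _ _; set I2 := segint _ _ _ => A B.
have -> : I1 - I2 = (I1 - al * l * l) - (I2 - al * l * l) by ring.
by apply: le_trans (ler_normB _ _) _; lra.
Qed.

Lemma boundary_integral_split x y m : 0 < m ->
  boundary_integral P Q x y (m + m) =
  boundary_integral P Q x y m + boundary_integral P Q (x + m) y m +
  (boundary_integral P Q x (y + m) m + boundary_integral P Q (x + m) (y + m) m).
Proof.
move=> m0; have [cQ cP] := closed_form_continuous.
rewrite /boundary_integral !addrA.
rewrite [segint y (y + m + m) (Q (x + m + m))](@segintD _ (y + m))//; [|lra..].
rewrite [segint y (y + m + m) (Q x)](@segintD _ (y + m))//; [|lra..].
rewrite [segint x (x + m + m) (P ^~ (y + m + m))](@segintD _ (x + m))//; [|lra..].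
rewrite [segint x (x + m + m) (P ^~ y)](@segintD _ (x + m))//; [|lra..].
ring.
Qed.

(** Goursat: the bound e l^2 is additive under subdivision into four squares, so
    that the local estimate propagates to every square. *)
Lemma boundary_integral_eq0 x y l : 0 < l -> boundary_integral P Q x y l = 0.
Proof.
move=> l0; apply/eqP; rewrite -normr_le0; apply/ler_addgt0Pr => e e0; rewrite add0r.
have el : 0 < e / l ^+ 2 by rewrite divr_gt0// exprn_gt0.
have -> : e = e / l ^+ 2 * l ^+ 2 by rewrite divfK// gt_eqF// exprn_gt0.
move: (e / l ^+ 2) el => {e0}e e0.
apply: (square_induction (Q := fun x y l => `|boundary_integral P Q x y l| <= e * l ^+ 2)) => //.
- move=> {}x {}y m m0 h1 h2 h3 h4; rewrite boundary_integral_split//.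
  apply: le_trans (ler_normD _ _) _.
  apply: le_trans (lerD (ler_normD _ _) (ler_normD _ _)) _.
  by rewrite (_ : e * (m + m) ^+ 2 = e * m ^+ 2 + e * m ^+ 2 + (e * m ^+ 2 + e * m ^+ 2));
    [rewrite !lerD|ring].
- by move=> x0 y0; exact: boundary_integral_local.
Qed.

End closed_form.

(** The integrals over the two horizontal sides cancel by periodicity. *)
Lemma closed_form_periodic (P Q : R -> R -> R) (x y l : R) : closed_form P Q ->
  0 < l -> (forall t, P t (y + l) = P t y) ->
  segint y (y + l) (Q (x + l)) = segint y (y + l) (Q x).
Proof.
move=> PQ l0 per; have := boundary_integral_eq0 PQ x y l0; rewrite /boundary_integral.
by rewrite (_ : P^~ (y + l) = P^~ y) ?subrr ?subr0; [move/subr0_eq|apply/funext].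
Qed.

End goursat.

(** * Entire functions are continuously differentiable *)
Section entire.
Context {R : realType}.
Implicit Types (f : R[i] -> R[i]) (z w : R[i]).

Lemma is_derive_first_order (f : R -> R) (x df : R) :
  (forall e, 0 < e -> exists2 del, 0 < del &
  forall h, `|h| < del -> `|f (x + h) - f x - df * h| <= e * `|h|) ->
  is_derive x 1 f df.
Proof.
move=> H; have L : (fun h : R => h^-1 *: (f (h *: 1 + x) - f x)) @ 0^' --> df.
  apply/cvgrPdist_le => e e0; have [del d0 {}H] := H e e0.
  rewrite near_withinE; apply/nbhs_ballP; exists del => // h.
  rewrite /ball /= sub0r normrN => hd h0; rewrite [h *: 1]mulr1.
  have := H h hd.
  have -> : f (x + h) - f x - df * h = - (h * (df - h^-1 *: (f (h + x) - f x))).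
    by rewrite mulrBr [h * (h^-1 *: _)]mulrA divff// mul1r opprB (addrC h) (mulrC h).
  by rewrite normrN normrM mulrC ler_pM2r// normr_gt0.
apply: DeriveDef; first by apply: cvgP L.
exact: cvg_lim L.
Qed.

Lemma cdiff_Re_path f w v (t : R) c : cdiff f (w + t%:C * v) c ->
  is_derive t 1 (fun s : R => complex.Re (f (w + s%:C * v))) (complex.Re (c * v)) /\
  is_derive t 1 (fun s : R => complex.Im (f (w + s%:C * v))) (complex.Im (c * v)).
Proof.
move=> fw.
have v1 : 0 < modulus v + 1 by have := modulus_ge0 v; lra.
have key e : 0 < e -> exists2 del, 0 < del & forall h : R, `|h| < del ->
    modulus (f (w + (t + h)%:C * v) - f (w + t%:C * v) - c * v * h%:C) <= e * `|h|.
  move=> e0; have [|del d0 H] := fw (e / (modulus v + 1)); first exact: divr_gt0.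
  exists (del / (modulus v + 1)); first exact: divr_gt0.
  move=> h; rewrite ltr_pdivlMr// => hd.
  have hv : modulus (h%:C * v) <= `|h| * (modulus v + 1).
    by rewrite modulusM modulus_real ler_wpM2l// lerDl.
  have := H (h%:C * v) (le_lt_trans hv hd).
  have -> : w + t%:C * v + h%:C * v = w + (t + h)%:C * v by rewrite rmorphD/=; ring.
  have -> : c * (h%:C * v) = c * v * h%:C by ring.
  move=> /le_trans; apply; rewrite mulrAC ler_pdivrMr//.
  by rewrite -mulrA ler_wpM2l// ltW.
have ReM (a : R[i]) (h : R) : complex.Re (a * h%:C) = complex.Re a * h.
  by case: a => a b /=; rewrite mulr0 subr0.
have ImM (a : R[i]) (h : R) : complex.Im (a * h%:C) = complex.Im a * h.
  by case: a => a b /=; rewrite mulr0 add0r.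
have ReB (a b : R[i]) : complex.Re (a - b) = complex.Re a - complex.Re b by case: a b => ? ? [].
have ImB (a b : R[i]) : complex.Im (a - b) = complex.Im a - complex.Im b by case: a b => ? ? [].
split; apply: is_derive_first_order => e e0; have [del d0 H] := key e e0;
  exists del => // h hd; apply: le_trans (H h hd).
- by rewrite -ReM -!ReB modulus_Re.
- by rewrite -ImM -!ImB modulus_Im.
Qed.

(** The factor 2 comes from applying the real mean value theorem to the real and
    the imaginary part separately. *)
Lemma modulus_mvt f (f' : R[i] -> R[i]) w z (B : R) :
  (forall t : R, 0 <= t <= 1 -> cdiff f (w + t%:C * (z - w)) (f' (w + t%:C * (z - w)))) ->
  (forall t : R, 0 <= t <= 1 -> modulus (f' (w + t%:C * (z - w))) <= B) ->
  modulus (f z - f w) <= 2 * B * modulus (z - w).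
Proof.
move=> fd fB; set v := z - w in fd fB *.
have zE : z = w + 1%:C * v by rewrite /v mul1r addrC subrK.
have wE : w = w + 0%:C * v by rewrite mul0r addr0.
have ReB (a b : R[i]) : complex.Re (a - b) = complex.Re a - complex.Re b by case: a b => ? ? [].
have ImB (a b : R[i]) : complex.Im (a - b) = complex.Im a - complex.Im b by case: a b => ? ? [].
have mvt (g g' : R -> R) : (forall t : R, 0 <= t <= 1 -> is_derive t 1 g (g' t)) ->
    (forall t : R, 0 <= t <= 1 -> `|g' t| <= B * modulus v) ->
    `|g 1 - g 0| <= B * modulus v.
  move=> dg g'B; have [||c c01] := @MVT_segment R g g' 0 1 ler01.
  - by move=> x /subset_itv_oo_cc; rewrite in_itv /= => /dg.
  - apply: derivable_within_continuous => x; rewrite in_itv /= => /dg h.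
    by have [] := h.
  by rewrite subr0 mulr1 => ->; apply: g'B; move: c01; rewrite in_itv.
have -> : f z - f w = f (w + 1%:C * v) - f (w + 0%:C * v) by rewrite -zE -wE.
apply: le_trans (le_modulus_ReIm _) _.
rewrite ReB ImB -mulrA mulr_natl mulr2n; apply: lerD.
  apply: (mvt (fun t => complex.Re (f (w + t%:C * v)))
              (fun t => complex.Re (f' (w + t%:C * v) * v))).
    by move=> t t01; have [] := cdiff_Re_path (fd t t01).
  move=> t t01; apply: le_trans (modulus_Re _) _.
  by rewrite modulusM ler_wpM2r ?modulus_ge0// fB.
apply: (mvt (fun t => complex.Im (f (w + t%:C * v)))
            (fun t => complex.Im (f' (w + t%:C * v) * v))).
  by move=> t t01; have [] := cdiff_Re_path (fd t t01).
move=> t t01; apply: le_trans (modulus_Im _) _.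
by rewrite modulusM ler_wpM2r ?modulus_ge0// fB.
Qed.

(** By the Cauchy-Riemann equations, the real and the imaginary part of the form
    - i G(z) dz are closed. *)
Lemma cdiff_closed_form (G G' : R[i] -> R[i]) : (forall z, cdiff G z (G' z)) ->
  closed_form (fun s t => complex.Im (G (s +i* t))) (fun s t => complex.Re (G (s +i* t))) /\
  closed_form (fun s t => - complex.Re (G (s +i* t))) (fun s t => complex.Im (G (s +i* t))).
Proof.
move=> dG.
have key x y e : 0 < e -> exists2 del, 0 < del & forall h k : R, `|h| < del -> `|k| < del ->
  `|complex.Re (G ((x + h) +i* (y + k))) - complex.Re (G (x +i* y)) -
    (complex.Re (G' (x +i* y)) * h - complex.Im (G' (x +i* y)) * k)| <= e * (`|h| + `|k|) /\
  `|complex.Im (G ((x + h) +i* (y + k))) - complex.Im (G (x +i* y)) -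
    (complex.Im (G' (x +i* y)) * h + complex.Re (G' (x +i* y)) * k)| <= e * (`|h| + `|k|).
  move=> e0; have [del d0 H] := dG (x +i* y) e e0; exists (del / 2); first by rewrite divr_gt0.
  move=> h k hd kd; have hk : modulus (h +i* k) <= `|h| + `|k| by exact: le_modulus_ReIm.
  have hkd : modulus (h +i* k) < del by apply: le_lt_trans hk _; lra.
  have zh : (x +i* y) + (h +i* k) = (x + h) +i* (y + k) by [].
  have {}H := le_trans (H _ hkd) (ler_wpM2l (ltW e0) hk).
  rewrite zh in H; split; apply: le_trans H; [apply: le_trans (modulus_Re _)|apply: le_trans (modulus_Im _)];
    rewrite le_eqVlt; apply/orP; left; apply/eqP.
    by case: (G _) (G _) (G' _) => a b [c e1] [m n] /=; congr (`|_|); ring.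
  by case: (G _) (G _) (G' _) => a b [c e1] [m n] /=; congr (`|_|); ring.
split=> x y.
  exists (complex.Re (G' (x +i* y))), (- complex.Im (G' (x +i* y))), (complex.Im (G' (x +i* y))).
  move=> e e0; have [del d0 H] := key x y e e0; exists del => // h k hd kd.
  by have [H1 H2] := H h k hd kd; rewrite mulNr.
exists (complex.Im (G' (x +i* y))), (complex.Re (G' (x +i* y))), (- complex.Re (G' (x +i* y))).
move=> e e0; have [del d0 H] := key x y e e0; exists del => // h k hd kd.
have [H1 H2] := H h k hd kd; split => //.
rewrite -normrN; apply: le_trans H1; rewrite le_eqVlt; apply/orP; left; apply/eqP.
by congr (`|_|); ring.
Qed.

Lemma modulus_cexp z : modulus (cexp z) = expR (complex.Re z).
Proof.
by rewrite modulusE /cexp /= !exprMn -mulrDr cos2Dsin2 mulr1 sqrtr_sqr ger0_norm ?expR_ge0.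
Qed.

Lemma cexpV z : cexp z * cexp (- z) = 1.
Proof. by rewrite -cexpD subrr /cexp /= expR0 cos0 sin0 mulr0 mul1r. Qed.

Lemma cexp_periodic (s t : R) : cexp (s +i* (t + pi *+ 2)) = cexp (s +i* t).
Proof. by rewrite /cexp /= cosD2pi sinD2pi. Qed.

Lemma cexpN_periodic (s t : R) : cexp (- (s +i* (t + pi *+ 2))) = cexp (- (s +i* t)).
Proof. by rewrite /cexp /= !cosN !sinN cosD2pi sinD2pi. Qed.

Lemma cdiff_opp z : cdiff (fun w => - w) z (-1).
Proof.
rewrite (_ : (fun w => - w) = fun w => -1 * id w); last first.
  by apply/funext => w; rewrite mulN1r.
by rewrite -[X in cdiff _ _ X]mulr1; exact: cdiffMl (@cdiff_id R z).
Qed.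

(** Cauchy's estimate on the unit circle. The function
    G(z) = (f(w + e^z) - f(w)) e^-z is entire and has period 2 i pi, so that its
    mean over a vertical segment of length 2 pi does not depend on the abscissa,
    at least along abscissas that differ by multiples of 2 pi. At abscissa 0 this
    mean is bounded by e, and as the abscissa tends to minus infinity G tends to
    f'(w). The exponential replaces the circle by a segment, for which squares
    suffice. *)
Lemma deriv_bound f (f' : R[i] -> R[i]) w (e : R) : (forall z, cdiff f z (f' z)) ->
  (forall u, modulus u = 1 -> modulus (f (w + u) - f w) <= e) ->
  modulus (f' w) <= 2 * e.
Proof.
move=> df bd.
pose G z := (f (w + cexp z) - f w) * cexp (- z).
have dG z : exists c, cdiff G z c.
  have d1 : cdiff (fun z => w + cexp z) z (0 + cexp z).
    by apply: cdiffD; [exact: cdiff_cst|exact: cdiff_cexp].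
  have d2 := cdiff_comp d1 (df (w + cexp z)).
  have d3 := cdiffD d2 (cdiff_cst z (- f w)).
  have d4 := cdiff_comp (cdiff_opp z) (cdiff_cexp (- z)).
  by eexists; exact: cdiffM d3 d4.
have [G' {}dG] := choice dG.
have [CF1 CF2] := cdiff_closed_form dG.
have l0 : 0 < pi *+ 2 :> R by rewrite pmulrn_lgt0// pi_gt0.
have Gper s t : G (s +i* (t + pi *+ 2)) = G (s +i* t).
  by rewrite /G cexp_periodic cexpN_periodic.
have G0 t : modulus (G (0 +i* t)) <= e.
  rewrite /G modulusM !modulus_cexp /= oppr0 expR0 mulr1; apply: bd.
  by rewrite modulus_cexp /= expR0.
have Glim eps : 0 < eps -> exists s0 : R, forall s t, s <= s0 ->
    modulus (G (s +i* t) - f' w) <= eps.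
  move=> eps0; have [del d0 H] := df w eps eps0.
  exists (ln (del / 2)) => s t ss0.
  have hE : modulus (cexp (s +i* t)) < del.
    rewrite modulus_cexp /=; apply: (@le_lt_trans _ _ (del / 2)); last by lra.
    by rewrite -[leRHS]lnK ?posrE ?divr_gt0// ler_expR.
  rewrite /G; set h := cexp _ in hE *; set h' := cexp _.
  have hh : h * h' = 1 by exact: cexpV.
  have -> : (f (w + h) - f w) * h' - f' w = (f (w + h) - f w - f' w * h) * h'.
    by rewrite [RHS]mulrBl -[f' w * h * h']mulrA hh mulr1.
  rewrite modulusM; apply: le_trans (ler_wpM2r (modulus_ge0 _) (H h hE)) _.
  by rewrite -mulrA -modulusM hh modulus1 mulr1.
have key (P Q : R -> R -> R) (c : R) : closed_form P Q ->
    (forall s t, P s (t + pi *+ 2) = P s t) ->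
    (forall s t, `|Q s t - c| <= modulus (G (s +i* t) - f' w)) ->
    (forall s t, `|Q s t| <= modulus (G (s +i* t))) -> `|c| <= e.
  move=> PQ Pper Qc Q0; have [cQ _] := closed_form_continuous PQ.
  apply/ler_addgt0Pr => eps eps0; have [s0 Hs0] := Glim eps eps0.
  have step s : segint 0 (pi *+ 2) (Q (s + pi *+ 2)) = segint 0 (pi *+ 2) (Q s).
    have := @closed_form_periodic _ P Q s 0 _ PQ l0; rewrite add0r; apply => t.
    by have := Pper t 0; rewrite add0r.
  have stepn n : segint 0 (pi *+ 2) (Q (- (pi *+ 2 *+ n))) = segint 0 (pi *+ 2) (Q 0).
    elim: n => [|n <-]; first by rewrite mulr0n oppr0.
    by rewrite -(step (- (pi *+ 2 *+ n.+1))) [_ *+ n.+1]mulrSr opprD subrK.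
  pose n := Num.bound (`|s0| / (pi *+ 2)).
  have sn : - (pi *+ 2 *+ n) <= s0.
    have q0 : 0 <= `|s0| / (pi *+ 2) by rewrite divr_ge0// ltW.
    have := archi_boundP q0; rewrite -/n ltr_pdivrMr// mulr_natl.
    by have := ler_norm (- s0); rewrite normrN; lra.
  have A : `|segint 0 (pi *+ 2) (Q 0) - c * (pi *+ 2 - 0)| <= eps * (pi *+ 2 - 0).
    rewrite -(stepn n); apply: segint_approx => //; first exact: ltW.
    by move=> t _; apply: le_trans (Qc _ _) _; exact: Hs0.
  have B : `|segint 0 (pi *+ 2) (Q 0) - 0 * (pi *+ 2 - 0)| <= e * (pi *+ 2 - 0).
    apply: segint_approx => //; first exact: ltW.
    by move=> t _; rewrite subr0; apply: le_trans (Q0 _ _) _; exact: G0.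
  rewrite !subr0 in A B; rewrite mul0r subr0 in B.
  rewrite -(ler_pM2r l0) mulrDl; move: l0 A B; set l := pi *+ 2 => l0 A B.
  rewrite -{1}(gtr0_norm l0) -normrM -[c * l](subrK (segint 0 l (Q 0))).
  by apply: le_trans (ler_normD _ _) _; rewrite distrC addrC lerD.
have ReB (a b : R[i]) : complex.Re (a - b) = complex.Re a - complex.Re b by case: a b => ? ? [].
have ImB (a b : R[i]) : complex.Im (a - b) = complex.Im a - complex.Im b by case: a b => ? ? [].
apply: le_trans (le_modulus_ReIm _) _; rewrite mulr_natl mulr2n; apply: lerD.
  apply: (key _ _ _ CF1) => s t; first by rewrite Gper.
    by rewrite -ReB modulus_Re.
  exact: modulus_Re.
apply: (key _ _ _ CF2) => s t; first by rewrite Gper.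
  by rewrite -ImB modulus_Im.
exact: modulus_Im.
Qed.

Definition in_box (L : R) z : Prop := `|complex.Re z| <= L /\ `|complex.Im z| <= L.

Lemma in_boxD L M z w : in_box L z -> modulus w <= M -> in_box (L + M) (z + w).
Proof.
move: z w => [a b] [c e] [/= h1 h2] hM; split=> /=.
  by apply: le_trans (ler_normD _ _) _; apply: lerD h1 (le_trans (modulus_Re (c +i* e)) hM).
by apply: le_trans (ler_normD _ _) _; apply: lerD h2 (le_trans (modulus_Im (c +i* e)) hM).
Qed.

Lemma in_box_segment L z w (t : R) : in_box L z -> in_box L w -> 0 <= t <= 1 ->
  in_box L (w + t%:C * (z - w)).
Proof.
move: z w => [a b] [c e] [/= a1 b1] [/= c1 e1] /andP[t0 t1].
have key (x y : R) : `|x| <= L -> `|y| <= L -> `|y + t * (x - y)| <= L.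
  move=> xL yL; have -> : y + t * (x - y) = (1 - t) * y + t * x by ring.
  apply: le_trans (ler_normD _ _) _; rewrite !normrM (ger0_norm t0).
  rewrite (@ger0_norm _ (1 - t)) ?subr_ge0//.
  have h : 0 <= 1 - t by rewrite subr_ge0.
  by have := ler_wpM2l t0 xL; have := ler_wpM2l h yL; lra.
by split=> /=; rewrite mul0r ?subr0 ?addr0; exact: key.
Qed.

(** Local boundedness spreads to squares by bisection. *)
Lemma continuous_bounded_box f (L : R) :
  (forall z, exists c, cdiff f z c) ->
  exists M, 0 <= M /\ forall z, in_box L z -> modulus (f z) <= M.
Proof.
move=> cf; pose Q (x y l : R) := exists M, forall a b, x <= a <= x + l -> y <= b <= y + l ->
  modulus (f (a +i* b)) <= M.
have QT : forall x y l, 0 < l -> Q x y l.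
  apply: square_induction => [x y m m0 [M1 H1] [M2 H2] [M3 H3] [M4 H4]|x0 y0].
    exists (Num.max (Num.max M1 M2) (Num.max M3 M4)) => a b ha hb; rewrite !le_max.
    have [a1|a1] := leP a (x + m); have [b1|b1] := leP b (y + m).
    - by rewrite H1 ?orbT//; lra.
    - by rewrite H3 ?orbT//; lra.
    - by rewrite H2 ?orbT//; lra.
    - by rewrite H4 ?orbT//; lra.
  have [c /cdiff_lip[del d0 H]] := cf (x0 +i* y0).
  exists (del / 2); first by rewrite divr_gt0.
  move=> x y l hl hx hy; exists (modulus (f (x0 +i* y0)) + (modulus c + 1) * del).
  move=> a b ha hb; pose h : R[i] := (a - x0) +i* (b - y0).
  have hd : modulus h < del.
    apply: le_lt_trans (le_modulus_ReIm _) _ => /=.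
    have h1 : `|a - x0| <= l by rewrite ler_norml; apply/andP; split; lra.
    have h2 : `|b - y0| <= l by rewrite ler_norml; apply/andP; split; lra.
    by lra.
  have := H h hd; have -> : x0 +i* y0 + h = a +i* b.
    by rewrite /h; apply/eqP; rewrite eq_complex /=; apply/andP; split; apply/eqP; ring.
  move=> H1; rewrite -[f (a +i* b)](subrK (f (x0 +i* y0))) addrC.
  apply: le_trans (le_modulusD _ _) _; rewrite lerD2l; apply: le_trans H1 _.
  by apply: ler_wpM2l; [rewrite addr_ge0// modulus_ge0|exact: ltW].
have l0 : 0 < 2 * (`|L| + 1) by rewrite mulr_gt0// ltr_wpDl.
have [M H] := QT (- `|L| - 1) (- `|L| - 1) _ l0.
exists (Num.max M 0); split; first by rewrite le_max lexx orbT.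
move=> [a b] [/= ha hb]; rewrite le_max; apply/orP; left.
have := ler_norm L; move: ha hb; rewrite !ler_norml => /andP[? ?] /andP[? ?] ?.
by apply: H; apply/andP; split; lra.
Qed.

(** Cauchy's estimate bounds f' on a box by the values of f on a larger box. Applied
    to the difference z -> f(z + h) - f(z), which is of the order of |h|, it
    bounds f'(w + h) - f'(w) in the same way: f' is Lipschitz. The last estimate is
    Taylor's formula with the derivative taken at a third point. *)
Theorem entire_C11 f (f' : R[i] -> R[i]) (L : R) : (forall z, cdiff f z (f' z)) ->
  exists C, [/\ 0 <= C,
    (forall z, in_box L z -> modulus (f z) <= C),
    (forall z, in_box L z -> modulus (f' z) <= C),
    (forall z w, in_box L z -> in_box L w -> modulus (f z - f w) <= C * modulus (z - w)) &
    (forall z w, in_box L z -> in_box L w -> modulus (f' z - f' w) <= C * modulus (z - w)) /\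
    (forall z w z0, in_box L z -> in_box L w -> in_box L z0 ->
      modulus (f z - f w - f' z0 * (z - w)) <=
      C * (modulus (z - z0) + modulus (w - z0)) * modulus (z - w))].
Proof.
move=> df; have ex z : exists c, cdiff f z c by exists (f' z).
have [M0 [M00 HM0]] := continuous_bounded_box L ex.
have [M2 [M20 HM2]] := continuous_bounded_box (L + 1 + 1) ex.
have sub1 (K : R) z : in_box K z -> in_box (K + 1) z.
  by rewrite -[z in in_box (K + 1) z]addr0 => h; apply: in_boxD; rewrite ?modulus0.
have D1 z : in_box (L + 1) z -> modulus (f' z) <= 4 * M2.
  move=> zL; have -> : 4 * M2 = 2 * (M2 + M2) by ring.
  apply: (deriv_bound df) => u u1; apply: le_trans (le_modulusB _ _) _; apply: lerD.
    by apply: HM2; apply: in_boxD => //; rewrite u1.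
  by apply: HM2; exact: sub1.
have Lip z w : in_box (L + 1) z -> in_box (L + 1) w ->
    modulus (f z - f w) <= 8 * M2 * modulus (z - w).
  move=> zL wL; have -> : 8 * M2 = 2 * (4 * M2) by ring.
  apply: (@modulus_mvt f f') => t t01; first exact: df.
  by apply: D1; exact: in_box_segment.
have Lip' z w : in_box L z -> in_box L w ->
    modulus (f' z - f' w) <= 32 * M2 * modulus (z - w).
  move=> zL wL; pose g v := f (v + (z - w)) + -1 * f v.
  have dg v : cdiff g v (f' (v + (z - w)) + -1 * f' v).
    apply: cdiffD; last by apply: cdiffMl; exact: df.
    have d1 : cdiff (fun u => u + (z - w)) v (1 + 0).
      by apply: cdiffD; [exact: cdiff_id|exact: cdiff_cst].
    by have := cdiff_comp d1 (df (v + (z - w))); rewrite addr0 mulr1.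
  have := deriv_bound (w := w) dg; rewrite mulN1r (addrC w) subrK.
  move=> /(_ (16 * M2 * modulus (z - w))).
  have -> : 2 * (16 * M2 * modulus (z - w)) = 32 * M2 * modulus (z - w) by ring.
  apply=> u u1; rewrite /g !mulN1r.
  have -> : f (w + u + (z - w)) - f (w + u) - (f (w + (z - w)) - f w) =
     (f (z + u) - f (w + u)) - (f z - f w).
    by congr (_ - _ - (f _ - _)); [congr f; ring|ring].
  apply: le_trans (le_modulusB _ _) _.
  have -> : 16 * M2 * modulus (z - w) = 8 * M2 * modulus (z - w) + 8 * M2 * modulus (z - w) by ring.
  apply: lerD; last by apply: Lip; exact: sub1.
  have -> : z - w = (z + u) - (w + u) by ring.
  by apply: Lip; apply: in_boxD => //; rewrite u1.
exists (64 * M2 + M0); split.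
- by rewrite addr_ge0// mulr_ge0.
- by move=> z zL; apply: le_trans (HM0 z zL) _; rewrite lerDr mulr_ge0.
- by move=> z zL; apply: le_trans (D1 z (sub1 _ _ zL)) _; lra.
- move=> z w zL wL; apply: le_trans (Lip z w (sub1 _ _ zL) (sub1 _ _ wL)) _.
  by rewrite ler_wpM2r ?modulus_ge0//; lra.
split.
  move=> z w zL wL; apply: le_trans (Lip' z w zL wL) _.
  by rewrite ler_wpM2r ?modulus_ge0//; lra.
move=> z w z0 zL wL z0L.
pose g v := f v + - f' z0 * v.
have dg v : cdiff g v (f' v + - f' z0 * 1).
  by apply: cdiffD; [exact: df|apply: cdiffMl; exact: cdiff_id].
have -> : f z - f w - f' z0 * (z - w) = g z - g w by rewrite /g; ring.
have := @modulus_mvt g (fun v => f' v + - f' z0 * 1) w z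
  (32 * M2 * (modulus (z - z0) + modulus (w - z0))).
move=> /(_ (fun t _ => dg _)) H; apply: le_trans (H _) _.
  move=> t t01; rewrite mulr1; apply: le_trans (Lip' _ _ (in_box_segment zL wL t01) z0L) _.
  rewrite ler_wpM2l ?mulr_ge0//.
  have -> : w + t%:C * (z - w) - z0 = t%:C * (z - z0) + (1 - t)%:C * (w - z0).
    by rewrite rmorphB /=; ring.
  move: t01 => /andP[t0 t1]; apply: le_trans (le_modulusD _ _) _.
  rewrite !modulusM !modulus_real (ger0_norm t0) ger0_norm ?subr_ge0//.
  by apply: lerD; rewrite ler_piMl ?modulus_ge0//; lra.
rewrite !mulrA ler_wpM2r ?modulus_ge0// ler_wpM2r ?addr_ge0 ?modulus_ge0//.
by lra.
Qed.

End entire.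

(** * Gaussian measure of a small square window *)
Section window.
Context {R : realType}.
Local Notation mu := (@lebesgue_measure R).
Local Notation mu2 := (mu \x mu)%E.
Local Notation Rm := (measurableTypeR R).
Local Notation plane := (Rm * Rm)%type.

(** On a set where the density is close to a constant, the Gaussian measure is
    close to that constant times the area. *)
Lemma gauss2_measure_bounds (W : set plane) (c eta a : R) : measurable W ->
  mu2 W = a%:E -> 0 <= eta ->
  (forall x y, W (x, y) -> `|gauss2_pdf (x, y) - c| <= eta) ->
  (((c - eta) * a)%:E <= gauss2 W <= ((c + eta) * a)%:E)%E.
Proof.
move=> mW aW eta0 H; rewrite gauss2E//.
have a0 : 0 <= a by rewrite -lee_fin -aW.
have mg : measurable_fun W (fun p : plane => (gauss2_pdf p)%:E).
  by apply: measurable_funTS; apply/measurable_EFinP; exact: measurable_gauss2_pdf.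
have cst (k : R) : (\int[mu2]_(p in W) k%:E = (k * a)%:E)%E.
  by transitivity (k%:E * mu2 W)%E; [exact: integral_cst|rewrite aW].
apply/andP; split.
  have [ce|ce] := leP 0 (c - eta).
    rewrite -cst; apply: ge0_le_integral => //.
    move=> [x y] Wxy; rewrite lee_fin; have := H x y Wxy.
    by rewrite ler_norml; lra.
  apply: (@le_trans _ _ 0%E); last first.
    by apply: integral_ge0 => p _; rewrite lee_fin gauss2_pdf_ge0.
  by rewrite lee_fin mulr_le0_ge0// ltW.
rewrite -cst; apply: ge0_le_integral => //.
- by move=> p _; rewrite lee_fin gauss2_pdf_ge0.
- move=> [x y] Wxy; rewrite lee_fin; have := H x y Wxy.
  by rewrite ler_norml; lra.
Qed.

(** Because u -> e^-u is 1-Lipschitz on nonnegative u. *)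
Lemma gauss2_pdf_lip (x y x' y' : R) :
  `|gauss2_pdf (x, y) - gauss2_pdf (x', y')| <= `|x ^+ 2 - x' ^+ 2| + `|y ^+ 2 - y' ^+ 2|.
Proof.
have expL (a b : R) : 0 <= a -> 0 <= b -> `|expR (- a) - expR (- b)| <= `|a - b|.
  have key (u v : R) : 0 <= u -> u <= v -> `|expR (- u) - expR (- v)| <= `|u - v|.
    move=> u0 uv; rewrite ger0_norm; last by rewrite subr_ge0 ler_expR lerN2.
    rewrite ler0_norm ?subr_le0// opprB.
    have -> : expR (- v) = expR (- u) * expR (u - v) by rewrite -expRD; congr expR; ring.
    have e1 : expR (- u) <= 1 by rewrite -expR0 ler_expR oppr_le0.
    have e2 := expR_ge1Dx (u - v); have e3 := expR_ge0 (- u).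
    by have := ler_wpM2l e3 e2; nra.
  move=> a0 b0; have [ab|/ltW ba] := leP a b; first exact: key.
  by rewrite distrC (distrC a); exact: key.
rewrite !gauss2_pdfE -mulrBr normrM.
have p1 : 1 <= 2 * pi :> R by have := @pi_ge2 R; lra.
have -> : `|(2 * pi)^-1| = (2 * pi)^-1 :> R by rewrite ger0_norm// invr_ge0; lra.
have pos (a b : R) : 0 <= (a ^+ 2 + b ^+ 2) / 2.
  by rewrite divr_ge0// addr_ge0// sqr_ge0.
apply: (@le_trans _ _ (1 * `|(x ^+ 2 + y ^+ 2) / 2 - (x' ^+ 2 + y' ^+ 2) / 2|)).
  apply: ler_pM => //; first by rewrite invr_ge0; lra.
    by rewrite invf_le1//; lra.
  exact: expL.
have -> : (x ^+ 2 + y ^+ 2) / 2 - (x' ^+ 2 + y' ^+ 2) / 2 =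
  ((x ^+ 2 - x' ^+ 2) + (y ^+ 2 - y' ^+ 2)) / 2 by ring.
rewrite mul1r normrM (@ger0_norm _ 2^-1) ?invr_ge0//.
have := ler_normD (x ^+ 2 - x' ^+ 2) (y ^+ 2 - y' ^+ 2).
have := normr_ge0 (x ^+ 2 - x' ^+ 2); have := normr_ge0 (y ^+ 2 - y' ^+ 2); lra.
Qed.

Lemma gauss2_pdf_le1 p : gauss2_pdf p <= 1 :> R.
Proof.
case: p => x y; rewrite gauss2_pdfE -[leRHS]mulr1.
have p1 : 1 <= 2 * pi :> R by have := @pi_ge2 R; lra.
apply: ler_pM; rewrite ?expR_ge0 ?invr_ge0 ?invf_le1//; try lra.
by rewrite -expR0 ler_expR oppr_le0 divr_ge0// addr_ge0// sqr_ge0.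
Qed.

(** The coordinates of - (s1 + i s2) in the orthonormal frame (u, i u) lie between
    lo and hi. *)
Definition frame_window (u1 u2 s1 s2 lo hi : R) : Prop :=
  (lo <= - (s1 * u1 + s2 * u2) <= hi) /\ (lo <= - (s2 * u1 - s1 * u2) <= hi).

(** The window is the preimage of a square under an affine map of determinant
    p t: a rotation composed with a triangular map. *)
Lemma lebesgue_measure_window (p q t K1 K2 u1 u2 lo hi : R) :
  p != 0 -> t != 0 -> u1 ^+ 2 + u2 ^+ 2 = 1 -> lo <= hi ->
  let W := [set z : plane |
    frame_window u1 u2 (p * z.1 - K1) (q * z.1 + t * z.2 - K2) lo hi] in
  measurable W /\ mu2 W = ((hi - lo) ^+ 2 / `|p * t|)%:E.
Proof.
move=> p0 t0 u1u2 lohi W.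
pose T (z : plane) : plane :=
  (- (u1 * p + u2 * q) * z.1 + - (u2 * t) * z.2 + (u1 * K1 + u2 * K2),
   - (u1 * q - u2 * p) * z.1 + - (u1 * t) * z.2 + (u1 * K2 - u2 * K1)).
have WE : W = T @^-1` (`[lo, hi] `*` `[lo, hi]).
  have E1 z : (T z).1 = - ((p * z.1 - K1) * u1 + (q * z.1 + t * z.2 - K2) * u2).
    by rewrite /T /=; ring.
  have E2 z : (T z).2 = - ((q * z.1 + t * z.2 - K2) * u1 - (p * z.1 - K1) * u2).
    by rewrite /T /=; ring.
  by apply/seteqP; split=> z; rewrite /W /frame_window /= -E1 -E2 !in_itv.
have mI : measurable (`[lo, hi] `*` `[lo, hi] : set plane) by exact: measurableX.
have det : - (u1 * p + u2 * q) * - (u1 * t) - - (u2 * t) * - (u1 * q - u2 * p) = p * t.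
  by transitivity ((u1 ^+ 2 + u2 ^+ 2) * (p * t)); [ring|rewrite u1u2 mul1r].
split; first by rewrite WE; apply: measurable_preim => //; exact: measurable_affine_map.
rewrite WE lebesgue_measure2_affine//; last by rewrite det mulf_neq0.
have -> : mu2 (`[lo, hi] `*` `[lo, hi]) = (mu `[lo, hi] * mu `[lo, hi])%E.
  exact: product_measure1E.
rewrite det lebesgue_measure_itv /= lte_fin.
move: lohi; rewrite le_eqVlt => /orP[/eqP ->|lh].
  by rewrite ltxx !mule0 subrr expr0n mul0r.
by rewrite lh -EFinB -!EFinM mulrC expr2.
Qed.

End window.

(** * Gaussian measure of a window, with explicit errors *)
Lemma normrM_le (R : realDomainType) (x y A B : R) :
  `|x| <= A -> `|y| <= B -> `|x * y| <= A * B.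
Proof. by move=> xA yB; rewrite normrM; exact: ler_pM. Qed.

Lemma normrD_le (R : realDomainType) (x y A B : R) :
  `|x| <= A -> `|y| <= B -> `|x + y| <= A + B.
Proof. by move=> xA yB; apply: le_trans (ler_normD _ _) _; exact: lerD. Qed.

Lemma normrB_le (R : realDomainType) (x y A B : R) :
  `|x| <= A -> `|y| <= B -> `|x - y| <= A + B.
Proof. by move=> xA yB; apply: le_trans (ler_normB _ _) _; exact: lerD. Qed.

(** A single number b >= 100 bounds all the data of the problem, so that numerical
    constants up to 100 are absorbed by one more power of b. The exponents below
    are not optimal; what matters is that they do not depend on the point of the
    plane. *)
Section window_estimate.
Context {R : realType}.
Local Notation Rm := (measurableTypeR R).
Local Notation plane := (Rm * Rm)%type.
Variables (b p q t K1 K2 : R).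
Hypotheses (b100 : 100 <= b) (p0 : p != 0) (t0 : t != 0).
Hypotheses (qb : `|q| <= b) (pb : `|p^-1| <= b) (tb : `|t^-1| <= b).
Hypotheses (K1b : `|K1| <= b) (K2b : `|K2| <= b).

(** (kap0, kap1) is the value of the coordinates (x, y) for which the triangular
    system p x = K1, q x + t y = K2 holds. *)
Definition kap0 := K1 / p.
Definition kap1 := (K2 - q * kap0) / t.

Let b1 : 1 <= b. Proof. by apply: le_trans b100; rewrite ler1n. Qed.
Let b0 : 0 <= b. Proof. by apply: le_trans b1. Qed.
Let bS (k : R) n : k <= 100 -> k * b ^+ n <= b ^+ n.+1.
Proof. by move=> k100; rewrite exprS ler_wpM2r ?exprn_ge0// (le_trans k100). Qed.
Let bX n m : (n <= m)%N -> b ^+ n <= b ^+ m.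
Proof. by move=> nm; exact: ler_weXn2l. Qed.

Lemma kap0_le : `|kap0| <= b ^+ 2.
Proof. by rewrite expr2; exact: normrM_le. Qed.

Lemma kap1_le : `|kap1| <= 2 * b ^+ 4.
Proof.
apply: le_trans (normrM_le (normrB_le K2b (normrM_le qb kap0_le)) tb) _.
rewrite (_ : (b + b * b ^+ 2) * b = b ^+ 2 + b ^+ 4); last by ring.
by have := @bX 2 4 isT; lra.
Qed.

Lemma frame_coords_le (x y S : R) : `|p * x - K1| <= S -> `|q * x + t * y - K2| <= S ->
  `|x - kap0| <= b * S /\ `|y - kap1| <= 2 * b ^+ 3 * S.
Proof.
move=> s1 s2; have S0 : 0 <= S by apply: le_trans s1.
have xE : x - kap0 = p^-1 * (p * x - K1) by rewrite /kap0; field.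
have yE : y - kap1 = t^-1 * ((q * x + t * y - K2) - q * (x - kap0)).
  by rewrite /kap1 /kap0; field; rewrite p0 t0.
have xb : `|x - kap0| <= b * S by rewrite xE; exact: normrM_le.
split=> //; rewrite yE.
apply: le_trans (normrM_le tb (normrB_le s2 (normrM_le qb xb))) _.
rewrite (_ : b * (S + b * (b * S)) = (b ^+ 1 + b ^+ 3) * S); last by ring.
by rewrite ler_wpM2r//; have := @bX 1 3 isT; lra.
Qed.

(** A window of size of order r around the solution of S = K stays at distance of
    order r from (kap0, kap1), where the density varies little. *)
Lemma window_pdf_le (x y S m r : R) : 1 <= m -> 0 < r <= 1 -> S = 42 * m * r ->
  `|p * x - K1| <= S -> `|q * x + t * y - K2| <= S ->
  `|gauss2_pdf (x, y) - gauss2_pdf (kap0, kap1)| <= b ^+ 10 * m ^+ 2 * r.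
Proof.
move=> m1 /andP[r0 r1] SE s1 s2; have [xk yk] := frame_coords_le s1 s2.
apply: le_trans (gauss2_pdf_lip _ _ _ _) _.
have m0 : 0 <= m by apply: le_trans m1.
have S0 : 0 <= S by rewrite SE !mulr_ge0// ltW.
have Sm : S <= 42 * m by rewrite SE ler_piMr// mulr_ge0.
have bn n : 0 <= b ^+ n by exact: exprn_ge0.
have mr : 0 <= m ^+ 2 * r by rewrite mulr_ge0 ?sqr_ge0// ltW.
have sqE (u v : R) : u ^+ 2 - v ^+ 2 = (u - v) * (u - v + 2 * v) by ring.
have two (v A : R) : `|v| <= A -> `|2 * v| <= 2 * A by move=> vA; rewrite normrM ger0_norm// ler_wpM2l.
have A : `|x ^+ 2 - kap0 ^+ 2| <= b ^+ 5 * (m ^+ 2 * r).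
  rewrite sqE; apply: le_trans (normrM_le xk (normrD_le xk (two _ _ kap0_le))) _.
  apply: (@le_trans _ _ (b * S * (44 * b ^+ 2 * m))).
    apply: ler_wpM2l; first by rewrite mulr_ge0.
    have h1 : b * S <= b ^+ 2 * (42 * m).
      by apply: ler_pM => //; have := @bX 1 2 isT; rewrite expr1.
    have h2 : b ^+ 2 <= b ^+ 2 * m by rewrite ler_peMr.
    by lra.
  rewrite (_ : _ * _ = (42 * b ^+ 1) * (44 * b ^+ 2) * (m ^+ 2 * r)); last by rewrite SE; ring.
  rewrite ler_wpM2r// (_ : b ^+ 5 = b ^+ 2 * b ^+ 3); last by ring.
  by apply: ler_pM; rewrite ?mulr_ge0//; apply: bS; lra.
have B : `|y ^+ 2 - kap1 ^+ 2| <= b ^+ 9 * (m ^+ 2 * r).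
  rewrite sqE; apply: le_trans (normrM_le yk (normrD_le yk (two _ _ kap1_le))) _.
  apply: (@le_trans _ _ (2 * b ^+ 3 * S * (88 * b ^+ 4 * m))).
    apply: ler_wpM2l; first by rewrite !mulr_ge0.
    have h1 : b ^+ 3 * S <= b ^+ 4 * (42 * m) by apply: ler_pM => //; exact: bX.
    have h2 : b ^+ 4 <= b ^+ 4 * m by rewrite ler_peMr.
    by lra.
  rewrite (_ : _ * _ = (84 * b ^+ 3) * (88 * b ^+ 4) * (m ^+ 2 * r)); last by rewrite SE; ring.
  rewrite ler_wpM2r// (_ : b ^+ 9 = b ^+ 4 * b ^+ 5); last by ring.
  by apply: ler_pM; rewrite ?mulr_ge0//; apply: bS; lra.
have h2 : 2 * b ^+ 9 <= b ^+ 10 by apply: bS; lra.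
by have := ler_wpM2r mr (@bX 5 9 isT); have := ler_wpM2r mr h2; lra.
Qed.

Lemma frame_window_le (u1 u2 s1 s2 lo hi S : R) : u1 ^+ 2 + u2 ^+ 2 = 1 ->
  frame_window u1 u2 s1 s2 lo hi -> - S <= lo -> hi <= S ->
  `|s1| <= 2 * S /\ `|s2| <= 2 * S.
Proof.
move=> u12; rewrite /frame_window.
set X := - (s1 * u1 + s2 * u2); set Y := - (s2 * u1 - s1 * u2).
move=> [hX hY] loS hiS.
have XS : `|X| <= S by rewrite ler_norml; apply/andP; split; lra.
have YS : `|Y| <= S by rewrite ler_norml; apply/andP; split; lra.
have u1l : `|u1| <= 1 by rewrite -(@ler_sqr _) ?nnegrE// real_normK ?num_real// expr1n -u12 lerDl sqr_ge0.
have u2l : `|u2| <= 1 by rewrite -(@ler_sqr _) ?nnegrE// real_normK ?num_real// expr1n -u12 lerDr sqr_ge0.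
have -> : s1 = - (X * u1 - Y * u2).
  by transitivity ((u1 ^+ 2 + u2 ^+ 2) * s1); [rewrite u12 mul1r|rewrite /X /Y; ring].
have -> : s2 = - (X * u2 + Y * u1).
  by transitivity ((u1 ^+ 2 + u2 ^+ 2) * s2); [rewrite u12 mul1r|rewrite /X /Y; ring].
rewrite !normrN; split.
  by apply: le_trans (normrB_le (normrM_le XS u1l) (normrM_le YS u2l)) _; lra.
by apply: le_trans (normrD_le (normrM_le XS u2l) (normrM_le YS u1l)) _; lra.
Qed.

Definition window (u1 u2 lo hi : R) : set plane :=
  [set z | frame_window u1 u2 (p * z.1 - K1) (q * z.1 + t * z.2 - K2) lo hi].

Section estimates.
Variables (u1 u2 N r m : R).
Hypotheses (u12 : u1 ^+ 2 + u2 ^+ 2 = 1) (N0 : 0 <= N) (Nm : N <= m).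
Hypotheses (m1 : 1 <= m) (r0 : 0 < r) (r1 : r <= 1).
Let e := 20 * m * r ^+ 2.
Let C := b ^+ 15.
Let c := gauss2_pdf (kap0, kap1).
Let eta := b ^+ 10 * m ^+ 2 * r.

Let m0 : 0 <= m. Proof. by apply: le_trans m1. Qed.
Let bn n : 0 <= b ^+ n. Proof. exact: exprn_ge0. Qed.
Let e0 : 0 <= e. Proof. by rewrite /e mulr_ge0 ?sqr_ge0// mulr_ge0. Qed.
Let eta0 : 0 <= eta.
Proof. by rewrite /eta mulr_ge0 ?(ltW r0)// mulr_ge0 ?sqr_ge0. Qed.
Let c0 : 0 <= c. Proof. exact: gauss2_pdf_ge0. Qed.
Let c1 : c <= 1. Proof. exact: gauss2_pdf_le1. Qed.
Let Dinv : 0 <= `|p * t|^-1 <= b ^+ 2.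
Proof. by rewrite invr_ge0 normr_ge0 -normfV invfM expr2 /= normrM_le. Qed.
Let eS : N * r + e <= 21 * m * r.
Proof.
have h1 := ler_wpM2r (ltW r0) Nm.
have h2 : m * r ^+ 2 <= m * r by rewrite ler_wpM2l// expr2 ler_piMl// ltW.
by rewrite /e; lra.
Qed.

Let window_pdf lo hi x y : - (N * r + e) <= lo -> hi <= N * r + e ->
  window u1 u2 lo hi (x, y) -> `|gauss2_pdf (x, y) - c| <= eta.
Proof.
move=> hlo hhi W; have hS := eS.
have [||s1 s2] := frame_window_le (S := 21 * m * r) u12 W; [lra|lra|].
apply: (window_pdf_le (S := 42 * m * r) (m := m) (r := r)) => //; first by rewrite r0.
  by move: s1 => /=; lra.
by move: s2 => /=; lra.
Qed.

(** Enlarging the square of side N r by the margin e, which is of order r^2, changes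
    its area by a term of order r^3, and on the square the density differs from
    its value c by O(r). *)
Lemma gauss2_window_outer :
  (gauss2 (window u1 u2 (- e) (N * r + e)) <=
   (c * N ^+ 2 * r ^+ 2 / `|p * t| + C * m ^+ 4 * r ^+ 3)%:E)%E.
Proof.
have ge0 := e0; have Nr : 0 <= N * r by rewrite mulr_ge0// ltW.
have [|mW aW] := lebesgue_measure_window q K1 K2 p0 t0 u12 (lo := - e) (hi := N * r + e); first lra.
have /andP[_ H] := gauss2_measure_bounds mW aW eta0
  (fun x y W => window_pdf (lo := - e) (hi := N * r + e) ltac:(lra) (lexx _) W).
apply: le_trans H _; rewrite lee_fin -/c.
move: Dinv; set D := `|p * t|^-1 => /andP[D0 Db].
have -> : N * r + e - - e = N * r + 2 * e by ring.
have Nrm : N * r <= m * r by rewrite ler_wpM2r// ltW.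
have m2r3 : 0 <= m ^+ 2 * r ^+ 3 by rewrite mulr_ge0 ?sqr_ge0// exprn_ge0// ltW.
have m2m4 : m ^+ 2 * r ^+ 3 <= m ^+ 4 * r ^+ 3.
  by apply: ler_wpM2r; [exact: exprn_ge0 (ltW r0)|exact: ler_weXn2l].
have r43 : m ^+ 2 * r ^+ 4 <= m ^+ 2 * r ^+ 3.
  by apply: ler_wpM2l; [exact: sqr_ge0|rewrite exprS ler_piMl// exprn_ge0// ltW].
have sq1 : (N * r + 2 * e) ^+ 2 <= N ^+ 2 * r ^+ 2 + b ^+ 2 * (m ^+ 2 * r ^+ 3).
  have h : N * r * e <= m * r * e by rewrite ler_wpM2r.
  have E1 : m * r * e = 20 * (m ^+ 2 * r ^+ 3) by rewrite /e; ring.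
  have E2 : e ^+ 2 = 400 * (m ^+ 2 * r ^+ 4) by rewrite /e; ring.
  rewrite (_ : (N * r + 2 * e) ^+ 2 = N ^+ 2 * r ^+ 2 + 4 * (N * r * e) + 4 * e ^+ 2); last by ring.
  have m2r3b : 42 * b ^+ 1 * (m ^+ 2 * r ^+ 3) <= b ^+ 2 * (m ^+ 2 * r ^+ 3).
    by rewrite ler_wpM2r//; apply: bS; lra.
  have h3 := ler_wpM2r m2r3 b100.
  rewrite E2; move: h; rewrite E1; lra.
have sq2 : (N * r + 2 * e) ^+ 2 <= b ^+ 2 * (m ^+ 2 * r ^+ 2).
  have mr : 0 <= m * r by rewrite mulr_ge0// ltW.
  have h : N * r + 2 * e <= b * (m * r).
    have h2 : m * r ^+ 2 <= m * r by rewrite ler_wpM2l// expr2 ler_piMl// ltW.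
    by have := ler_wpM2r mr b100; rewrite /e; lra.
  rewrite -!exprMn ler_sqr// nnegrE; first by rewrite addr_ge0// mulr_ge0.
  by rewrite mulr_ge0.
have bD k : 0 <= k -> k * D <= k * b ^+ 2 by move=> k0; exact: ler_wpM2l.
have T1 : c * ((N * r + 2 * e) ^+ 2 * D) <= c * N ^+ 2 * r ^+ 2 * D + b ^+ 4 * (m ^+ 2 * r ^+ 3).
  apply: (@le_trans _ _ (c * ((N ^+ 2 * r ^+ 2 + b ^+ 2 * (m ^+ 2 * r ^+ 3)) * D))).
    by apply: ler_wpM2l => //; exact: ler_wpM2r.
  rewrite (_ : c * (_ * D) = c * N ^+ 2 * r ^+ 2 * D + c * (b ^+ 2 * (m ^+ 2 * r ^+ 3) * D)); last by ring.
  rewrite lerD2l; apply: (@le_trans _ _ (1 * (b ^+ 2 * (m ^+ 2 * r ^+ 3) * D))).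
    by apply: ler_wpM2r => //; rewrite mulr_ge0// mulr_ge0.
  rewrite mul1r (_ : b ^+ 4 * _ = b ^+ 2 * (m ^+ 2 * r ^+ 3) * b ^+ 2); last by ring.
  by apply: bD; rewrite mulr_ge0.
have T2 : eta * ((N * r + 2 * e) ^+ 2 * D) <= b ^+ 14 * (m ^+ 4 * r ^+ 3).
  apply: (@le_trans _ _ (eta * (b ^+ 2 * (m ^+ 2 * r ^+ 2) * b ^+ 2))).
    apply: ler_wpM2l => //; apply: (@le_trans _ _ (b ^+ 2 * (m ^+ 2 * r ^+ 2) * D)).
      exact: ler_wpM2r.
    by apply: bD; rewrite mulr_ge0// mulr_ge0// sqr_ge0.
  by rewrite /eta le_eqVlt; apply/orP; left; apply/eqP; ring.
have m4r3 : 0 <= m ^+ 4 * r ^+ 3 by apply: le_trans m2m4.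
have T3 : b ^+ 4 * (m ^+ 2 * r ^+ 3) <= b ^+ 14 * (m ^+ 4 * r ^+ 3).
  by apply: ler_pM => //; exact: bX.
have T4 : 2 * b ^+ 14 * (m ^+ 4 * r ^+ 3) <= b ^+ 15 * (m ^+ 4 * r ^+ 3).
  by rewrite ler_wpM2r//; apply: bS; lra.
by rewrite mulrDl /C; lra.
Qed.

Lemma gauss2_window_inner :
  ((c * N ^+ 2 * r ^+ 2 / `|p * t|)%:E <=
   gauss2 (window u1 u2 e (N * r - e)) + (C * m ^+ 4 * r ^+ 3)%:E)%E.
Proof.
have ge0 := e0; have Nr : 0 <= N * r by rewrite mulr_ge0// ltW.
have Nrm : N * r <= m * r by rewrite ler_wpM2r// ltW.
have Dinv' := Dinv; move: Dinv'; set D := `|p * t|^-1 => /andP[D0 Db].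
have m2r3 : 0 <= m ^+ 2 * r ^+ 3 by rewrite mulr_ge0 ?sqr_ge0// exprn_ge0// ltW.
have m2m4 : m ^+ 2 * r ^+ 3 <= m ^+ 4 * r ^+ 3.
  by apply: ler_wpM2r; [exact: exprn_ge0 (ltW r0)|exact: ler_weXn2l].
have m4r3 : 0 <= m ^+ 4 * r ^+ 3 by apply: le_trans m2m4.
have T3 : b ^+ 3 * (m ^+ 2 * r ^+ 3) <= b ^+ 14 * (m ^+ 4 * r ^+ 3).
  by apply: ler_pM => //; exact: bX.
have T4 : 2 * b ^+ 14 * (m ^+ 4 * r ^+ 3) <= b ^+ 15 * (m ^+ 4 * r ^+ 3).
  by rewrite ler_wpM2r//; apply: bS; lra.
have T6 : b ^+ 12 * (m ^+ 4 * r ^+ 3) <= b ^+ 14 * (m ^+ 4 * r ^+ 3).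
  by rewrite ler_wpM2r//; exact: bX.
have T7 : 0 <= b ^+ 14 * (m ^+ 4 * r ^+ 3) by rewrite mulr_ge0.
have E1 : m * r * e = 20 * (m ^+ 2 * r ^+ 3) by rewrite /e; ring.
have bD k : 0 <= k -> k * D <= k * b ^+ 2 by move=> k0; exact: ler_wpM2l.
have T5 : c * (4 * (N * r * e) * D) <= b ^+ 3 * (m ^+ 2 * r ^+ 3).
  apply: (@le_trans _ _ (1 * (4 * (m * r * e) * D))).
    apply: ler_pM => //; first by rewrite !mulr_ge0// ltW.
    by rewrite ler_wpM2r// ler_wpM2l// ler_wpM2r.
  have h80 : 80 * b ^+ 2 * (m ^+ 2 * r ^+ 3) <= b ^+ 3 * (m ^+ 2 * r ^+ 3).
    by rewrite ler_wpM2r//; apply: bS; lra.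
  by have := bD (80 * (m ^+ 2 * r ^+ 3)); rewrite E1 mulr_ge0// => /(_ isT); lra.
have [h|h] := leP (2 * e) (N * r); last first.
  apply: (@le_trans _ _ (C * m ^+ 4 * r ^+ 3)%:E); last by rewrite leeDr.
  rewrite lee_fin.
  have : c * ((N * r * (N * r)) * D) <= c * (4 * (N * r * e) * D).
    apply: ler_wpM2l => //; apply: ler_wpM2r => //.
    have := ler_wpM2l Nr (ltW h); have : 0 <= N * r * e by rewrite mulr_ge0.
    by lra.
  by rewrite /C; lra.
have [|mW aW] := lebesgue_measure_window q K1 K2 p0 t0 u12 (lo := e) (hi := N * r - e); first lra.
have /andP[H _] := gauss2_measure_bounds mW aW eta0
  (fun x y W => window_pdf (lo := e) (hi := N * r - e) ltac:(lra) ltac:(lra) W).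
apply: le_trans (leeD2r _ H); rewrite -EFinD lee_fin -/c.
have -> : N * r - e - e = N * r - 2 * e by ring.
have sq1 : N ^+ 2 * r ^+ 2 - 4 * (N * r * e) <= (N * r - 2 * e) ^+ 2.
  rewrite (_ : (N * r - 2 * e) ^+ 2 = N ^+ 2 * r ^+ 2 - 4 * (N * r * e) + 4 * e ^+ 2); last by ring.
  by rewrite lerDl mulr_ge0 ?sqr_ge0.
have sq2 : (N * r - 2 * e) ^+ 2 <= m ^+ 2 * r ^+ 2.
  by rewrite -exprMn ler_sqr ?nnegrE ?subr_ge0//; [lra|rewrite mulr_ge0// ltW].
have T1 : c * N ^+ 2 * r ^+ 2 * D - c * (4 * (N * r * e) * D) <= c * ((N * r - 2 * e) ^+ 2 * D).
  rewrite (_ : _ - _ = c * ((N ^+ 2 * r ^+ 2 - 4 * (N * r * e)) * D)); last by ring.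
  by apply: ler_wpM2l => //; exact: ler_wpM2r.
have T2 : eta * ((N * r - 2 * e) ^+ 2 * D) <= b ^+ 12 * (m ^+ 4 * r ^+ 3).
  apply: (@le_trans _ _ (eta * (m ^+ 2 * r ^+ 2 * b ^+ 2))).
    apply: ler_wpM2l => //; apply: (@le_trans _ _ (m ^+ 2 * r ^+ 2 * D)).
      exact: ler_wpM2r.
    by apply: bD; rewrite mulr_ge0// sqr_ge0.
  by rewrite /eta le_eqVlt; apply/orP; left; apply/eqP; ring.
by rewrite -/D mulrBl /C; lra.
Qed.

End estimates.

(** A window of side of order r^2 has a measure of order r^4. *)
Lemma gauss2_window_thin (r m : R) : 1 <= m -> 0 < r ->
  (gauss2 (window 1 0 (- (20 * m * r ^+ 2)) (20 * m * r ^+ 2)) <=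
   (b ^+ 4 * m ^+ 2 * r ^+ 4)%:E)%E.
Proof.
move=> m1 r0; set e := 20 * m * r ^+ 2.
have e0 : 0 <= e.
  by rewrite /e mulr_ge0 ?sqr_ge0// mulr_ge0// (le_trans ler01 m1).
have u12 : (1 : R) ^+ 2 + 0 ^+ 2 = 1 by rewrite expr1n expr0n addr0.
have [|mW aW] := lebesgue_measure_window q K1 K2 p0 t0 u12 (lo := - e) (hi := e); first lra.
have H1 x y : window 1 0 (- e) e (x, y) -> `|gauss2_pdf (x, y) - 0| <= 1.
  by rewrite subr0 ger0_norm ?gauss2_pdf_ge0// gauss2_pdf_le1.
have /andP[_ H] := gauss2_measure_bounds mW aW ler01 H1.
apply: le_trans H _; rewrite lee_fin add0r mul1r.
apply: (@le_trans _ _ ((e - - e) ^+ 2 * (b * b))).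
  by rewrite ler_wpM2l ?sqr_ge0// -normfV invfM normrM_le.
have -> : (e - - e) ^+ 2 * (b * b) = (40 * b ^+ 1) ^+ 2 * (m ^+ 2 * r ^+ 4) by rewrite /e; ring.
have mr : 0 <= m ^+ 2 * r ^+ 4 by rewrite mulr_ge0 ?sqr_ge0// exprn_ge0// ltW.
have h4 : (40 * b ^+ 1) ^+ 2 <= b ^+ 4.
  rewrite (_ : b ^+ 4 = (b ^+ 2) ^+ 2); last by ring.
  by rewrite ler_sqr ?nnegrE ?mulr_ge0 ?exprn_ge0//; apply: bS; lra.
by rewrite -[b ^+ 4 * _ * _]mulrA; exact: ler_wpM2r.
Qed.

End window_estimate.

(** * Zeros of nearly affine maps *)
Section newton.
Context {R : realType}.

Definition in_square (z0 : R[i]) (l : R) (z : R[i]) : Prop :=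
  `|complex.Re z - complex.Re z0| <= l /\ `|complex.Im z - complex.Im z0| <= l.

Lemma modulusD_swap (z w : R[i]) : modulus z <= modulus w + modulus (z - w).
Proof. by rewrite -{1}(subrK w z) addrC le_modulusD. Qed.

Lemma square_min_exists (F : R[i] -> R) (z0 : R[i]) (l k : R) : 0 <= l -> 0 <= k ->
  (forall z w, in_square z0 l z -> in_square z0 l w ->
     `|F z - F w| <= k * modulus (z - w)) ->
  exists2 z, in_square z0 l z & forall w, in_square z0 l w -> F z <= F w.
Proof.
move=> l0 k0 H.
pose a := complex.Re z0; pose b := complex.Im z0.
pose A : set (R * R) := `[a - l, a + l] `*` `[b - l, b + l].
have AE x y : A (x, y) <-> in_square z0 l (x +i* y).
  rewrite /A /in_square /= !in_itv /= !ler_norml -/a -/b.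
  by split=> -[/andP[h1 h2] /andP[h3 h4]]; split; apply/andP; split; lra.
have cA : compact A by apply: compact_setX; exact: segment_compact.
have A0 : A !=set0.
  exists (a, b); rewrite /A /= !in_itv /=.
  by split; apply/andP; split; lra.
pose f (p : R * R) := F (p.1 +i* p.2).
have cf : {within A, continuous f}.
  apply/subspace_continuousP => -[x y] Axy; apply/cvgrPdist_lt => e e0.
  have k1 : 0 < 2 * (k + 1) by lra.
  rewrite near_withinE; apply/nbhs_ballP; exists (e / (2 * (k + 1))).
    by rewrite /= divr_gt0.
  move=> [x' y'] [/= hx hy] Axy'; rewrite /f /=.
  apply: le_lt_trans (H _ _ ((AE _ _).1 Axy) ((AE _ _).1 Axy')) _.
  have hm : modulus ((x +i* y) - (x' +i* y')) <= `|x - x'| + `|y - y'|.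
    exact: le_modulus_ReIm.
  rewrite /ball /= ltr_pdivlMr// in hx; rewrite /ball /= ltr_pdivlMr// in hy.
  have := ler_wpM2l k0 hm; have := normr_ge0 (x - x'); have := normr_ge0 (y - y').
  by nra.
have [[x y] /[!inE] Axy m] := compact_EVT_min A0 cA cf.
exists (x +i* y); first exact: (AE _ _).1.
by move=> [x' y'] /AE h; apply: (m (x', y')); rewrite inE.
Qed.

(** Let z minimize |g| on the square. As g is close to an affine map of slope V
    and g(z0) is small, z is interior. If g(z) were not 0, a small step in the
    direction of - g(z) / V would decrease |g|. *)
Lemma zero_in_square (g : R[i] -> R[i]) (V z0 : R[i]) (l : R) : V != 0 -> 0 <= l ->
  (forall z w, in_square z0 l z -> in_square z0 l w ->
     modulus (g z - g w - V * (z - w)) <= modulus V / 2 * modulus (z - w)) ->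
  modulus (g z0) < modulus V / 4 * l ->
  exists2 z, in_square z0 l z & g z = 0.
Proof.
move=> V0 l0 H g0; have mV := modulus_gt0 V0.
have z0S : in_square z0 l z0 by split; rewrite subrr normr0.
have V2 : 0 <= 2 * modulus V by rewrite mulr_ge0// ltW.
have [|z zS zmin] := @square_min_exists (fun z => modulus (g z)) z0 l _ l0 V2.
  move=> z w zS wS; have := H z w zS wS.
  have := modulusD_swap (g z) (g w); have := modulusD_swap (g w) (g z).
  rewrite (modulus_distrC (g w)) => h1 h2 h3.
  have h4 : modulus (g z - g w) <= 2 * modulus V * modulus (z - w).
    have := modulusD_swap (g z - g w) (V * (z - w)); rewrite modulusM.
    have := mulr_ge0 (ltW mV) (modulus_ge0 (z - w)); lra.
  by rewrite ler_norml; apply/andP; split; lra.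
exists z => //; apply: contrapT => /eqP gz0.
have gz := modulus_gt0 gz0.
have close : modulus (z - z0) < l.
  have h1 := H z z0 zS z0S; have h2 := zmin z0 z0S.
  have h3 : modulus V * modulus (z - z0) <=
      modulus (g z) + modulus (g z0) + modulus (g z - g z0 - V * (z - z0)).
    rewrite -modulusM.
    have E : V * (z - z0) = g z - g z0 - (g z - g z0 - V * (z - z0)) by ring.
    rewrite {1}E.
    by apply: le_trans (le_modulusB _ _) _; have := le_modulusB (g z) (g z0); lra.
  rewrite ltNge; apply/negP => lz.
  have := ler_wpM2l (ltW mV) lz; lra.
pose q := l - modulus (z - z0).
have q0 : 0 < q by rewrite subr_gt0.
pose t := Num.min 1 (q * modulus V / modulus (g z)).
have t0 : 0 < t by rewrite /t lt_min ltr01/= divr_gt0// mulr_gt0.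
have t1 : t <= 1 by rewrite /t ge_min lexx.
have tq : t * (modulus (g z) / modulus V) <= q.
  rewrite mulrA ler_pdivrMr//; have : t <= q * modulus V / modulus (g z).
    by rewrite /t ge_min lexx orbT.
  by rewrite ler_pdivlMr.
pose h := - (t%:C * (g z / V)).
have hq : modulus h <= q.
  by rewrite /h modulusN !modulusM modulusV modulus_real (ger0_norm (ltW t0)).
have inS (c : R[i] -> R) : (forall u v, c (u + v) = c u + c v) -> (forall u, `|c u| <= modulus u) ->
    `|c (z + h) - c z0| <= l.
  move=> cD cm; have -> : c (z + h) - c z0 = c (z - z0) + c h.
    by have E := cD (z - z0) z0; rewrite subrK in E; rewrite cD E; ring.
  apply: le_trans (ler_normD _ _) _; have := cm (z - z0); have := cm h.
  by move: hq; rewrite /q; lra.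
have ReD (u v : R[i]) : complex.Re (u + v) = complex.Re u + complex.Re v by case: u v => ? ? [].
have ImD (u v : R[i]) : complex.Im (u + v) = complex.Im u + complex.Im v by case: u v => ? ? [].
have zhS : in_square z0 l (z + h).
  by split; [exact: (inS _ ReD (@modulus_Re R))|exact: (inS _ ImD (@modulus_Im R))].
have := zmin _ zhS; apply/negP; rewrite -ltNge.
have := H _ _ zhS zS; rewrite (_ : z + h - z = h); last by ring.
have Vh : V * h = - (t%:C * g z) by rewrite /h mulrN mulrCA; congr (- (_ * _)); field.
have mh : modulus V * modulus h = t * modulus (g z).
  by rewrite -modulusM Vh modulusN modulusM modulus_real (ger0_norm (ltW t0)).
move=> {}H.
have -> : g (z + h) = (g (z + h) - g z - V * h) + (1 - t)%:C * g z.
  by rewrite Vh rmorphB /=; ring.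
apply: le_lt_trans (le_modulusD _ _) _.
rewrite modulusM modulus_real ger0_norm ?subr_ge0//.
have := mulr_gt0 t0 gz; lra.
Qed.

End newton.

(** * Real linear combinations of entire functions on a small cell *)
Section real_combination.
Context {R : realType} (J : finType).

Definition real_comb (a : J -> R[i] -> R[i]) (zeta : J -> R) (z : R[i]) : R[i] :=
  \sum_j a j z * (zeta j)%:C.

(** In the last estimate the derivative is frozen at a third point z0, in the
    applications the corner of a cell that contains z and w. *)
Record C11_on (a a' : J -> R[i] -> R[i]) (L b : R) : Prop := C11On {
  C11_deriv_le : forall j z, in_box L z -> modulus (a' j z) <= b;
  C11_deriv_lip : forall j z w, in_box L z -> in_box L w ->
    modulus (a' j z - a' j w) <= b * modulus (z - w);
  C11_taylor : forall j z w z0, in_box L z -> in_box L w -> in_box L z0 ->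
    modulus (a j z - a j w - a' j z0 * (z - w)) <=
    b * (modulus (z - z0) + modulus (w - z0)) * modulus (z - w) }.

(** Half-open, so that the cells of a grid are disjoint and fill the square. *)
Definition in_cell (z0 : R[i]) (r : R) (z : R[i]) : Prop :=
  (complex.Re z0 <= complex.Re z < complex.Re z0 + r) /\
  (complex.Im z0 <= complex.Im z < complex.Im z0 + r).

Definition in_closed_cell (z0 : R[i]) (r : R) (z : R[i]) : Prop :=
  (complex.Re z0 <= complex.Re z <= complex.Re z0 + r) /\
  (complex.Im z0 <= complex.Im z <= complex.Im z0 + r).

Lemma in_cell_closed z0 r z : in_cell z0 r z -> in_closed_cell z0 r z.
Proof. by move=> [/andP[h1 h2] /andP[h3 h4]]; split; rewrite ?h1 ?h3 ltW. Qed.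

Lemma modulus_closed_cell z0 r z : in_closed_cell z0 r z -> modulus (z - z0) <= 2 * r.
Proof.
case: z z0 => [x y] [x0 y0] [/= h1 h2]; apply: le_trans (le_modulus_ReIm _) _ => /=.
have A : `|x - x0| <= r by rewrite ler_norml; apply/andP; split; lra.
have B : `|y - y0| <= r by rewrite ler_norml; apply/andP; split; lra.
lra.
Qed.

Section bounds.
Variables (a a' : J -> R[i] -> R[i]) (L b : R).
Hypothesis aC : C11_on a a' L b.
Variable zeta : J -> R.
Let T := \sum_j `|zeta j|.
Local Notation S := (real_comb a zeta).
Local Notation S' := (real_comb a' zeta).

Lemma real_comb_le (F : J -> R[i]) (k : R) : (forall j, modulus (F j) <= k) ->
  modulus (\sum_j F j * (zeta j)%:C) <= k * T.
Proof.
move=> Fk; apply: le_trans (modulus_sum _) _; rewrite /T mulr_sumr.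
by apply: ler_sum => j _; rewrite modulusM modulus_real ler_wpM2r.
Qed.

Lemma real_comb_deriv_le z : in_box L z -> modulus (S' z) <= b * T.
Proof. by move=> zL; apply: real_comb_le => j; exact: (C11_deriv_le aC). Qed.

Lemma real_comb_deriv_lip z w : in_box L z -> in_box L w ->
  modulus (S' z - S' w) <= b * T * modulus (z - w).
Proof.
move=> zL wL; rewrite /real_comb -sumrB.
rewrite (eq_bigr (fun j => (a' j z - a' j w) * (zeta j)%:C)); last by move=> j _; ring.
rewrite mulrAC; apply: real_comb_le => j; exact: (C11_deriv_lip aC).
Qed.

Lemma real_comb_taylor z w z0 : in_box L z -> in_box L w -> in_box L z0 ->
  modulus (S z - S w - S' z0 * (z - w)) <=
  b * T * (modulus (z - z0) + modulus (w - z0)) * modulus (z - w).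
Proof.
move=> zL wL z0L; rewrite /real_comb mulr_suml -!sumrB.
rewrite (eq_bigr (fun j => (a j z - a j w - a' j z0 * (z - w)) * (zeta j)%:C)); last first.
  by move=> j _; ring.
have -> : b * T * (modulus (z - z0) + modulus (w - z0)) * modulus (z - w) =
  b * (modulus (z - z0) + modulus (w - z0)) * modulus (z - w) * T by ring.
by apply: real_comb_le => j; exact: (C11_taylor aC).
Qed.

Section sample.
Variables (K : R[i]) (z0 : R[i]) (r : R).
Variables (p q t c0 c1 e0 e1 x y w1 w2 rho : R).
Hypotheses (b100 : 100 <= b) (p0 : p != 0) (t0 : t != 0).
Hypotheses (qb : `|q| <= b) (pb : `|p^-1| <= b) (tb : `|t^-1| <= b).
Hypotheses (K1b : `|complex.Re K| <= b) (K2b : `|complex.Im K| <= b).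
Hypotheses (c0b : `|c0| <= b) (c1b : `|c1| <= b) (e0b : `|e0| <= b) (e1b : `|e1| <= b).
Hypotheses (rho0 : 0 <= rho) (w1b : w1 ^+ 2 <= b ^+ 2 * rho) (w2b : w2 ^+ 2 <= b ^+ 2 * rho).
Hypotheses (r0 : 0 < r) (rb : r * (2 * b ^+ 7) <= 1).
Hypothesis cellL : forall z, in_closed_cell z0 r z -> in_box L z.
Hypothesis S1 : complex.Re (S z0) = p * x.
Hypothesis S2 : complex.Im (S z0) = q * x + t * y.
Hypothesis S'1 : complex.Re (S' z0) = c0 * x + c1 * y + w1.
Hypothesis S'2 : complex.Im (S' z0) = e0 * x + e1 * y + w2.
Hypothesis Tb : T <= b * (`|x| + `|y| + 1 + rho).

Local Notation kap0 := (kap0 p (complex.Re K)).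
Local Notation kap1 := (kap1 p q t (complex.Re K) (complex.Im K)).

(** S'(z0) with (x, y) replaced by the value (kap0, kap1) that it takes when
    S(z0) = K. Where a zero of S - K may lie close to z0, the two differ by O(r).
    Being a function of the residuals only, the frozen derivative is independent
    of S(z0): this is what turns the probability of a zero into a product. *)
Definition frozen_deriv : R[i] :=
  (c0 * kap0 + c1 * kap1 + w1) +i* (e0 * kap0 + e1 * kap1 + w2).
Local Notation V := frozen_deriv.
(* A bound for the modulus of V, and also, multiplied by r, for the Lipschitz
   constant of the error in the affine approximation of S. *)
Let m := b ^+ 15 * (1 + rho).
Let s := S z0 - K.

Let b1 : 1 <= b. Proof. by apply: le_trans b100; rewrite ler1n. Qed.
Let b0 : 0 <= b. Proof. by apply: le_trans b1. Qed.
Let bn n : 0 <= b ^+ n. Proof. exact: exprn_ge0. Qed.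
Let bX n k : (n <= k)%N -> b ^+ n <= b ^+ k.
Proof. by move=> nk; exact: ler_weXn2l. Qed.
Let bS (k : R) n : k <= 100 -> k * b ^+ n <= b ^+ n.+1.
Proof. by move=> k100; rewrite exprS ler_wpM2r ?exprn_ge0// (le_trans k100). Qed.
Let bSX (k : R) n l : k <= 100 -> (n < l)%N -> k * b ^+ n <= b ^+ l.
Proof. by move=> k100 nl; exact: le_trans (bS n k100) (bX nl). Qed.
Let T0 : 0 <= T. Proof. by apply: sumr_ge0. Qed.
Let P0 : 1 <= 1 + rho. Proof. by rewrite lerDl. Qed.
Let Pge0 : 0 <= 1 + rho. Proof. by rewrite addr_ge0. Qed.
Let r1 : r <= 1.
Proof.
apply: le_trans rb; rewrite ler_peMr ?(ltW r0)//.
by have := @bX 0 7 isT; rewrite expr0; lra.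
Qed.
Let m1 : 1 <= m.
Proof.
have h : 1 <= b ^+ 15 by have := @bX 0 15 isT; rewrite expr0.
by rewrite /m (le_trans h)// ler_peMr.
Qed.

Let ReB (u v : R[i]) : complex.Re (u - v) = complex.Re u - complex.Re v.
Proof. by case: u v => ? ? []. Qed.
Let ImB (u v : R[i]) : complex.Im (u - v) = complex.Im u - complex.Im v.
Proof. by case: u v => ? ? []. Qed.

Let s1E : complex.Re s = p * x - complex.Re K. Proof. by rewrite /s ReB S1. Qed.
Let s2E : complex.Im s = q * x + t * y - complex.Im K. Proof. by rewrite /s ImB S2. Qed.

Let coords : `|x - kap0| <= b * modulus s /\ `|y - kap1| <= 2 * b ^+ 3 * modulus s.
Proof.
apply: frame_coords_le => //; first by rewrite -s1E modulus_Re.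
by rewrite -s2E modulus_Im.
Qed.

Let k0 : `|kap0| <= b ^+ 2. Proof. exact: kap0_le. Qed.
Let k1 : `|kap1| <= 2 * b ^+ 4. Proof. exact: kap1_le. Qed.

(* The variables are controlled by rho and by S(z0) - K, since x and y are
   determined by S(z0). *)
Let T_le : T <= b ^+ 6 * (1 + rho) + b ^+ 5 * modulus s.
Proof.
have [hx hy] := coords; have ms := modulus_ge0 s; have hk0 := k0; have hk1 := k1.
have xb : `|x| <= b ^+ 2 + b * modulus s.
  by rewrite -(subrK kap0 x); apply: le_trans (ler_normD _ _) _; lra.
have yb : `|y| <= 2 * b ^+ 4 + 2 * b ^+ 3 * modulus s.
  by rewrite -(subrK kap1 y); apply: le_trans (ler_normD _ _) _; lra.
apply: le_trans Tb _.
apply: (@le_trans _ _ (b * (4 * b ^+ 4 * (1 + rho) + 3 * b ^+ 3 * modulus s))).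
  apply: ler_wpM2l => //.
  have h1 : b ^+ 4 <= b ^+ 4 * (1 + rho) by rewrite ler_peMr.
  have h2 : 1 + rho <= b ^+ 4 * (1 + rho).
    by rewrite ler_peMl//; have := @bX 0 4 isT; rewrite expr0.
  have h3 := @bX 2 4 isT; have h4 := ler_wpM2r ms (@bX 1 3 isT); rewrite expr1 in h4.
  lra.
have -> : b * (4 * b ^+ 4 * (1 + rho) + 3 * b ^+ 3 * modulus s) =
  4 * b ^+ 5 * (1 + rho) + 3 * b ^+ 4 * modulus s by ring.
by apply: lerD; apply: ler_wpM2r => //; apply: bS; lra.
Qed.

Let T_le_of_s : modulus s <= b ^+ 9 * (1 + rho) * r -> T <= b ^+ 8 * (1 + rho).
Proof.
move=> sb; apply: le_trans T_le _.
have h1 : b ^+ 5 * modulus s <= b ^+ 7 * (1 + rho).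
  apply: (@le_trans _ _ (b ^+ 5 * (b ^+ 9 * (1 + rho) * r))); first exact: ler_wpM2l.
  have -> : b ^+ 5 * (b ^+ 9 * (1 + rho) * r) = b ^+ 7 * (1 + rho) * (r * b ^+ 7) by ring.
  rewrite ler_piMr ?mulr_ge0//.
  by have := mulr_ge0 (ltW r0) (bn 7%N); have := rb; lra.
have h2 := ler_wpM2r Pge0 (@bX 6 7 isT).
by have : 2 * b ^+ 7 * (1 + rho) <= b ^+ 8 * (1 + rho); [apply: ler_wpM2r => //; apply: bS; lra|lra].
Qed.

Let z0c : in_closed_cell z0 r z0.
Proof. by split; rewrite lexx lerDl ltW. Qed.
Let z0L : in_box L z0. Proof. exact: cellL. Qed.

(* If S - K vanishes in the cell, then S(z0) - K is at most of order r times the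
   size of S'(z0), and the latter is again bounded in terms of S(z0) - K; the
   smallness of r makes the estimate close up. *)
Let zero_s z : in_closed_cell z0 r z -> S z = K -> modulus s <= b ^+ 9 * (1 + rho) * r.
Proof.
move=> zc Sz; have zL := cellL zc; have hz := modulus_closed_cell zc.
have hz0 := modulus_ge0 (z - z0).
have tay := real_comb_taylor zL z0L z0L; rewrite subrr modulus0 addr0 Sz in tay.
have sE : s = - (K - S z0 - S' z0 * (z - z0)) - S' z0 * (z - z0) by rewrite /s; ring.
have bT : 0 <= b * T by rewrite mulr_ge0.
have sT : modulus s <= 6 * b * T * r.
  rewrite sE; apply: le_trans (le_modulusB _ _) _; rewrite modulusN modulusM.
  have A := ler_pM (modulus_ge0 _) hz0 (real_comb_deriv_le z0L) hz.
  have B : b * T * modulus (z - z0) * modulus (z - z0) <= b * T * 2 * (2 * r).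
    apply: ler_pM => //; first by rewrite mulr_ge0.
    by rewrite ler_wpM2l//; apply: le_trans hz _; have := r1; lra.
  by lra.
have h1 : b ^+ 5 * modulus s <= T / 2.
  apply: (@le_trans _ _ (b ^+ 5 * (6 * b * T * r))); first exact: ler_wpM2l.
  have -> : b ^+ 5 * (6 * b * T * r) = (6 * b ^+ 6) * (T * r) by ring.
  apply: (@le_trans _ _ (b ^+ 7 * (T * r))).
    by apply: ler_wpM2r; [rewrite mulr_ge0// ltW|apply: bS; lra].
  have := ler_wpM2l T0 rb; lra.
have TP : T <= 2 * b ^+ 6 * (1 + rho) by have := T_le; lra.
apply: le_trans sT _.
apply: (@le_trans _ _ (6 * b * (2 * b ^+ 6 * (1 + rho)) * r)).
  by apply: ler_wpM2r; [exact: ltW|apply: ler_wpM2l => //; rewrite mulr_ge0].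
have -> : 6 * b * (2 * b ^+ 6 * (1 + rho)) * r = 12 * b ^+ 7 * ((1 + rho) * r) by ring.
rewrite -[X in _ <= X]mulrA; apply: ler_wpM2r; first by rewrite mulr_ge0// ltW.
by apply: bSX => //; lra.
Qed.

Let frozen_deriv_le6 : modulus V <= b ^+ 6 * (1 + rho).
Proof.
have wl (w : R) : w ^+ 2 <= b ^+ 2 * rho -> `|w| <= b * (1 + rho).
  move=> wb; rewrite -ler_sqr ?nnegrE ?mulr_ge0// real_normK ?num_real//.
  apply: le_trans wb _; rewrite exprMn ler_wpM2l//.
  rewrite (_ : (1 + rho) ^+ 2 = 1 + 2 * rho + rho * rho); last by ring.
  by have := mulr_ge0 rho0 rho0; have := rho0; lra.
apply: le_trans (le_modulus_ReIm _) _ => /=.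
have A := normrD_le (normrD_le (normrM_le c0b k0) (normrM_le c1b k1)) (wl _ w1b).
have B := normrD_le (normrD_le (normrM_le e0b k0) (normrM_le e1b k1)) (wl _ w2b).
apply: le_trans (lerD A B) _.
have h1 : b * b ^+ 2 <= b ^+ 5 * (1 + rho).
  rewrite (_ : b * b ^+ 2 = b ^+ 3 * 1); last by ring.
  by apply: ler_pM => //; exact: bX.
have h2 : b * (2 * b ^+ 4) <= 2 * (b ^+ 5 * (1 + rho)).
  rewrite (_ : b * (2 * b ^+ 4) = 2 * (b ^+ 5 * 1)); last by ring.
  by apply: ler_wpM2l => //; apply: ler_wpM2l.
have h3 : b * (1 + rho) <= b ^+ 5 * (1 + rho).
  by apply: ler_wpM2r => //; have := @bX 1 5 isT; rewrite expr1.
have h4 : 8 * b ^+ 5 * (1 + rho) <= b ^+ 6 * (1 + rho).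
  by apply: ler_wpM2r => //; apply: bSX => //; lra.
lra.
Qed.

Lemma frozen_deriv_le : modulus V <= m.
Proof. by apply: le_trans frozen_deriv_le6 _; apply: ler_wpM2r => //; exact: bX. Qed.

(* S differs from an affine map of slope V by a map with Lipschitz constant m r. *)
Let near_affine : modulus s <= b ^+ 9 * (1 + rho) * r ->
  forall z w, in_closed_cell z0 r z -> in_closed_cell z0 r w ->
  modulus (S z - S w - V * (z - w)) <= m * r * modulus (z - w).
Proof.
move=> sb z w zc wc; have TP := T_le_of_s sb; have [hx hy] := coords.
have ms := modulus_ge0 s.
have SV : modulus (S' z0 - V) <= b ^+ 14 * (1 + rho) * r.
  apply: (@le_trans _ _ (b ^+ 5 * modulus s)); last first.
    have -> : b ^+ 14 * (1 + rho) * r = b ^+ 5 * (b ^+ 9 * (1 + rho) * r) by ring.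
    exact: ler_wpM2l.
  apply: le_trans (le_modulus_ReIm _) _; rewrite ReB ImB S'1 S'2 /=.
  have -> : c0 * x + c1 * y + w1 - (c0 * kap0 + c1 * kap1 + w1) =
    c0 * (x - kap0) + c1 * (y - kap1) by ring.
  have -> : e0 * x + e1 * y + w2 - (e0 * kap0 + e1 * kap1 + w2) =
    e0 * (x - kap0) + e1 * (y - kap1) by ring.
  have A := normrD_le (normrM_le c0b hx) (normrM_le c1b hy).
  have B := normrD_le (normrM_le e0b hx) (normrM_le e1b hy).
  apply: le_trans (lerD A B) _.
  have h1 : 6 * b ^+ 4 * modulus s <= b ^+ 5 * modulus s.
    by apply: ler_wpM2r => //; apply: bS; lra.
  have h2 := ler_wpM2r ms (@bX 2 4 isT); lra.
have tay := real_comb_taylor (cellL zc) (cellL wc) z0L.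
have -> : S z - S w - V * (z - w) = (S z - S w - S' z0 * (z - w)) + (S' z0 - V) * (z - w).
  by ring.
apply: le_trans (le_modulusD _ _) _; rewrite modulusM.
have B := ler_wpM2r (modulus_ge0 (z - w)) SV.
have A : b * T * (modulus (z - z0) + modulus (w - z0)) * modulus (z - w) <=
    b ^+ 14 * (1 + rho) * r * modulus (z - w).
  apply: ler_wpM2r; first exact: modulus_ge0.
  apply: (@le_trans _ _ (b * (b ^+ 8 * (1 + rho)) * (4 * r))).
    apply: ler_pM => //; [by rewrite mulr_ge0|by rewrite addr_ge0 ?modulus_ge0|exact: ler_wpM2l|].
    by have := modulus_closed_cell zc; have := modulus_closed_cell wc; lra.
  have -> : b * (b ^+ 8 * (1 + rho)) * (4 * r) = 4 * b ^+ 9 * ((1 + rho) * r) by ring.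
  rewrite -[X in _ <= X]mulrA; apply: ler_wpM2r; first by rewrite mulr_ge0// ltW.
  by apply: bSX => //; lra.
have C : 2 * b ^+ 14 * ((1 + rho) * r * modulus (z - w)) <= m * r * modulus (z - w).
  have -> : m * r * modulus (z - w) = b ^+ 15 * ((1 + rho) * r * modulus (z - w)).
    by rewrite /m; ring.
  apply: ler_wpM2r; last by apply: bS; lra.
  by rewrite !mulr_ge0 ?modulus_ge0// ltW.
lra.
Qed.

Definition frame (v : R[i]) : R * R :=
  if v == 0 then (1, 0) else (complex.Re v / modulus v, complex.Im v / modulus v).

Lemma frame_unit v : (frame v).1 ^+ 2 + (frame v).2 ^+ 2 = 1.
Proof.
rewrite /frame; case: eqP => [_|/eqP v0] /=; first by rewrite expr1n expr0n addr0.
rewrite !exprMn -mulrDl -modulus_sqr exprVn divff// expf_neq0//.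
by rewrite gt_eqF// modulus_gt0.
Qed.

Lemma frameE v : complex.Re v = modulus v * (frame v).1 /\
  complex.Im v = modulus v * (frame v).2.
Proof.
rewrite /frame; case: eqP => [->|/eqP v0] /=; first by rewrite modulus0 !mul0r.
have h : modulus v != 0 by rewrite gt_eqF// modulus_gt0.
by rewrite ![modulus v * _]mulrC !divfK.
Qed.

Let e := 20 * m * r ^+ 2.
Let mr2 : 0 <= m * r ^+ 2.
Proof. by rewrite mulr_ge0 ?sqr_ge0// (le_trans ler01 m1). Qed.

Let bP9 : 8 * b ^+ 9 * (1 + rho) <= m.
Proof. by apply: ler_wpM2r => //; apply: bSX => //; lra. Qed.

(** At a zero z in the cell, V (z - z0) = - (S(z0) - K) up to O(r^2). Dividing by
    the unit vector of V turns membership of z in the cell into the condition that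
    - (S(z0) - K) lies in a square of side |V| r in the frame of V. *)
Lemma zero_in_cell_window z : in_cell z0 r z -> S z = K ->
  frame_window (frame V).1 (frame V).2 (p * x - complex.Re K)
    (q * x + t * y - complex.Im K) (- e) (modulus V * r + e).
Proof.
move=> zr Sz; have zc := in_cell_closed zr.
have := near_affine (zero_s zc Sz) zc z0c; rewrite Sz.
have -> : K - S z0 - V * (z - z0) = - (s + V * (z - z0)) by rewrite /s; ring.
rewrite modulusN => gb; have gb2 : modulus (s + V * (z - z0)) <= 2 * (m * r ^+ 2).
  apply: le_trans gb _; rewrite (_ : 2 * _ = m * r * (2 * r)); last by ring.
  apply: ler_wpM2l; last exact: modulus_closed_cell.
  by rewrite mulr_ge0// ?(ltW r0)// (le_trans ler01 m1).
have [V1 V2] := frameE V; have u12 := frame_unit V.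
rewrite -s1E -s2E /frame_window.
move: (frame V) V1 V2 u12 => [u1 u2] /= V1 V2 u12.
set g := s + V * (z - z0) in gb2.
have ul (v : R) : v ^+ 2 <= 1 -> `|v| <= 1.
  by move=> v1; rewrite -ler_sqr ?nnegrE// real_normK ?num_real// expr1n.
have u1l : `|u1| <= 1 by apply: ul; rewrite -u12 lerDl sqr_ge0.
have u2l : `|u2| <= 1 by apply: ul; rewrite -u12 lerDr sqr_ge0.
have g1 := le_trans (modulus_Re g) gb2; have g2 := le_trans (modulus_Im g) gb2.
have A := normrD_le (normrM_le g1 u1l) (normrM_le g2 u2l).
have B := normrB_le (normrM_le g2 u1l) (normrM_le g1 u2l).
have genRe (s' v a1 a0 : R[i]) : complex.Re (s' + v * (a1 - a0)) = complex.Re s' +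
    (complex.Re v * (complex.Re a1 - complex.Re a0) - complex.Im v * (complex.Im a1 - complex.Im a0)).
  by case: s' v a1 a0 => ? ? [? ?] [? ?] [? ?].
have genIm (s' v a1 a0 : R[i]) : complex.Im (s' + v * (a1 - a0)) = complex.Im s' +
    (complex.Re v * (complex.Im a1 - complex.Im a0) + complex.Im v * (complex.Re a1 - complex.Re a0)).
  by case: s' v a1 a0 => ? ? [? ?] [? ?] [? ?].
have g1E : complex.Re g = complex.Re s + (modulus V * u1 * (complex.Re z - complex.Re z0)
    - modulus V * u2 * (complex.Im z - complex.Im z0)).
  by rewrite -V1 -V2 /g genRe.
have g2E : complex.Im g = complex.Im s + (modulus V * u1 * (complex.Im z - complex.Im z0)
    + modulus V * u2 * (complex.Re z - complex.Re z0)).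
  by rewrite -V1 -V2 /g genIm.
have E1 : - (complex.Re s * u1 + complex.Im s * u2) =
    modulus V * (complex.Re z - complex.Re z0) - (complex.Re g * u1 + complex.Im g * u2).
  rewrite g1E g2E -[modulus V * (complex.Re z - complex.Re z0)]mulr1 -u12; ring.
have E2 : - (complex.Im s * u1 - complex.Re s * u2) =
    modulus V * (complex.Im z - complex.Im z0) - (complex.Im g * u1 - complex.Re g * u2).
  rewrite g1E g2E -[modulus V * (complex.Im z - complex.Im z0)]mulr1 -u12; ring.
rewrite E1 E2; have [h1 h2] := zc.
have N0 := modulus_ge0 V.
have bnd (d : R) : 0 <= d <= r -> 0 <= modulus V * d <= modulus V * r.
  by move=> /andP[d0 dr]; rewrite mulr_ge0//= ler_wpM2l.
have := bnd (complex.Re z - complex.Re z0); have := bnd (complex.Im z - complex.Im z0).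
move=> /(_ ltac:(apply/andP; split; lra)) /andP[i1 i2].
move=> /(_ ltac:(apply/andP; split; lra)) /andP[j1 j2].
move: A B; rewrite !ler_norml => /andP[A1 A2] /andP[B1 B2].
by rewrite /e; split; apply/andP; split; lra.
Qed.

(** The point z0 + d with V d = - (S(z0) - K) lies in the cell, together with a
    square around it whose size is the margin divided by |V|; the map S - K is
    small at its center and has a zero in that square by zero_in_square. *)
Lemma window_zero_in_cell :
  frame_window (frame V).1 (frame V).2 (p * x - complex.Re K)
    (q * x + t * y - complex.Im K) e (modulus V * r - e) ->
  exists2 z, in_cell z0 r z & S z = K.
Proof.
rewrite -s1E -s2E; have [V1 V2] := frameE V; have u12 := frame_unit V.
move: (frame V) V1 V2 u12 => [u1 u2] /= V1 V2 u12 W.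
have mr0 : 0 < m * r ^+ 2 by rewrite mulr_gt0 ?exprn_gt0// (lt_le_trans ltr01 m1).
have mr20 : 20 * (m * r ^+ 2) = e by rewrite /e; ring.
have N0 := modulus_ge0 V.
have Ne : 2 * e <= modulus V * r by case: W => /andP[h1 h2] _; lra.
have [||s1l s2l] := frame_window_le (S := modulus V * r) u12 W; [lra|lra|].
have Np : 0 < modulus V.
  by rewrite lt_neqAle N0 andbT; apply/eqP => h; move: Ne; rewrite -h; lra.
have V0 : V != 0 by apply/eqP => h; move: Np; rewrite h modulus0 ltxx.
have sb : modulus s <= b ^+ 9 * (1 + rho) * r.
  apply: le_trans (le_modulus_ReIm _) _.
  have h1 := ler_wpM2r (ltW r0) frozen_deriv_le6.
  have h2 : 4 * b ^+ 6 * ((1 + rho) * r) <= b ^+ 9 * ((1 + rho) * r).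
    by apply: ler_wpM2r; [rewrite mulr_ge0// ltW|apply: bSX => //; lra].
  lra.
have na := near_affine sb.
move: W; rewrite /frame_window.
set X := - (complex.Re s * u1 + _); set Y := - (complex.Im s * u1 - _) => -[hX hY].
pose N := modulus V; rewrite -/N in V1 V2 N0 Ne Np hX hY.
(* z0 + d is the zero of the affine approximation. *)
pose d : R[i] := (X / N) +i* (Y / N).
have Nn : N != 0 by rewrite gt_eqF.
have Vd : V * d = - s.
  have E1 : u1 * X - u2 * Y = - complex.Re s.
    by rewrite -[complex.Re s]mul1r -u12 /X /Y; ring.
  have E2 : u1 * Y + u2 * X = - complex.Im s.
    by rewrite -[complex.Im s]mul1r -u12 /X /Y; ring.
  have VE : V = (N * u1) +i* (N * u2) by rewrite -V1 -V2.
  rewrite VE /d; apply/eqP; rewrite eq_complex; apply/andP; split; apply/eqP => /=.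
    by transitivity (u1 * X - u2 * Y); [field|rewrite E1; case: (s)].
  by transitivity (u1 * Y + u2 * X); [field|rewrite E2; case: (s)].
have itv (A : R) : e <= A <= N * r - e -> e / N <= A / N <= r - e / N.
  move=> /andP[A1 A2]; rewrite ler_pM2r ?invr_gt0// A1/=.
  by rewrite ler_pdivrMr// mulrBl divfK// mulrC.
have /andP[x1 x2] := itv _ hX; have /andP[y1 y2] := itv _ hY.
have epos : 0 < e by rewrite -mr20 mulr_gt0.
have eN : 0 < e / N by rewrite divr_gt0.
have l0 : 0 <= e / (2 * N) by rewrite divr_ge0 ?(ltW epos)// mulr_ge0.
have sq z : in_square (z0 + d) (e / (2 * N)) z -> in_cell z0 r z.
  have -> : e / (2 * N) = e / N / 2 by field.
  have [E1 E2] : complex.Re (z0 + d) = complex.Re z0 + X / N /\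
      complex.Im (z0 + d) = complex.Im z0 + Y / N by rewrite /d; case: (z0).
  rewrite /in_square E1 E2 !ler_norml => -[/andP[a1 a2] /andP[a3 a4]].
  by split; apply/andP; split; lra.
have sqc z := fun h => in_cell_closed (sq z h).
have dS : in_square (z0 + d) (e / (2 * N)) (z0 + d).
  by split; rewrite subrr normr0.
have d2r : modulus d <= 2 * r.
  by have := modulus_closed_cell (sqc _ dS); rewrite (addrC z0) addrK.
have mrN : 2 * (m * r) <= N.
  rewrite -(ler_pM2r r0); apply: le_trans Ne.
  by rewrite -mr20 (_ : 2 * (m * r) * r = 2 * (m * r ^+ 2)); [lra|ring].
have [||z zS gz] := @zero_in_square R (fun z => S z - K) V (z0 + d) (e / (2 * N)) V0 l0.
- move=> z w zs ws; have := na z w (sqc _ zs) (sqc _ ws).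
  have -> : S z - K - (S w - K) = S z - S w by ring.
  move=> /le_trans; apply; apply: ler_wpM2r; first exact: modulus_ge0.
  by rewrite -/N; lra.
- have := na _ _ (sqc _ dS) z0c; rewrite (addrC z0) addrK -(addrC z0) Vd opprK /s.
  have -> : S (z0 + d) - S z0 + (S z0 - K) = S (z0 + d) - K by ring.
  move=> /le_lt_trans; apply; rewrite -/N.
  have -> : N / 4 * (e / (2 * N)) = e / 8 by field.
  have := ler_wpM2l (mulr_ge0 (le_trans ler01 m1) (ltW r0)) d2r.
  by rewrite -mr20; lra.
by exists z; [exact: sq|apply/eqP; rewrite -subr_eq0; apply/eqP].
Qed.

(** At a double zero both S - K and S' vanish, so that S'(z0) is O(r) and S(z0) - K
    is O(r^2). *)
Lemma double_zero_in_cell_window z : in_cell z0 r z -> S z = K -> S' z = 0 ->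
  frame_window 1 0 (p * x - complex.Re K) (q * x + t * y - complex.Im K) (- e) e.
Proof.
move=> zr Sz S'z; have zc := in_cell_closed zr; have zL := cellL zc.
have TP := T_le_of_s (zero_s zc Sz).
have hz := modulus_closed_cell zc; have hz0 := modulus_ge0 (z - z0).
have bT : 0 <= b * T by rewrite mulr_ge0.
have := real_comb_taylor zL z0L z0L; rewrite subrr modulus0 addr0 Sz => tay.
have := real_comb_deriv_lip z0L zL; rewrite S'z subr0 modulus_distrC => dlip.
have sE : s = - (K - S z0 - S' z0 * (z - z0)) - S' z0 * (z - z0) by rewrite /s; ring.
have zz : modulus (z - z0) * modulus (z - z0) <= 2 * r * (2 * r) by exact: ler_pM.
have sT : modulus s <= 8 * (b * T) * r ^+ 2.
  rewrite sE; apply: le_trans (le_modulusB _ _) _; rewrite modulusN modulusM.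
  have A := ler_wpM2r hz0 dlip; have B := ler_wpM2l bT zz.
  lra.
have sm : modulus s <= m * r ^+ 2.
  apply: le_trans sT _; apply: ler_wpM2r; first exact: sqr_ge0.
  by have := ler_wpM2l b0 TP; have := bP9; lra.
have h1 := modulus_Re s; have h2 := modulus_Im s.
rewrite /frame_window -s1E -s2E !mulr1 !mulr0 addr0 subr0.
move: h1 h2; rewrite !ler_norml => /andP[? ?] /andP[? ?].
by have := mr2; rewrite /e; split; apply/andP; split; lra.
Qed.

End sample.
End bounds.
End real_combination.

(** * Measurability of windows that depend on the sample *)
Section measurable_window.
Context d (T : measurableType d) (R : realType).
Local Notation Rm := (measurableTypeR R).

Lemma measurable_fun_powR (f : T -> Rm) (p : R) : measurable_fun setT f ->
  measurable_fun setT (fun w => f w `^ p : Rm).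
Proof.
move=> mf; have mp : measurable_fun setT (fun x : Rm => x `^ p : Rm) := measurable_powR _.
exact: (measurableT_comp mp mf).
Qed.

Lemma measurable_invr (f : T -> Rm) : measurable_fun setT f ->
  measurable_fun setT (fun w => (f w)^-1 : Rm).
Proof.
move=> mf.
have -> : (fun w => (f w)^-1 : Rm) = (fun w => f w * (f w ^+ 2) `^ (-1)).
  apply/funext => w; have [->|f0] := eqVneq (f w) 0; first by rewrite invr0 mul0r.
  by rewrite powR_inv1 ?sqr_ge0//; field.
by apply: measurable_funM => //; apply: measurable_fun_powR; exact: measurable_funX.
Qed.

Lemma measurable_modulus (f g : T -> Rm) : measurable_fun setT f -> measurable_fun setT g ->
  measurable_fun setT (fun w => modulus (f w +i* g w) : Rm).
Proof.
move=> mf mg.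
have -> : (fun w => modulus (f w +i* g w) : Rm) = (fun w => (f w ^+ 2 + g w ^+ 2) `^ 2^-1).
  by apply/funext => w; rewrite powR12_sqrt ?addr_ge0 ?sqr_ge0// modulusE.
by apply: measurable_fun_powR; apply: measurable_funD; apply: measurable_funX.
Qed.

(* The frame is a rational function of the modulus away from 0 and constant at 0. *)
Lemma measurable_frame (f g : T -> Rm) : measurable_fun setT f -> measurable_fun setT g ->
  measurable_fun setT (fun w => (frame (f w +i* g w)).1 : Rm) /\
  measurable_fun setT (fun w => (frame (f w +i* g w)).2 : Rm).
Proof.
move=> mf mg; have mm := measurable_modulus mf mg.
have mi := measurable_invr mm.
split.
  have -> : (fun w => (frame (f w +i* g w)).1 : Rm) =
      (fun w => f w * (modulus (f w +i* g w))^-1 +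
                \1_((fun w => modulus (f w +i* g w) : Rm) @^-1` [set 0]) w).
    apply/funext => w; rewrite /frame indicE.
    case: eqP => [h|h] /=.
      rewrite h modulus0 invr0 mulr0 add0r mem_set//= h modulus0//.
    rewrite memNset ?addr0//= => m0; case: h; exact: modulus_eq0.
  apply: measurable_funD; first exact: measurable_funM.
  by apply: measurable_indic; exact: measurable_preim.
have -> : (fun w => (frame (f w +i* g w)).2 : Rm) = (fun w => g w * (modulus (f w +i* g w))^-1).
  apply/funext => w; rewrite /frame; case: eqP => //= h.
  by rewrite h modulus0 invr0 mulr0.
exact: measurable_funM.
Qed.

Lemma measurable_le_between (f g h : T -> Rm) : measurable_fun setT f ->
  measurable_fun setT g -> measurable_fun setT h -> measurable [set w | f w <= g w <= h w].
Proof.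
move=> mf mg mh.
have -> : [set w | f w <= g w <= h w] =
    ((fun w => g w - f w : Rm) @^-1` `[0, +oo[) `&` ((fun w => h w - g w : Rm) @^-1` `[0, +oo[).
  apply/seteqP; split=> w /=; rewrite !in_itv /= !subr_ge0 !andbT.
    by move=> /andP[].
  by move=> [-> ->].
by apply: measurableI; apply: measurable_preim => //; exact: measurable_funB.
Qed.

Lemma measurable_frame_window (f1 f2 g1 g2 lo hi : T -> Rm) :
  measurable_fun setT f1 -> measurable_fun setT f2 ->
  measurable_fun setT g1 -> measurable_fun setT g2 ->
  measurable_fun setT lo -> measurable_fun setT hi ->
  measurable [set w | frame_window (frame (f1 w +i* f2 w)).1 (frame (f1 w +i* f2 w)).2
     (g1 w) (g2 w) (lo w) (hi w)].
Proof.
move=> mf1 mf2 mg1 mg2 mlo mhi; have [m1 m2] := measurable_frame mf1 mf2.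
pose u1 w : Rm := (frame (f1 w +i* f2 w)).1; pose u2 w : Rm := (frame (f1 w +i* f2 w)).2.
apply: (measurableI [set w | lo w <= - (g1 w * u1 w + g2 w * u2 w) <= hi w]
                    [set w | lo w <= - (g2 w * u1 w - g1 w * u2 w) <= hi w]).
  apply: measurable_le_between => //; apply: measurable_funN.
  by apply: measurable_funD; apply: measurable_funM.
apply: measurable_le_between => //; apply: measurable_funN.
by apply: measurable_funB; apply: measurable_funM.
Qed.

End measurable_window.

(** * Moments and the density of zeros *)
Section moment.
Context d (Omega : measurableType d) (R : realType) (P : probability Omega R).
Variable J : finType.
Local Notation Rm := (measurableTypeR R).

Lemma sum_pow4_le (v : J -> R) : (forall j, 0 <= v j) ->
  (1 + \sum_j v j) ^+ 4 <= 8 * (1 + #|J|%:R ^+ 3 * \sum_j v j ^+ 4).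
Proof.
move=> v0.
have sqS (w : J -> R) : (\sum_j w j) ^+ 2 <= #|J|%:R * \sum_j w j ^+ 2.
  have := cauchy_schwarz_sum (fun=> 1) w.
  rewrite (eq_bigr w); last by move=> j _; rewrite mul1r.
  rewrite (_ : \sum_(j : J) 1 ^+ 2 = #|J|%:R)//.
  by under eq_bigr do rewrite expr1n; rewrite sumr_const.
have n0 : 0 <= #|J|%:R :> R by [].
set s := \sum_j v j; set q := \sum_j v j ^+ 4.
have h1 : s ^+ 2 <= #|J|%:R * \sum_j v j ^+ 2 := sqS v.
have h2 : (\sum_j v j ^+ 2) ^+ 2 <= #|J|%:R * q.
  by apply: le_trans (sqS _) _; rewrite ler_wpM2l//; apply: ler_sum => j _; rewrite -exprM.
have h3 : s ^+ 4 <= #|J|%:R ^+ 3 * q.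
  rewrite (exprM s 2 2); apply: (@le_trans _ _ ((#|J|%:R * \sum_j v j ^+ 2) ^+ 2)).
    by rewrite ler_sqr ?nnegrE ?sqr_ge0// (le_trans _ h1)// sqr_ge0.
  rewrite exprMn (_ : _ ^+ 3 * q = #|J|%:R ^+ 2 * (#|J|%:R * q)); last by ring.
  exact: (ler_wpM2l (exprn_ge0 2 n0) h2).
apply: (@le_trans _ _ (8 * (1 + s ^+ 4))); last by rewrite ler_wpM2l// lerD2l.
rewrite -subr_ge0.
have -> : 8 * (1 + s ^+ 4) - (1 + s) ^+ 4 =
  (1 - s) ^+ 2 * ((1 + s) ^+ 2 * 3 + 4 * (1 + s ^+ 2 + s)) + 0 * s by ring.
have q0 : 0 <= 1 + s ^+ 2 + s.
  rewrite (_ : _ + s = (s + 1/2) ^+ 2 + 3 / 4); last by field.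
  by rewrite addr_ge0 ?sqr_ge0//.
rewrite mul0r addr0; apply: mulr_ge0; first exact: sqr_ge0.
by have := sqr_ge0 (1 + s); lra.
Qed.

(** The error terms of the cell estimates are polynomials of degree 4 in rho; only
    the existence of a bound that is uniform over all families indexed by J
    matters. *)
Lemma gauss_family_moment : exists C : R, 0 <= C /\
  forall X : J -> Omega -> R, gauss_family P X ->
  (\int[P]_w ((1 + \sum_j X j w ^+ 2) ^+ 4)%:E <= C%:E)%E.
Proof.
have [C [C0 CE]] := @gauss_moment8 R.
exists (8 * (1 + #|J|%:R ^+ 3 * (#|J|%:R * C))); split.
  by rewrite mulr_ge0// addr_ge0// !mulr_ge0.
move=> X gX; have mX := gX.1.
have mX2 j : measurable_fun setT (fun w => X j w ^+ 2 : Rm).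
  by apply: measurable_funX; exact: mX.
have mX8 j : measurable_fun setT (fun w => (1 + X j w ^+ 2) ^+ 4 : Rm).
  by apply: measurable_funX; apply: measurable_funD; [exact: measurable_cst|exact: mX2].
have mS8 : measurable_fun setT (fun w => \sum_j (1 + X j w ^+ 2) ^+ 4 : Rm).
  exact: measurable_sum.
apply: (@le_trans _ _ (\int[P]_w (8 * 1 + (8 * #|J|%:R ^+ 3) * \sum_j (1 + X j w ^+ 2) ^+ 4)%:E)%E).
  apply: le_ge0_integral_EFin.
  - move=> w; rewrite exprn_ge0 ?addr_ge0 ?sumr_ge0// => [|j _]; last exact: sqr_ge0.
    apply: le_trans (sum_pow4_le _) _ => [j|]; first exact: sqr_ge0.
    rewrite mulrDr mulrA lerD2l; apply: ler_wpM2l; first by rewrite mulr_ge0.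
    apply: ler_sum => j _; rewrite lerXn2r ?nnegrE ?addr_ge0 ?sqr_ge0//.
    by rewrite lerDr.
  - by apply: measurable_funX; apply: measurable_funD => //; exact: measurable_sum.
  - by apply: measurable_funD => //; apply: measurable_funM.
rewrite (ge0_integral_lin2 P (a := 8) (b := 8 * #|J|%:R ^+ 3) (f := cst 1)); last 6 first.
- by [].
- by rewrite mulr_ge0.
- by [].
- by move=> w; apply: sumr_ge0 => j _; rewrite exprn_ge0// addr_ge0// sqr_ge0.
- by [].
- exact: mS8.
have -> : (\int[P]_w (cst 1 w)%:E = 1)%E.
  by transitivity (1 * P setT)%E; [exact: (integral_cst P measurableT 1%E)|rewrite probability_setT mule1].
have -> : (\int[P]_w (\sum_j (1 + X j w ^+ 2) ^+ 4)%:E =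
    \sum_j \int[P]_w ((1 + X j w ^+ 2) ^+ 4)%:E)%E.
  under eq_integral do rewrite -sumEFin.
  rewrite ge0_integral_sum//.
    by move=> j; apply/measurable_EFinP; exact: mX8.
  by move=> j w _; rewrite lee_fin exprn_ge0// addr_ge0// sqr_ge0.
rewrite (_ : 8 * (1 + _) = 8 * 1 + (8 * #|J|%:R ^+ 3) * (#|J|%:R * C)); last by ring.
rewrite [X in (_ <= X)%E]EFinD; apply: leeD.
  by rewrite mule1 mulr1.
rewrite [X in (_ <= X)%E]EFinM; apply: lee_wpmul2l; first by rewrite lee_fin mulr_ge0.
apply: (@le_trans _ _ (\sum_(j : J) C%:E)%E).
  apply: lee_sum => j _.
  have m8 : measurable_fun setT (fun x : Rm => (((1 + x ^+ 2) ^+ 4)%:E : \bar R)).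
    by apply/measurable_EFinP; apply: measurable_funX; apply: measurable_funD => //; exact: measurable_funX.
  rewrite (@ge0_integral_gauss_family _ _ _ _ _ _ j (fun x => ((1 + x ^+ 2) ^+ 4)%:E) gX)//.
  by move=> x; rewrite lee_fin exprn_ge0// addr_ge0// sqr_ge0.
by rewrite sumEFin sumr_const mulr_natl lexx.
Qed.

End moment.

Section density.
Context {R : realType} (J : finType).

(** The Gram determinant of the real and imaginary parts of the coefficients, which
    is the determinant of the covariance of S(z) when a lists the coefficients at
    z. *)
Definition kr_det (a : J -> R[i]) : R :=
  (\sum_j complex.Re (a j) ^+ 2) * (\sum_j complex.Im (a j) ^+ 2) -
  (\sum_j complex.Re (a j) * complex.Im (a j)) ^+ 2.

(** The Kac-Rice density: the density of the Gaussian vector S(z) at K, times the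
    conditional expectation of |S'(z)|^2 given S(z) = K. The latter is the
    conditional variance, CC + EE minus a quadratic form in the covariances
    divided by D, plus the square of the conditional mean, the term with D^2. *)
Definition kr_density (K : R[i]) (a a' : J -> R[i]) : R :=
  let K1 := complex.Re K in let K2 := complex.Im K in
  let A := \sum_j complex.Re (a j) ^+ 2 in
  let B := \sum_j complex.Im (a j) ^+ 2 in
  let C := \sum_j complex.Re (a j) * complex.Im (a j) in
  let AC := \sum_j complex.Re (a j) * complex.Re (a' j) in
  let BC := \sum_j complex.Im (a j) * complex.Re (a' j) in
  let AE := \sum_j complex.Re (a j) * complex.Im (a' j) in
  let BE := \sum_j complex.Im (a j) * complex.Im (a' j) in
  let CC := \sum_j complex.Re (a' j) ^+ 2 in
  let EE := \sum_j complex.Im (a' j) ^+ 2 in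
  let D := kr_det a in
  let u := K1 * B - K2 * C in let v := K2 * A - K1 * C in
  (2 * pi * Num.sqrt D)^-1 *
  expR (- ((K1 ^+ 2 * B + K2 ^+ 2 * A - 2 * K1 * K2 * C) / (2 * D))) *
  (CC + EE
   - ((AC ^+ 2 * B - 2 * AC * BC * C + BC ^+ 2 * A)
      + (AE ^+ 2 * B - 2 * AE * BE * C + BE ^+ 2 * A)) / D
   + ((AC * u + BC * v) ^+ 2 + (AE * u + BE * v) ^+ 2) / D ^+ 2).

End density.

Section density_regression.
Context d (Omega : measurableType d) (R : realType) (P : probability Omega R).
Variable J : finType.

(** In the coordinates of the regression the density of S(z) at K is the Gaussian
    density at (k0, k1) divided by the Jacobian |p t|, and the conditional
    expectation is the second moment of the frozen derivative. *)
Lemma kr_density_regression (X : J -> Omega -> R) (K : R[i]) (a a' : J -> R[i])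
    x y w1 w2 rho (p q t c0 c1 e0 e1 : R) : p != 0 -> t != 0 ->
  regression P X (fun j => complex.Re (a j)) (fun j => complex.Im (a j))
    (fun j => complex.Re (a' j)) (fun j => complex.Im (a' j))
    x y w1 w2 rho p q t c0 c1 e0 e1 ->
  let k0 := kap0 p (complex.Re K) in
  let k1 := kap1 p q t (complex.Re K) (complex.Im K) in
  kr_density K a a' = gauss2_pdf (k0, k1) / `|p * t| *
   (((c0 * k0 + c1 * k1) ^+ 2 + (\sum_j complex.Re (a' j) ^+ 2 - c0 ^+ 2 - c1 ^+ 2)) +
    ((e0 * k0 + e1 * k1) ^+ 2 + (\sum_j complex.Im (a' j) ^+ 2 - e0 ^+ 2 - e1 ^+ 2))).
Proof.
move=> p0 t0 rg k0 k1.
have raa := reg_aa rg; have rab := reg_ab rg; have rbb := reg_bb rg.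
have rac := reg_ac rg; have rbc := reg_bc rg; have rae := reg_ae rg; have rbe := reg_be rg.
rewrite /= in raa rab rbb rac rbc rae rbe.
have DE : kr_det a = (p * t) ^+ 2 by rewrite /kr_det raa rbb rab; ring.
rewrite /kr_density /= DE sqrtr_sqr raa rab rbb rac rbc rae rbe gauss2_pdfE invfM.
move: (\sum_j _ ^+ 2) (\sum_j _ ^+ 2) => CC EE; rewrite /k0 /k1 /kap1 /kap0.
move: (complex.Re K) (complex.Im K) => K1 K2.
have -> : (K1 ^+ 2 * (q ^+ 2 + t ^+ 2) + K2 ^+ 2 * p ^+ 2 - 2 * K1 * K2 * (p * q)) /
    (2 * (p * t) ^+ 2) = ((K1 / p) ^+ 2 + ((K2 - q * (K1 / p)) / t) ^+ 2) / 2.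
  by field; rewrite p0 t0.
rewrite -[RHS]mulrA -[LHS]mulrA -[LHS]mulrA -[RHS]mulrA; congr (_ * _).
rewrite mulrCA; congr (_ * (_ * _)).
by field; rewrite p0 t0.
Qed.

End density_regression.

(** * Probability of a zero in a small cell *)
Section frame_cell.
Context d (Omega : measurableType d) (R : realType) (P : probability Omega R).
Variable J : finType.
Local Notation Rm := (measurableTypeR R).
Local Notation plane := (Rm * Rm)%type.

Lemma Re_real_comb (a : J -> R[i] -> R[i]) (zeta : J -> R) z :
  complex.Re (real_comb a zeta z) = \sum_j complex.Re (a j z) * zeta j.
Proof.
rewrite /real_comb; elim/big_rec2 : _ => // j y1 y2 _ <-.
by case: (a j z) y2 => u v [? ?] /=; rewrite mulr0 subr0.
Qed.

Lemma Im_real_comb (a : J -> R[i] -> R[i]) (zeta : J -> R) z :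
  complex.Im (real_comb a zeta z) = \sum_j complex.Im (a j z) * zeta j.
Proof.
rewrite /real_comb; elim/big_rec2 : _ => // j y1 y2 _ <-.
by case: (a j z) y2 => u v [? ?] /=; rewrite mulr0 add0r.
Qed.

Variables (X : J -> Omega -> R) (a a' : J -> R[i] -> R[i]) (L b Lam : R).
Hypothesis aC : C11_on a a' L b.
Hypothesis XLam : (\int[P]_w ((1 + \sum_j X j w ^+ 2) ^+ 4)%:E <= Lam%:E)%E.
Hypothesis mX : forall j, measurable_fun setT (X j : Omega -> Rm).
Variables (K : R[i]) (z0 : R[i]) (r : R).
Variables (p q t c0 c1 e0 e1 : R) (x y w1 w2 rho : Omega -> R).
Hypotheses (b100 : 100 <= b) (p0 : p != 0) (t0 : t != 0).
Hypotheses (qb : `|q| <= b) (pb : `|p^-1| <= b) (tb : `|t^-1| <= b).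
Hypotheses (K1b : `|complex.Re K| <= b) (K2b : `|complex.Im K| <= b).
Hypotheses (Jb : #|J|%:R <= b).
Hypothesis a'1b : \sum_j complex.Re (a' j z0) ^+ 2 <= b ^+ 2.
Hypothesis a'2b : \sum_j complex.Im (a' j z0) ^+ 2 <= b ^+ 2.
Hypotheses (r0 : 0 < r) (rb : r * (2 * b ^+ 7) <= 1).
Hypothesis cellL : forall z, in_closed_cell z0 r z -> in_box L z.
Hypothesis rg : regression P X (fun j => complex.Re (a j z0)) (fun j => complex.Im (a j z0))
  (fun j => complex.Re (a' j z0)) (fun j => complex.Im (a' j z0))
  x y w1 w2 rho p q t c0 c1 e0 e1.

Let K1 := complex.Re K.
Let K2 := complex.Im K.
Let k0 := kap0 p K1.
Let k1 := kap1 p q t K1 K2.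
Let v1 := c0 * k0 + c1 * k1.
Let v2 := e0 * k0 + e1 * k1.
Let c := gauss2_pdf (k0, k1).
Let b1 : 1 <= b. Proof. by apply: le_trans b100; rewrite ler1n. Qed.
Let b0 : 0 <= b. Proof. by apply: le_trans b1. Qed.
Let r1 : r <= 1.
Proof.
apply: le_trans rb; rewrite ler_peMr ?(ltW r0)//.
by have : 1 <= b ^+ 7; [exact: exprn_ege1|lra].
Qed.

Let sqb (s A : R) : s ^+ 2 <= A -> A <= b ^+ 2 -> `|s| <= b.
Proof.
move=> sA Ab; rewrite -ler_sqr ?nnegrE// real_normK ?num_real//; exact: le_trans sA Ab.
Qed.
Let c0b : `|c0| <= b.
Proof. by apply: sqb a'1b; apply: le_trans (reg_cc rg); rewrite lerDl sqr_ge0. Qed.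
Let c1b : `|c1| <= b.
Proof. by apply: sqb a'1b; apply: le_trans (reg_cc rg); rewrite lerDr sqr_ge0. Qed.
Let e0b : `|e0| <= b.
Proof. by apply: sqb a'2b; apply: le_trans (reg_ee rg); rewrite lerDl sqr_ge0. Qed.
Let e1b : `|e1| <= b.
Proof. by apply: sqb a'2b; apply: le_trans (reg_ee rg); rewrite lerDr sqr_ge0. Qed.
Let rho0 w : 0 <= rho w. Proof. exact: (reg_rho_ge0 rg). Qed.
Let w1b w : w1 w ^+ 2 <= b ^+ 2 * rho w.
Proof. by apply: le_trans (reg_w1_le rg w) _; exact: ler_wpM2r. Qed.
Let w2b w : w2 w ^+ 2 <= b ^+ 2 * rho w.
Proof. by apply: le_trans (reg_w2_le rg w) _; exact: ler_wpM2r. Qed.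

Let Tb w : \sum_j `|X j w| <= b * (`|x w| + `|y w| + 1 + rho w).
Proof.
have s0 : 0 <= `|x w| + `|y w| + 1 + rho w by rewrite !addr_ge0.
apply: (@le_trans _ _ (\sum_(j : J) (`|x w| + `|y w| + 1 + rho w))).
  apply: ler_sum => j _; rewrite -ler_sqr ?nnegrE// real_normK ?num_real//.
  apply: (@le_trans _ _ (\sum_j X j w ^+ 2)).
    by rewrite (bigD1 j)//= lerDl; apply: sumr_ge0 => i _; exact: sqr_ge0.
  rewrite (reg_sq rg) -(real_normK (num_real (x w))) -(real_normK (num_real (y w))).
  have := rho0 w; have := normr_ge0 (x w); have := normr_ge0 (y w).
  by move: `|x w| `|y w| (rho w) => A B C; nra.
by rewrite sumr_const -mulr_natl ler_wpM2r.
Qed.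

Let S1 w : complex.Re (real_comb a (X^~ w) z0) = p * x w.
Proof. by rewrite Re_real_comb (reg_a rg). Qed.
Let S2 w : complex.Im (real_comb a (X^~ w) z0) = q * x w + t * y w.
Proof. by rewrite Im_real_comb (reg_b rg). Qed.
Let S'1 w : complex.Re (real_comb a' (X^~ w) z0) = c0 * x w + c1 * y w + w1 w.
Proof. by rewrite Re_real_comb (reg_c rg). Qed.
Let S'2 w : complex.Im (real_comb a' (X^~ w) z0) = e0 * x w + e1 * y w + w2 w.
Proof. by rewrite Im_real_comb (reg_e rg). Qed.

Let V (s1 s2 : R) : R[i] := (v1 + s1) +i* (v2 + s2).
Let VE w : frozen_deriv K p q t c0 c1 e0 e1 (w1 w) (w2 w) = V (w1 w) (w2 w).
Proof. by []. Qed.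
Let m (s : R) := b ^+ 15 * (1 + s).
Let e (s : R) := 20 * m s * r ^+ 2.
Let m1 w : 1 <= m (rho w).
Proof.
have h : 1 <= b ^+ 15 by exact: exprn_ege1.
by rewrite /m (le_trans h)// ler_peMr ?(le_trans ler01 h)// lerDl.
Qed.
Let Vm w : modulus (V (w1 w) (w2 w)) <= m (rho w).
Proof. by rewrite -VE; exact: frozen_deriv_le. Qed.

(* The window as a condition on the residuals and on (x, y); for double zeros
   (thin) the frame is the standard one. *)
Let F (thin : bool) (lo hi : Rm * Rm * Rm -> Rm) : set ((Rm * Rm * Rm) * plane) :=
  [set z | frame_window
     (frame (if thin then 1 else V z.1.1.1 z.1.1.2)).1
     (frame (if thin then 1 else V z.1.1.1 z.1.1.2)).2
     (p * z.2.1 - K1) (q * z.2.1 + t * z.2.2 - K2) (lo z.1) (hi z.1)].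

Let mF thin lo hi : measurable_fun setT lo -> measurable_fun setT hi ->
  measurable (F thin lo hi).
Proof.
move=> mlo mhi; pose D := ((Rm * Rm * Rm) * plane)%type.
have ml : measurable_fun setT (fun z : D => lo z.1) := measurableT_comp mlo measurable_fst.
have mh : measurable_fun setT (fun z : D => hi z.1) := measurableT_comp mhi measurable_fst.
have m11 : measurable_fun setT (fun z : D => z.1.1 : (Rm * Rm)%type).
  exact: (measurableT_comp measurable_fst measurable_fst).
have ms1 : measurable_fun setT (fun z : D => z.1.1.1 : Rm).
  exact: (measurableT_comp measurable_fst m11).
have ms2 : measurable_fun setT (fun z : D => z.1.1.2 : Rm).
  exact: (measurableT_comp measurable_snd m11).
have mg1 : measurable_fun setT (fun z : D => p * z.2.1 - K1 : Rm).
  rewrite (_ : (fun _ => _) = (fun z : plane => p * z.1 + 0 * z.2 + - K1) \o snd); last first.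
    by apply/funext => z /=; rewrite mul0r addr0.
  exact: (measurableT_comp (measurable_affine2 _ _ _) measurable_snd).
have mg2 : measurable_fun setT (fun z : D => q * z.2.1 + t * z.2.2 - K2 : Rm).
  exact: (measurableT_comp (measurable_affine2 q t (- K2)) measurable_snd).
case: thin.
  have cst k : measurable_fun setT (fun _ : D => k : Rm) by exact: measurable_cst.
  exact: (measurable_frame_window (cst 1) (cst 0) mg1 mg2 ml mh).
have mv1 : measurable_fun setT (fun z : D => v1 + z.1.1.1 : Rm).
  by apply: measurable_funD; [exact: measurable_cst|exact: ms1].
have mv2 : measurable_fun setT (fun z : D => v2 + z.1.1.2 : Rm).
  by apply: measurable_funD; [exact: measurable_cst|exact: ms2].
exact: (measurable_frame_window mv1 mv2 mg1 mg2 ml mh).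
Qed.

Let eta w : Rm * Rm * Rm := (w1 w, w2 w, rho w).
Let meta : measurable_fun setT eta.
Proof.
apply/measurable_fun_pair => /=; last exact: (reg_mrho rg).
by apply/measurable_fun_pair => /=; [exact: (reg_mw1 rg)|exact: (reg_mw2 rg)].
Qed.

Let mxy : measurable_fun setT (fun w => (x w, y w) : plane).
Proof.
have lin (s : J -> R) : measurable_fun setT (fun w => \sum_j s j * X j w : Rm).
  apply: measurable_sum => j; apply: measurable_funM; [exact: measurable_cst|exact: mX].
have mx : measurable_fun setT (x : Omega -> Rm).
  have -> : x = fun w => p^-1 * \sum_j complex.Re (a j z0) * X j w.
    by apply/funext => w; rewrite (reg_a rg) mulKf.
  by apply: measurable_funM; [exact: measurable_cst|exact: lin].
have my : measurable_fun setT (y : Omega -> Rm).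
  have -> : y = fun w => t^-1 * (\sum_j complex.Im (a j z0) * X j w - q * x w).
    by apply/funext => w; rewrite (reg_b rg) (addrC (q * _)) addrK mulKf.
  apply: measurable_funM; first exact: measurable_cst.
  apply: measurable_funB; first exact: lin.
  by apply: measurable_funM; [exact: measurable_cst|exact: mx].
by apply/measurable_fun_pair.
Qed.

Let event thin lo hi := [set w | F thin lo hi (eta w, (x w, y w))].
Let mevent thin lo hi : measurable_fun setT lo -> measurable_fun setT hi ->
  measurable (event thin lo hi).
Proof.
move=> mlo mhi.
have mm : measurable_fun setT (fun w => (eta w, (x w, y w)) : ((Rm * Rm * Rm) * plane)%type).
  by apply/measurable_fun_pair.
exact: (measurable_preim mm (mF thin mlo mhi)).
Qed.

Let wdw thin lo hi w := window p q t K1 K2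
  (frame (if thin then 1 else V (w1 w) (w2 w))).1
  (frame (if thin then 1 else V (w1 w) (w2 w))).2 (lo (eta w)) (hi (eta w)).

Let xsecE thin lo hi w : xsection (F thin lo hi) (eta w) = wdw thin lo hi w.
Proof. by apply/seteqP; split=> z; rewrite /xsection /= inE. Qed.

(* With the residuals frozen, the probability is the Gaussian measure of a window. *)
Let P_event thin lo hi : measurable_fun setT lo -> measurable_fun setT hi ->
  P (event thin lo hi) = (\int[P]_w gauss2 (wdw thin lo hi w))%E.
Proof.
move=> mlo mhi; rewrite (reg_indep rg (mF thin mlo mhi)).
by apply: eq_integral => w _; rewrite -xsecE.
Qed.

Let mwdw thin lo hi : measurable_fun setT lo -> measurable_fun setT hi ->
  measurable_fun setT (fun w => gauss2 (wdw thin lo hi w) : \bar R).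
Proof.
move=> mlo mhi; under eq_fun do rewrite -xsecE.
exact: (measurableT_comp (measurable_fun_xsection gauss2 (mF thin mlo mhi)) meta).
Qed.

Let N w := modulus (V (w1 w) (w2 w)).
(* The second moment of the modulus N of the frozen derivative. *)
Let M := (v1 ^+ 2 + (\sum_j complex.Re (a' j z0) ^+ 2 - c0 ^+ 2 - c1 ^+ 2)) +
    (v2 ^+ 2 + (\sum_j complex.Im (a' j z0) ^+ 2 - e0 ^+ 2 - e1 ^+ 2)).

Let mvw (s : R) (w' : Omega -> Rm) : measurable_fun setT w' ->
  measurable_fun setT (fun w => (s + w' w) ^+ 2 : Rm).
Proof.
by move=> mw; apply: measurable_funX; apply: measurable_funD => //; exact: measurable_cst.
Qed.

Let NE : (fun w => N w ^+ 2 : Rm) = (fun w => 1 * (v1 + w1 w) ^+ 2 + 1 * (v2 + w2 w) ^+ 2).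
Proof. by apply/funext => w; rewrite /N modulus_sqr !mul1r. Qed.

Let mN : measurable_fun setT (fun w => N w ^+ 2 : Rm).
Proof.
rewrite NE; apply: measurable_funD.
  by apply: measurable_funM; [exact: measurable_cst|exact: (mvw _ (reg_mw1 rg))].
by apply: measurable_funM; [exact: measurable_cst|exact: (mvw _ (reg_mw2 rg))].
Qed.

Let EN : (\int[P]_w (N w ^+ 2)%:E = M%:E)%E.
Proof.
transitivity (\int[P]_w (1 * (v1 + w1 w) ^+ 2 + 1 * (v2 + w2 w) ^+ 2)%:E)%E.
  by apply: eq_integral => w _; rewrite -(congr1 (fun f => f w) NE).
rewrite (ge0_integral_lin2 P (a := 1) (b := 1)
  (f := fun w => (v1 + w1 w) ^+ 2) (g := fun w => (v2 + w2 w) ^+ 2)); last 6 first.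
- by [].
- by [].
- by move=> w; exact: sqr_ge0.
- by move=> w; exact: sqr_ge0.
- exact: (mvw _ (reg_mw1 rg)).
- exact: (mvw _ (reg_mw2 rg)).
by rewrite (reg_E1 rg) (reg_E2 rg) !mul1e -EFinD.
Qed.

Let mP4 : measurable_fun setT (fun w => (1 + rho w) ^+ 4 : Rm).
Proof.
apply: measurable_funX; apply: measurable_funD; [exact: measurable_cst|exact: (reg_mrho rg)].
Qed.

Let EP4 : (\int[P]_w ((1 + rho w) ^+ 4)%:E <= Lam%:E)%E.
Proof.
apply: le_trans XLam; apply: le_ge0_integral_EFin => [w||].
- rewrite exprn_ge0 ?addr_ge0//= lerXn2r ?nnegrE ?addr_ge0 ?sumr_ge0// ?lerD2l.
    by move=> j _; exact: sqr_ge0.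
  by rewrite (reg_sq rg) lerDr addr_ge0// sqr_ge0.
- exact: mP4.
- apply: measurable_funX; apply: measurable_funD; first exact: measurable_cst.
  by apply: measurable_sum => j; apply: measurable_funX; exact: mX.
Qed.

Let combine (A B : R) : 0 <= A -> 0 <= B ->
  (\int[P]_w (A * N w ^+ 2 + B * (1 + rho w) ^+ 4)%:E <= (A * M + B * Lam)%:E)%E.
Proof.
move=> A0 B0; rewrite (ge0_integral_lin2 P (a := A) (b := B)
  (f := fun w => N w ^+ 2) (g := fun w => (1 + rho w) ^+ 4)); last 6 first.
- by [].
- by [].
- by move=> w; exact: sqr_ge0.
- by move=> w; rewrite exprn_ge0// addr_ge0.
- exact: mN.
- exact: mP4.
rewrite EN [X in (_ <= X)%E]EFinD !EFinM; apply: leeD => //.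
by apply: lee_wpmul2l.
Qed.

Let mcomb (A B : R) :
  measurable_fun setT (fun w => (A * N w ^+ 2 + B * (1 + rho w) ^+ 4)%:E : \bar R).
Proof.
apply/measurable_EFinP; apply: measurable_funD.
  by apply: measurable_funM; [exact: measurable_cst|exact: mN].
by apply: measurable_funM; [exact: measurable_cst|exact: mP4].
Qed.

Let Zero : set Omega := [set w | exists2 z, in_cell z0 r z & real_comb a (X^~ w) z = K].
Let h := kr_density K (fun j => a j z0) (fun j => a' j z0).
(* The error b^15 m^4 r^3 with m = b^15 (1 + rho), where Lam bounds E (1 + rho)^4. *)
Let C := b ^+ 75 * Lam.
Let D := c / `|p * t|.
Let hE : h = D * M. Proof. exact: (kr_density_regression K p0 t0 rg). Qed.
Let D0 : 0 <= D. Proof. by rewrite divr_ge0// gauss2_pdf_ge0. Qed.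

Let elo (z : Rm * Rm * Rm) : Rm := e z.2.
Let ehi (z : Rm * Rm * Rm) : Rm := modulus (V z.1.1 z.1.2) * r.
Let melo : measurable_fun setT elo.
Proof.
rewrite (_ : elo = (fun z : Rm => (20 * b ^+ 15 * r ^+ 2) * z + 20 * b ^+ 15 * r ^+ 2) \o snd).
  exact: (measurableT_comp (measurable_affine _ _) measurable_snd).
by apply/funext => z; rewrite /elo /e /m /=; ring.
Qed.
Let mehi : measurable_fun setT ehi.
Proof.
pose T := (Rm * Rm * Rm)%type.
have m11 : measurable_fun setT (fun z : T => z.1.1 : Rm) := measurableT_comp measurable_fst measurable_fst.
have m12 : measurable_fun setT (fun z : T => z.1.2 : Rm) := measurableT_comp measurable_snd measurable_fst.
apply: measurable_funM; last exact: measurable_cst.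
apply: measurable_modulus.
  by apply: measurable_funD; [exact: measurable_cst|exact: m11].
by apply: measurable_funD; [exact: measurable_cst|exact: m12].
Qed.

(** Integrating c N^2 r^2 / |p t| over the residuals gives r^2 times the density. *)
Lemma frame_cell_upper : measurable Zero -> (P Zero <= (r ^+ 2 * h + C * r ^+ 3)%:E)%E.
Proof.
move=> mZ; pose lo z := - elo z; pose hi z := ehi z + elo z.
have mlo : measurable_fun setT lo by exact: measurable_funN.
have mhi : measurable_fun setT hi by exact: measurable_funD.
apply: (@le_trans _ _ (P (event false lo hi))).
  apply: le_measure; rewrite ?inE//; first exact: mevent.
  move=> w [z zc Sz]; rewrite /event /F /lo /hi /elo /ehi /=.
  exact: (zero_in_cell_window aC b100 p0 t0 qb pb tb K1b K2b c0b c1b e0b e1b (rho0 w) r0 rb cellL (S1 w) (S2 w) (S'1 w) (S'2 w) (Tb w) zc Sz).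
rewrite (P_event _ mlo mhi).
have -> : r ^+ 2 * h + C * r ^+ 3 = (D * r ^+ 2) * M + (b ^+ 75 * r ^+ 3) * Lam.
  by rewrite hE /C; ring.
apply: le_trans (combine _ _); last 2 first.
- by rewrite mulr_ge0// sqr_ge0.
- by rewrite mulr_ge0 ?exprn_ge0// ltW.
apply: ge0_le_integral => //; first exact: mwdw.
move=> w _; have := gauss2_window_outer b100 p0 t0 qb pb tb K1b K2b (frame_unit (V (w1 w) (w2 w)))
  (modulus_ge0 _) (Vm w) (m1 w) r0 r1.
move=> /le_trans; apply; rewrite lee_fin le_eqVlt; apply/orP; left; apply/eqP.
by rewrite /D /c /N /m; ring.
Qed.

Lemma frame_cell_lower : measurable Zero -> ((r ^+ 2 * h)%:E <= P Zero + (C * r ^+ 3)%:E)%E.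
Proof.
move=> mZ; pose lo z := elo z; pose hi z := ehi z - elo z.
have mlo : measurable_fun setT lo by exact: melo.
have mhi : measurable_fun setT hi by exact: measurable_funB.
have B0 : 0 <= b ^+ 75 * r ^+ 3 by rewrite mulr_ge0 ?exprn_ge0// ltW.
apply: (@le_trans _ _ (P (event false lo hi) + (C * r ^+ 3)%:E)%E); last first.
  apply: leeD => //; apply: le_measure; rewrite ?inE//; first exact: mevent.
  move=> w; rewrite /event /F /lo /hi /elo /ehi /= => W.
  exact: (window_zero_in_cell aC b100 p0 t0 qb pb tb K1b K2b c0b c1b e0b e1b (rho0 w)
    (w1b w) (w2b w) r0 rb cellL (S1 w) (S2 w) (S'1 w) (S'2 w) (Tb w) W).
rewrite (P_event _ mlo mhi).
apply: (@le_trans _ _ (\int[P]_w (gauss2 (wdw false lo hi w) +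
    (0 * N w ^+ 2 + b ^+ 75 * r ^+ 3 * (1 + rho w) ^+ 4)%:E))%E); last first.
  rewrite ge0_integralD//; last 2 first.
  - exact: mwdw.
  - by move=> w _; rewrite lee_fin mul0r add0r mulr_ge0// exprn_ge0// addr_ge0.
  apply: leeD => //; apply: le_trans (combine _ _) _ => //.
  by rewrite lee_fin le_eqVlt; apply/orP; left; apply/eqP; rewrite /C; ring.
have -> : (r ^+ 2 * h)%:E = (\int[P]_w ((D * r ^+ 2) * N w ^+ 2 + 0 * N w ^+ 2)%:E)%E.
  rewrite (ge0_integral_lin2 P (a := D * r ^+ 2) (b := 0)
    (f := fun w => N w ^+ 2) (g := fun w => N w ^+ 2)); last 6 first.
  - by rewrite mulr_ge0// sqr_ge0.
  - by [].
  - by move=> w; exact: sqr_ge0.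
  - by move=> w; exact: sqr_ge0.
  - exact: mN.
  - exact: mN.
  by rewrite EN mul0e adde0 -EFinM hE; congr EFin; ring.
apply: ge0_le_integral => //.
- by move=> w _; rewrite lee_fin mul0r addr0; do 2! (apply: mulr_ge0; last exact: sqr_ge0).
- apply/measurable_EFinP; apply: measurable_funD.
    by apply: measurable_funM; [exact: measurable_cst|exact: mN].
  by apply: measurable_funM; [exact: measurable_cst|exact: mN].
- by apply: emeasurable_funD; [exact: mwdw|exact: mcomb].
move=> w _; have := gauss2_window_inner b100 p0 t0 qb pb tb K1b K2b (frame_unit (V (w1 w) (w2 w)))
  (modulus_ge0 _) (Vm w) (m1 w) r0 r1.
have -> : b ^+ 15 * m (rho w) ^+ 4 * r ^+ 3 =
    0 * N w ^+ 2 + b ^+ 75 * r ^+ 3 * (1 + rho w) ^+ 4 by rewrite /m; ring.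
apply: le_trans; rewrite lee_fin le_eqVlt; apply/orP; left; apply/eqP.
by rewrite /D /c /N; ring.
Qed.

Lemma frame_cell_double : exists E, [/\ measurable E,
  (forall w, (exists z, [/\ in_cell z0 r z, real_comb a (X^~ w) z = K &
     real_comb a' (X^~ w) z = 0]) -> E w) & (P E <= (C * r ^+ 4)%:E)%E].
Proof.
pose lo z := - elo z.
have mlo : measurable_fun setT lo by exact: measurable_funN.
exists (event true lo elo); split; first exact: mevent.
  move=> w [z [zc Sz S'z]]; rewrite /event /F /lo /elo /=.
  have -> : frame (1 : R[i]) = (1, 0).
    by rewrite /frame oner_eq0 modulus1 !divr1.
  exact: (double_zero_in_cell_window aC b100 p0 t0 qb pb tb K1b K2b (rho0 w)
     r0 rb cellL (S1 w) (S2 w) (Tb w) zc Sz S'z).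
rewrite (P_event _ mlo melo).
have -> : C * r ^+ 4 = 0 * M + (b ^+ 75 * r ^+ 4) * Lam by rewrite /C; ring.
have B0 : 0 <= b ^+ 75 * r ^+ 4 by rewrite mulr_ge0 ?exprn_ge0// ltW.
apply: le_trans (combine _ _) => //.
apply: ge0_le_integral => //; first exact: mwdw.
move=> w _; rewrite /wdw /lo /elo /=.
have -> : frame (1 : R[i]) = (1, 0).
  by rewrite /frame oner_eq0 modulus1 !divr1.
have := gauss2_window_thin q K1 K2 b100 p0 t0 pb tb (m1 w) r0.
move=> /le_trans; apply; rewrite lee_fin mul0r add0r -/(m (rho w)).
have -> : b ^+ 4 * m (rho w) ^+ 2 * r ^+ 4 = b ^+ 34 * (1 + rho w) ^+ 2 * r ^+ 4.
  by rewrite /m; ring.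
rewrite mulrAC; apply: ler_pM; rewrite ?mulr_ge0 ?exprn_ge0 ?(ltW r0) ?addr_ge0//.
  by rewrite ler_wpM2r ?exprn_ge0 ?(ltW r0)//; exact: ler_weXn2l.
by apply: ler_weXn2l => //; rewrite lerDl.
Qed.

End frame_cell.

Section uniform_C11.
Context {R : realType} (J : finType).

Lemma entire_family_C11 (a a' : J -> R[i] -> R[i]) (L : R) :
  (forall j z, cdiff (a j) z (a' j z)) ->
  exists B, [/\ 0 <= B, C11_on a a' L B,
    (forall j z, in_box L z -> modulus (a j z) <= B) &
    (forall j z w, in_box L z -> in_box L w -> modulus (a j z - a j w) <= B * modulus (z - w))].
Proof.
move=> da; have /choice[C HC] j := entire_C11 L (da j).
exists (\sum_j C j); have C0 j : 0 <= C j by case: (HC j).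
have CB j : C j <= \sum_j C j.
  by rewrite (bigD1 j)//= lerDl; apply: sumr_ge0 => i _; exact: C0.
have H j (P : R -> Prop) : P (C j) -> (forall A B, A <= B -> P A -> P B) -> P (\sum_j C j).
  by move=> Pj mono; exact: mono (CB j) Pj.
split.
- by apply: sumr_ge0 => j _; exact: C0.
- split=> [j z zL|j z w zL wL|j z w z0 zL wL z0L]; have [_ h1 h2 h3 [h4 h5]] := HC j.
  + exact: le_trans (h2 _ zL) (CB j).
  + by apply: le_trans (h4 _ _ zL wL) _; apply: ler_wpM2r; [exact: modulus_ge0|exact: CB].
  + apply: le_trans (h5 _ _ _ zL wL z0L) _.
    rewrite -!mulrA; apply: ler_wpM2r; last exact: CB.
    by rewrite mulr_ge0 ?addr_ge0 ?modulus_ge0.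
- by move=> j z zL; have [_ h1 h2 h3 [h4 h5]] := HC j; exact: le_trans (h1 _ zL) (CB j).
- move=> j z w zL wL; have [_ h1 h2 h3 [h4 h5]] := HC j.
  by apply: le_trans (h3 _ _ zL wL) _; apply: ler_wpM2r; [exact: modulus_ge0|exact: CB].
Qed.

End uniform_C11.

Section cell.
Context d (Omega : measurableType d) (R : realType) (P : probability Omega R).
Variable J : finType.

Definition zero_in_cell (a : J -> R[i] -> R[i]) (X : J -> Omega -> R) (K z0 : R[i]) (r : R) :=
  [set w | exists2 z, in_cell z0 r z & real_comb a (X^~ w) z = K].

(** The local form of the theorem: a cell of side r at z0 contains a zero with
    probability r^2 times the density, up to O(r^3), and a double zero with
    probability O(r^4). The constants are uniform as long as the cell stays in a
    fixed box and the determinant at z0 is bounded below, which is what allows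
    summation over the cells of a grid. Measurability of the event is a hypothesis
    here because it needs other arguments. *)
Lemma cell_probability (X : J -> Omega -> R) (a a' : J -> R[i] -> R[i]) (K : R[i])
    (L delta : R) : gauss_family P X -> (forall j z, cdiff (a j) z (a' j z)) -> 0 < delta ->
  exists C r0, [/\ 0 <= C, 0 < r0 & forall z0 r, 0 < r <= r0 ->
    (forall z, in_closed_cell z0 r z -> in_box L z) -> delta <= kr_det (a^~ z0) ->
    [/\ measurable (zero_in_cell a X K z0 r) ->
         (P (zero_in_cell a X K z0 r) <=
          (r ^+ 2 * kr_density K (a^~ z0) (a'^~ z0) + C * r ^+ 3)%:E)%E,
       measurable (zero_in_cell a X K z0 r) ->
         ((r ^+ 2 * kr_density K (a^~ z0) (a'^~ z0))%:E <=
          P (zero_in_cell a X K z0 r) + (C * r ^+ 3)%:E)%E &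
       exists E, [/\ measurable E,
         (forall w, (exists z, [/\ in_cell z0 r z, real_comb a (X^~ w) z = K &
            real_comb a' (X^~ w) z = 0]) -> E w) & (P E <= (C * r ^+ 4)%:E)%E]]].
Proof.
move=> gX da delta0.
have [B [B0 aB aB0 _]] := entire_family_C11 L da.
have [Lam [Lam0 XLam]] := gauss_family_moment P J.
pose b0 := 1 + #|J|%:R + B + `|complex.Re K| + `|complex.Im K| + delta^-1.
have d0 : 0 <= delta^-1 by rewrite invr_ge0 ltW.
have J0 : 0 <= #|J|%:R :> R by [].
have [Kr Ki] := (normr_ge0 (complex.Re K), normr_ge0 (complex.Im K)).
have b01 : 1 <= b0 by rewrite /b0; lra.
have b00 : 0 <= b0 by lra.
have bX n k : (n <= k)%N -> b0 ^+ n <= b0 ^+ k by move=> nk; exact: ler_weXn2l.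
(* The squares of p^-1, t^-1, q are bounded by b0^4, hence these numbers by b0^2;
   the factor 100 meets the requirement b >= 100. *)
pose b := 100 * b0 ^+ 2.
have h1 := bX 0%N 2%N isT; have h2 := bX 1%N 2%N isT; rewrite expr0 expr1 in h1 h2.
have b0b : b0 <= b by rewrite /b; lra.
have bb : b0 ^+ 2 <= b by rewrite /b; lra.
have b100 : 100 <= b by rewrite /b; lra.
have bge0 : 0 <= b by lra.
have sqb (s : R) : s ^+ 2 <= b0 ^+ 4 -> `|s| <= b.
  move=> sb; apply: le_trans bb; rewrite -ler_sqr ?nnegrE ?sqr_ge0//.
  by rewrite real_normK ?num_real// -exprM.
have sumb (F : J -> R[i]) : (forall j, modulus (F j) <= B) ->
    \sum_j complex.Re (F j) ^+ 2 <= b0 ^+ 3 /\ \sum_j complex.Im (F j) ^+ 2 <= b0 ^+ 3.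
  move=> FB; have one (s : R) : `|s| <= B -> s ^+ 2 <= b0 ^+ 2.
    move=> sB; rewrite -(real_normK (num_real s)) ler_sqr ?nnegrE//.
    by apply: le_trans sB _; rewrite /b0; lra.
  have fin (f : J -> R) : (forall j, `|f j| <= B) -> \sum_j f j ^+ 2 <= b0 ^+ 3.
    move=> fB; apply: (@le_trans _ _ (\sum_(j : J) b0 ^+ 2)).
      by apply: ler_sum => j _; exact: one.
    by rewrite sumr_const -mulr_natl exprS ler_wpM2r ?sqr_ge0// /b0; lra.
  split; apply: fin => j; apply: le_trans (FB j); [exact: modulus_Re|exact: modulus_Im].
have b3 : b0 ^+ 3 <= b ^+ 2.
  apply: (@le_trans _ _ ((b0 ^+ 2) ^+ 2)); first by rewrite -exprM; exact: bX.
  by rewrite ler_sqr ?nnegrE ?sqr_ge0.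
have bp : 0 < 2 * b ^+ 7 by rewrite mulr_gt0// exprn_gt0//; lra.
exists (b ^+ 75 * Lam), (2 * b ^+ 7)^-1; split.
- by rewrite mulr_ge0// exprn_ge0.
- by rewrite invr_gt0.
move=> z0 r /andP[r0 rr] cellL detz.
have z0L : in_box L z0 by apply: cellL; split; rewrite lexx lerDl ltW.
have [aR aI] := sumb (a^~ z0) (fun j => aB0 j z0 z0L).
have [a'R a'I] := sumb (a'^~ z0) (fun j => C11_deriv_le aB j z0L).
have det0 : 0 < kr_det (a^~ z0) by apply: lt_le_trans delta0 detz.
have [x [y [w1 [w2 [rho [p [q [t [c0 [c1 [e0 [e1 rg]]]]]]]]]]]] :=
  regression_exists (fun j => complex.Re (a' j z0)) (fun j => complex.Im (a' j z0)) gX det0.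
have detE : kr_det (a^~ z0) = p ^+ 2 * t ^+ 2.
  by rewrite /kr_det (reg_aa rg) (reg_ab rg) (reg_bb rg); ring.
have p2 : p ^+ 2 <= b0 ^+ 3 by rewrite -(reg_aa rg).
have [q2 t2] : q ^+ 2 <= b0 ^+ 3 /\ t ^+ 2 <= b0 ^+ 3.
  by move: aI; rewrite (reg_bb rg); have := sqr_ge0 q; have := sqr_ge0 t; lra.
have p0 : p != 0 by apply/eqP => h; move: det0; rewrite detE h expr0n mul0r ltxx.
have t0 : t != 0 by apply/eqP => h; move: det0; rewrite detE h expr0n mulr0 ltxx.
have inv (s s' : R) : s != 0 -> s' != 0 -> s ^+ 2 * s' ^+ 2 = kr_det (a^~ z0) ->
    s' ^+ 2 <= b0 ^+ 3 -> `|s^-1| <= b.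
  move=> s0 s'0 E s'b; apply: sqb.
  have -> : s^-1 ^+ 2 = (kr_det (a^~ z0))^-1 * s' ^+ 2 by rewrite -E; field; rewrite s0 s'0.
  rewrite exprS; apply: ler_pM => //; rewrite ?sqr_ge0 ?invr_ge0 ?(ltW det0)//.
  apply: (@le_trans _ _ delta^-1); first by rewrite lef_pV2 ?posrE.
  by rewrite /b0; lra.
have pb : `|p^-1| <= b by apply: (inv p t).
have tb : `|t^-1| <= b by apply: (inv t p) => //; rewrite mulrC.
have qb : `|q| <= b by apply: sqb; apply: le_trans q2 _; exact: bX.
have K1b : `|complex.Re K| <= b by apply: le_trans b0b; rewrite /b0; lra.
have K2b : `|complex.Im K| <= b by apply: le_trans b0b; rewrite /b0; lra.
have Jb : #|J|%:R <= b by apply: le_trans b0b; rewrite /b0; lra.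
have Bb : B <= b by apply: le_trans b0b; rewrite /b0; lra.
have ab : C11_on a a' L b.
  split=> [j z zL|j z w zL wL|j z w z1 zL wL z1L].
  - exact: le_trans (C11_deriv_le aB j zL) Bb.
  - by apply: le_trans (C11_deriv_lip aB j zL wL) _; rewrite ler_wpM2r// modulus_ge0.
  - apply: le_trans (C11_taylor aB j zL wL z1L) _.
    apply: ler_wpM2r; first exact: modulus_ge0.
    by apply: ler_wpM2r; [rewrite addr_ge0 ?modulus_ge0|exact: Bb].
have rb : r * (2 * b ^+ 7) <= 1 by rewrite -ler_pdivlMr// div1r.
have a'1 := le_trans a'R b3; have a'2 := le_trans a'I b3.
have mX := gX.1; have XL := XLam X gX.
split.
- exact: (frame_cell_upper ab XL mX b100 p0 t0 qb pb tb K1b K2b Jb a'1 a'2 r0 rb cellL rg).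
- exact: (frame_cell_lower ab XL mX b100 p0 t0 qb pb tb K1b K2b Jb a'1 a'2 r0 rb cellL rg).
- exact: (frame_cell_double ab XL mX b100 p0 t0 qb pb tb K1b K2b Jb r0 rb cellL rg).
Qed.

End cell.

(** * Measurability of the existence of a zero *)
Section measurable_zero.
Context d (Omega : measurableType d) (R : realType).
Variable J : finType.
Local Notation Rm := (measurableTypeR R).
Variables (X : J -> Omega -> R) (a a' : J -> R[i] -> R[i]) (K : R[i]).
Hypothesis mX : forall j, measurable_fun setT (X j : Omega -> Rm).
Hypothesis da : forall j z, cdiff (a j) z (a' j z).

Let S w z := real_comb a (X^~ w) z.

Lemma measurable_real_comb_lt z (e : R) : measurable [set w | modulus (S w z - K) < e].
Proof.
have lin (s : J -> R) k : measurable_fun setT (fun w => \sum_j s j * X j w - k : Rm).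
  apply: measurable_funB; last exact: measurable_cst.
  apply: measurable_sum => j; apply: measurable_funM; [exact: measurable_cst|exact: mX].
have E w : S w z - K = (\sum_j complex.Re (a j z) * X j w - complex.Re K) +i*
    (\sum_j complex.Im (a j z) * X j w - complex.Im K).
  by rewrite -Re_real_comb -Im_real_comb /S; case: (real_comb _ _ _) K => ? ? [].
have mm : measurable_fun setT (fun w => modulus (S w z - K) : Rm).
  by under eq_fun do rewrite E; apply: measurable_modulus; exact: lin.
have -> : [set w | modulus (S w z - K) < e] = (fun w => modulus (S w z - K) : Rm) @^-1` `]-oo, e[.
  by apply/seteqP; split=> w /=; rewrite in_itv.
exact: measurable_preim.
Qed.

Lemma real_comb_lipschitz w L : exists k, 0 <= k /\ forall z z', in_box L z -> in_box L z' ->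
  modulus (S w z - S w z') <= k * modulus (z - z').
Proof.
have [B [B0 _ _ lipB]] := entire_family_C11 L da.
exists (B * \sum_j `|X j w|); split; first by rewrite mulr_ge0// sumr_ge0.
move=> z z' zL z'L; rewrite /S /real_comb -sumrB.
rewrite (eq_bigr (fun j => (a j z - a j z') * (X j w)%:C)); last by move=> j _; ring.
by rewrite mulrAC; apply: real_comb_le => j; exact: lipB.
Qed.

(** Keeps the points with rational parameters inside the square. *)
Definition clamp (q : R) : R := Num.max (-1) (Num.min 1 q).

Lemma clamp_itv q : -1 <= clamp q <= 1.
Proof.
by rewrite /clamp; case: (leP 1 q) => h;
  [case: (leP (-1) 1) => h'|case: (leP (-1) q) => h']; apply/andP; split; lra.
Qed.

Lemma clamp_dist q s : -1 <= s <= 1 -> `|clamp q - s| <= `|q - s|.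
Proof.
move=> /andP[s0 s1]; rewrite /clamp; case: (leP 1 q) => h.
  case: (leP (-1) 1) => h'; last by lra.
  by rewrite !ger0_norm; lra.
case: (leP (-1) q) => h' //.
by rewrite !ler0_norm; lra.
Qed.

Definition square_point (z0 : R[i]) (l : R) (q1 q2 : rat) : R[i] :=
  (complex.Re z0 + l * clamp (ratr q1)) +i* (complex.Im z0 + l * clamp (ratr q2)).

Lemma square_point_in z0 l q1 q2 : 0 <= l -> in_square z0 l (square_point z0 l q1 q2).
Proof.
move=> l0; have c1 q : `|clamp q| <= 1 by rewrite ler_norml clamp_itv.
by split; rewrite /= addrAC subrr add0r normrM ger0_norm// ler_piMr.
Qed.

Lemma square_point_dense z0 l z e : 0 <= l -> 0 < e -> in_square z0 l z ->
  exists q1 q2, modulus (square_point z0 l q1 q2 - z) < e.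
Proof.
move=> l0 e0 [h1 h2].
have den x0 x : `|x - x0| <= l -> exists q : rat, `|x0 + l * clamp (ratr q) - x| < e / 2.
  move=> xl; have [l1|l1] := eqVneq l 0.
    exists 0; rewrite l1 mul0r addr0 distrC; apply: le_lt_trans xl _.
    by rewrite l1 divr_gt0.
  have lp : 0 < l by rewrite lt_neqAle eq_sym l1.
  pose s := (x - x0) / l.
  have s1 : -1 <= s <= 1.
    by rewrite -ler_norml /s normrM normfV (ger0_norm l0) ler_pdivrMr// mul1r.
  have se : s < s + e / (2 * l) by rewrite ltrDl divr_gt0// mulr_gt0.
  have [q] := rat_in_itvoo se.
  rewrite in_itv /= => /andP[q1 q2]; exists q.
  have -> : x0 + l * clamp (ratr q) - x = l * (clamp (ratr q) - s).
    by rewrite /s; field; rewrite gt_eqF.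
  rewrite normrM ger0_norm//; apply: le_lt_trans (ler_wpM2l l0 (clamp_dist _ s1)) _.
  rewrite ger0_norm; last by rewrite subr_ge0 ltW.
  have -> : e / 2 = l * (e / (2 * l)) by field; rewrite gt_eqF.
  by rewrite ltr_pM2l// ltrBlDl.
have [q1 H1] := den _ _ h1; have [q2 H2] := den _ _ h2; exists q1, q2.
apply: le_lt_trans (le_modulus_ReIm _) _.
by move: H1 H2; rewrite /square_point; case: z {h1 h2} => x y /=; lra.
Qed.

(** By compactness a continuous function that takes arbitrarily small absolute
    values on a closed square vanishes there; by density rational points suffice,
    which makes the condition a countable one. *)
Lemma zero_in_squareE w z0 l : 0 <= l ->
  (exists2 z, in_square z0 l z & S w z = K) <->
  (forall k : nat, exists q1 q2, modulus (S w (square_point z0 l q1 q2) - K) < k.+1%:R^-1).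
Proof.
move=> l0; pose L := `|complex.Re z0| + `|complex.Im z0| + l.
have sqL z : in_square z0 l z -> in_box L z.
  move=> [h1 h2]; split.
    rewrite -(subrK (complex.Re z0) (complex.Re z)) addrC; apply: le_trans (ler_normD _ _) _.
    by have := normr_ge0 (complex.Im z0); rewrite /L; lra.
  rewrite -(subrK (complex.Im z0) (complex.Im z)) addrC; apply: le_trans (ler_normD _ _) _.
  by have := normr_ge0 (complex.Re z0); rewrite /L; lra.
have [k [k0 lip]] := real_comb_lipschitz w L; split=> [[z zs Sz] n|H].
  have e0 : 0 < n.+1%:R^-1 / (k + 1) by rewrite divr_gt0 ?invr_gt0//; lra.
  have [q1 [q2 h]] := square_point_dense l0 e0 zs; exists q1, q2.
  rewrite -Sz; have kp : 0 < k + 1 by lra.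
  apply: le_lt_trans (lip _ _ (sqL _ (square_point_in z0 q1 q2 l0)) (sqL _ zs)) _.
  rewrite ltr_pdivlMr// in h; apply: le_lt_trans h.
  by rewrite mulrC; apply: ler_wpM2l; [exact: modulus_ge0|rewrite lerDl].
have [|z zs zmin] := @square_min_exists R (fun z => modulus (S w z - K)) z0 l k l0 k0.
  move=> z z' zs z's; apply: le_trans (lip _ _ (sqL _ zs) (sqL _ z's)).
  rewrite ler_norml; apply/andP; split.
    have := modulusD_swap (S w z' - K) (S w z - K); rewrite (modulus_distrC (S w z' - K) (S w z - K)).
    by rewrite (_ : S w z - K - (S w z' - K) = S w z - S w z'); [lra|ring].
  have := modulusD_swap (S w z - K) (S w z' - K).
  by rewrite (_ : S w z - K - (S w z' - K) = S w z - S w z'); [lra|ring].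
exists z => //; apply/eqP; rewrite -subr_eq0; apply/eqP/modulus_eq0.
apply: le_anti; rewrite modulus_ge0 andbT; apply/ler_addgt0Pr => e e0; rewrite add0r.
have [n hn] := ltr_add_invr e0; rewrite add0r in hn.
have [q1 [q2 h]] := H n.
apply: le_trans (zmin _ (square_point_in z0 q1 q2 l0)) _; exact: ltW (lt_trans h hn).
Qed.

Lemma measurable_zero_in_square z0 l : 0 <= l ->
  measurable [set w | exists2 z, in_square z0 l z & S w z = K].
Proof.
move=> l0.
have -> : [set w | exists2 z, in_square z0 l z & S w z = K] =
  \bigcap_k \bigcup_q1 \bigcup_q2
    [set w | modulus (S w (square_point z0 l q1 q2) - K) < k.+1%:R^-1].
  apply/seteqP; split=> w.
    move=> /(zero_in_squareE _ _ l0) H k _; have [q1 [q2 h]] := H k.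
    by exists q1 => //; exists q2.
  move=> H; apply/(zero_in_squareE _ _ l0) => k.
  by have [q1 _ [q2 _ h]] := H k I; exists q1, q2.
apply: bigcapT_measurable => k; apply: bigcupT_measurable_rat => q1.
by apply: bigcupT_measurable_rat => q2; exact: measurable_real_comb_lt.
Qed.

(** A half-open cell is a countable union of closed squares. *)
Lemma measurable_zero_in_cell z0 r : measurable (zero_in_cell a X K z0 r).
Proof.
pose l (n : nat) := (r - n.+1%:R^-1) / 2.
pose c n : R[i] := (complex.Re z0 + l n) +i* (complex.Im z0 + l n).
have -> : zero_in_cell a X K z0 r =
  \bigcup_n (if 0 <= l n then [set w | exists2 z, in_square (c n) (l n) z & S w z = K] else set0).
  apply/seteqP; split=> w.
    move=> [z [/andP[h1 h2] /andP[h3 h4]] Sz].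
    have [n1 H1] := ltr_add_invr h2; have [n2 H2] := ltr_add_invr h4.
    pose n := maxn n1 n2.
    have nn1 : n.+1%:R^-1 <= n1.+1%:R^-1 :> R.
      by rewrite lef_pV2 ?posrE ?ltr0n// ler_nat ltnS leq_maxl.
    have nn2 : n.+1%:R^-1 <= n2.+1%:R^-1 :> R.
      by rewrite lef_pV2 ?posrE ?ltr0n// ler_nat ltnS leq_maxr.
    have u0 : 0 <= n.+1%:R^-1 :> R by rewrite invr_ge0.
    exists n => //; rewrite /= /c /l; move: n.+1%:R^-1 n1.+1%:R^-1 n2.+1%:R^-1 nn1 nn2 H1 H2 u0.
    move=> u u1 u2 nn1 nn2 H1 H2 u0; have -> : 0 <= (r - u) / 2 by lra.
    by exists z => //; split; rewrite ler_norml /=; apply/andP; split; lra.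
  move=> [n _]; case: ifPn => //= l0 [z [h1 h2] Sz]; exists z => //.
  have n0 : 0 < n.+1%:R^-1 :> R by rewrite invr_gt0.
  move: h1 h2; rewrite !ler_norml /c /l /=; move: n.+1%:R^-1 n0 => u u0 /andP[? ?] /andP[? ?].
  by split; apply/andP; split; lra.
apply: bigcupT_measurable => n; case: ifPn => // l0; exact: measurable_zero_in_square.
Qed.

End measurable_zero.

(** * Counting points with a grid *)
(** Nothing is assumed on u but an upper bound, as occupied cells need not grow. *)
Lemma cvge_from_below (R : realType) (u : (\bar R)^nat) (l : \bar R) :
  (forall n, (u n <= l)%E) ->
  (forall x, (x < l)%E -> \forall n \near \oo, (x <= u n)%E) -> u @ \oo --> l.
Proof.
move=> ul H.
have e1 n : (einfs u n <= u n)%E by apply: ereal_inf_lbound; exists n => /=.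
have el : einfs u @ \oo --> l.
  have -> : l = ereal_sup (range (einfs u)).
    apply/eqP; rewrite eq_le; apply/andP; split; last first.
      by apply: ge_ereal_sup => _ [n _ <-]; exact: le_trans (e1 n) (ul n).
    rewrite leNgt; apply/negP => sl.
    have [x sx xl] : exists2 x, (ereal_sup (range (einfs u)) < x)%E & (x < l)%E.
      move: (ereal_sup _) l sl {ul H e1} => [a| |] [b| |]//= ab.
      - by exists ((a + b) / 2)%:E; rewrite lte_fin; rewrite lte_fin in ab; lra.
      - by exists (a + 1)%:E; rewrite ?ltry// lte_fin ltrDl.
      - by exists (b - 1)%:E; rewrite ?ltNyr// lte_fin gtrBl.
      - by exists 0%E; rewrite ?ltNyr ?ltry.
    have [N _ HN] := H x xl.
    have : (x <= einfs u N)%E by apply: le_ereal_inf_tmp => _ [k /= Nk <-]; exact: HN.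
    apply/negP; rewrite -ltNge; apply: le_lt_trans sx.
    by apply: ereal_sup_ubound; exists N.
  exact: cvg_einfs_sup.
apply: (@squeeze_cvge _ _ _ _ (einfs u) _ (cst l)) => //; last exact: cvg_cst.
by apply: nearW => n; rewrite e1 ul.
Qed.

Lemma near_all_seq (T : eqType) (s : seq T) (Q : T -> nat -> Prop) :
  (forall x, x \in s -> \forall n \near \oo, Q x n) ->
  \forall n \near \oo, forall x, x \in s -> Q x n.
Proof.
elim: s => [|x s IH] H; first by apply: nearW.
have h1 := H x (mem_head _ _).
have h2 : \forall n \near \oo, forall y, y \in s -> Q y n.
  by apply: IH => y ys; apply: H; rewrite inE ys orbT.
near=> n => y; rewrite inE => /orP[/eqP ->|]; first by near: n.
by move: y; near: n.
Unshelve. all: by end_near. Qed.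

Lemma sum_ones (R : realType) (T : Type) (s : seq T) : \sum_(x <- s) (1 : R) = (size s)%:R.
Proof. by rewrite -sum1_size natr_sum. Qed.

Section grid.
Context {R : realType} (L : R).
Hypothesis L0 : 0 < L.

Definition mesh (n : nat) : R := 2 * L / n.+1%:R.
Local Notation cell n := ('I_n.+1 * 'I_n.+1)%type.
Definition corner n (c : cell n) : R[i] :=
  (- L + c.1%:R * mesh n) +i* (- L + c.2%:R * mesh n).

Lemma mesh_gt0 n : 0 < mesh n. Proof. by rewrite divr_gt0// mulr_gt0. Qed.

Lemma meshE n : n.+1%:R * mesh n = 2 * L.
Proof. by rewrite /mesh mulrC divfK// pnatr_eq0. Qed.

Lemma mesh_small e : 0 < e -> \forall n \near \oo, mesh n < e.
Proof.
move=> e0; have c : 0 < e / (2 * L) by rewrite divr_gt0// mulr_gt0.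
have [N hN] := ltr_add_invr c; rewrite add0r in hN.
exists N => // n /= Nn; rewrite /mesh.
have h : n.+1%:R^-1 < e / (2 * L).
  by apply: le_lt_trans hN; rewrite lef_pV2 ?posrE ?ltr0n// ler_nat.
have := h; rewrite ltr_pdivlMr ?mulr_gt0// mulrC; exact.
Qed.

Lemma cvg_mesh : mesh @ \oo --> (0 : R).
Proof.
apply/cvgrPdist_lt => e e0; have := mesh_small e0; apply: filterS => n h.
by rewrite sub0r normrN ger0_norm// ltW// mesh_gt0.
Qed.

Let grid_coord n x : - L <= x < L ->
  exists i : 'I_n.+1, - L + i%:R * mesh n <= x < - L + i%:R * mesh n + mesh n.
Proof.
move=> /andP[x1 x2]; have m0 := mesh_gt0 n.
pose y := (x + L) / mesh n.
have y0 : 0 <= y by rewrite divr_ge0 ?(ltW m0)//; lra.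
have /andP[k1 k2] := Num.Theory.truncn_itv y0.
have yn : y < n.+1%:R by rewrite /y ltr_pdivrMr// meshE; lra.
have kn : (Num.truncn y < n.+1)%N by rewrite -(ltr_nat R); exact: le_lt_trans k1 yn.
exists (Ordinal kn) => /=; rewrite /y in k1 k2 *.
rewrite ler_pdivlMr// in k1; rewrite ltr_pdivrMr// -natr1 in k2.
by apply/andP; split; lra.
Qed.

Let grid_coord_le n (i j : nat) x : - L + i%:R * mesh n <= x ->
  x < - L + j%:R * mesh n + mesh n -> (i <= j)%N.
Proof.
move=> h1 h2; have m0 := mesh_gt0 n; rewrite -ltnS -(ltr_nat R) -(ltr_pM2r m0) -natr1.
lra.
Qed.

Lemma cell_exists n z : `|complex.Re z| < L -> `|complex.Im z| < L ->
  exists c : cell n, in_cell (corner c) (mesh n) z.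
Proof.
rewrite !ltr_norml => /andP[h1 h2] /andP[h3 h4].
have [|i hi] := @grid_coord n (complex.Re z); first by rewrite (ltW h1).
have [|j hj] := @grid_coord n (complex.Im z); first by rewrite (ltW h3).
by exists (i, j).
Qed.

Lemma cell_unique n (c c' : cell n) z : in_cell (corner c) (mesh n) z ->
  in_cell (corner c') (mesh n) z -> c = c'.
Proof.
case: c c' => [i j] [i' j'] [/andP[/= a1 a2] /andP[b1 b2]] [/andP[/= c1 c2] /andP[d1 d2]].
congr (_, _); apply/val_inj/anti_leq => /=.
  by rewrite (grid_coord_le a1 c2) (grid_coord_le c1 a2).
by rewrite (grid_coord_le b1 d2) (grid_coord_le d1 b2).
Qed.

Lemma grid_closed_cell_box n (c : cell n) z : in_closed_cell (corner c) (mesh n) z -> in_box L z.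
Proof.
case: c => i j [/andP[/= a1 a2] /andP[b1 b2]].
have up (k : 'I_n.+1) : 0 <= k%:R * mesh n /\ k%:R * mesh n + mesh n <= 2 * L.
  split; first by rewrite mulr_ge0// ltW// mesh_gt0.
  rewrite -(meshE n) -[X in _ + X]mul1r -mulrDl natr1; apply: ler_wpM2r.
    by rewrite ltW// mesh_gt0.
  by rewrite ler_nat.
have [i1 i2] := up i; have [j1 j2] := up j.
by split; rewrite ler_norml; apply/andP; split; lra.
Qed.

Lemma corner_in_cell n (c : cell n) : in_cell (corner c) (mesh n) (corner c).
Proof. by have m0 := mesh_gt0 n; split; rewrite lexx ltrDl. Qed.

Section counting.
Variable G : set R[i].
Hypothesis GL : forall z, G z -> `|complex.Re z| < L /\ `|complex.Im z| < L.
Hypothesis Gopen : forall z, G z -> exists2 e, 0 < e & forall z', modulus (z' - z) < e -> G z'.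

(** Only the cells inside G are counted; each point of G lies in such a cell
    once the mesh is small. *)
Definition inner n (c : cell n) : Prop := forall z, in_cell (corner c) (mesh n) z -> G z.

Lemma near_inner z : G z -> \forall n \near \oo, forall c : cell n,
  in_cell (corner c) (mesh n) z -> inner c.
Proof.
move=> Gz; have [e e0 He] := Gopen Gz.
have e4 : 0 < e / 4 by rewrite divr_gt0.
have := mesh_small e4; apply: filterS => n hn c cz z' cz'; apply: He.
have h1 := modulus_closed_cell (in_cell_closed cz).
have h2 := modulus_closed_cell (in_cell_closed cz').
rewrite (_ : z' - z = (z' - corner c) - (z - corner c)); last by ring.
apply: le_lt_trans (le_modulusB _ _) _; lra.
Qed.

Definition occupied n (Z : set R[i]) : {set cell n} :=
  finset (fun c : cell n => `[< inner c /\ exists2 z, Z z & in_cell (corner c) (mesh n) z >]).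

Lemma in_occupied n Z (c : cell n) : (c \in occupied n Z) =
  `[< inner c /\ exists2 z, Z z & in_cell (corner c) (mesh n) z >].
Proof. by rewrite /occupied finset.in_set. Qed.

(** Disjoint cells contain distinct points. *)
Lemma occupied_le_esum n Z : ((#|occupied n Z|%:R)%:E <= \esum_(z in Z) (1 : \bar R))%E.
Proof.
have /choice[f Hf] (c : cell n) : exists z, c \in occupied n Z -> Z z /\ in_cell (corner c) (mesh n) z.
  rewrite in_occupied; case: asboolP => [[_ [z Zz cz]]|_]; first by exists z.
  by exists 0.
pose r := [seq f c | c <- enum (occupied n Z)].
have ur : uniq r.
  rewrite map_inj_in_uniq ?enum_uniq// => c c'; rewrite !mem_enum => /Hf[_ h] /Hf[_ h'] E.
  by apply: cell_unique h _; rewrite E.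
apply: esum_ge; exists [set` r].
  split; first exact: finite_seq.
  by move=> z /= /mapP[c]; rewrite mem_enum => /Hf[Zf _] ->.
rewrite -fsbig_seq//.
by rewrite sumEFin sum_ones size_map -cardE lexx.
Qed.

(** Finitely many points of G lie in distinct inner cells once the mesh is small. *)
Lemma near_occupied_ge (r : seq R[i]) (Z : set R[i]) : uniq r ->
  (forall z, z \in r -> Z z) -> Z `<=` G ->
  \forall n \near \oo, (size r <= #|occupied n Z|)%N.
Proof.
move=> ur rZ ZG.
have H1 : \forall n \near \oo, forall z, z \in r -> forall c : cell n,
    in_cell (corner c) (mesh n) z -> inner c.
  by apply: near_all_seq => z zr; apply: near_inner; exact/ZG/rZ.
have H2 : \forall n \near \oo, forall z, z \in r -> forall z', z' \in r ->
    forall c : cell n, in_cell (corner c) (mesh n) z -> in_cell (corner c) (mesh n) z' -> z = z'.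
  apply: near_all_seq => z zr; apply: near_all_seq => z' zr'.
  have [->|zz'] := eqVneq z z'; first by apply: nearW.
  have e4 : 0 < modulus (z - z') / 4 by rewrite divr_gt0// modulus_gt0// subr_eq0.
  have := mesh_small e4; apply: filterS => n hn c cz cz'.
  have h1 := modulus_closed_cell (in_cell_closed cz).
  have h2 := modulus_closed_cell (in_cell_closed cz').
  have : modulus (z - z') <= 4 * mesh n.
    rewrite (_ : z - z' = (z - corner c) - (z' - corner c)); last by ring.
    by apply: le_trans (le_modulusB _ _) _; lra.
  by move=> h; exfalso; lra.
near=> n.
have h1 : forall z, z \in r -> forall c : cell n,
    in_cell (corner c) (mesh n) z -> inner c by near: n.
have h2 : forall z, z \in r -> forall z', z' \in r -> forall c : cell n,
  in_cell (corner c) (mesh n) z -> in_cell (corner c) (mesh n) z' -> z = z' by near: n.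
have /choice[loc Hloc] z : exists c : cell n, z \in r -> in_cell (corner c) (mesh n) z.
  have [zr|_] := boolP (z \in r); last by exists (ord0, ord0).
  have [g1 g2] := GL (ZG _ (rZ _ zr)).
  by have [c cz] := cell_exists n g1 g2; exists c.
have ul : uniq [seq loc z | z <- r].
  rewrite map_inj_in_uniq// => z z' zr z'r E.
  by apply: (h2 z zr z' z'r (loc z)); [exact: Hloc|rewrite E; exact: Hloc].
rewrite -(size_map loc) -(card_uniqP ul); apply: subset_leq_card.
apply/fintype.subsetP => c /mapP[z zr ->]; rewrite in_occupied; apply/asboolP; split.
  exact: h1 zr _ (Hloc _ zr).
by exists z; [exact: rZ|exact: Hloc].
Unshelve. all: by end_near. Qed.

Lemma cvg_occupied (Z : set R[i]) : Z `<=` G ->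
  (#|occupied n Z|%:R)%:E @[n --> \oo] --> (\esum_(z in Z) (1%E : \bar R))%E.
Proof.
move=> ZG; apply: cvge_from_below => [n|x]; first exact: occupied_le_esum.
move=> /ereal_sup_gt[_ [X [fX XZ] <-] xX].
have [r0 Xr] := (finite_seqP X).1 fX; pose r := undup r0.
have XE : X = [set` r] by rewrite Xr; apply/seteqP; split=> z /=; rewrite mem_undup.
rewrite XE -fsbig_seq ?undup_uniq// sumEFin sum_ones in xX.
have rZ z : z \in r -> Z z by move=> zr; apply: XZ; rewrite XE.
have := near_occupied_ge (undup_uniq r0) rZ ZG; apply: filterS => n hn.
by apply: le_trans (ltW xX) _; rewrite lee_fin ler_nat.
Qed.

End counting.
End grid.

(** * Continuity of the density *)
Section density_continuity.
Context {R : realType} (J : finType) (T : Type) (F : set_system T) {FF : Filter F}.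

Lemma cvg_sum (f : J -> T -> R) (l : J -> R) :
  (forall j, f j x @[x --> F] --> l j) -> \sum_j f j x @[x --> F] --> \sum_j l j.
Proof.
move=> H; elim: (index_enum J) => [|j s IH].
  by under eq_cvg do rewrite big_nil; rewrite big_nil; exact: cvg_cst.
by under eq_cvg do rewrite big_cons; rewrite big_cons; exact: cvgD.
Qed.

Lemma cvg_prod2 (f g : T -> R) (k l : R) : f x @[x --> F] --> k -> g x @[x --> F] --> l ->
  f x * g x @[x --> F] --> k * l.
Proof. exact: cvgM. Qed.

Lemma cvg_sqr (f : T -> R) (l : R) : f x @[x --> F] --> l -> f x ^+ 2 @[x --> F] --> l ^+ 2.
Proof. by move=> H; under eq_cvg do rewrite expr2; rewrite expr2; exact: cvg_prod2. Qed.

Variables (A A' : T -> J -> R[i]) (a a' : J -> R[i]) (K : R[i]).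
Hypothesis cR : forall j, complex.Re (A x j) @[x --> F] --> complex.Re (a j).
Hypothesis cI : forall j, complex.Im (A x j) @[x --> F] --> complex.Im (a j).
Hypothesis cR' : forall j, complex.Re (A' x j) @[x --> F] --> complex.Re (a' j).
Hypothesis cI' : forall j, complex.Im (A' x j) @[x --> F] --> complex.Im (a' j).

Lemma cvg_kr_det : kr_det (A x) @[x --> F] --> kr_det a.
Proof.
apply: cvgB.
  by apply: cvg_prod2; apply: cvg_sum => j; exact: cvg_sqr.
by apply: cvg_sqr; apply: cvg_sum => j; exact: cvg_prod2.
Qed.

Lemma cvg_kr_density : 0 < kr_det a -> kr_density K (A x) (A' x) @[x --> F] --> kr_density K a a'.
Proof.
move=> det0; rewrite /kr_density.
have cst (k : R) : k @[_ --> F] --> k by exact: cvg_cst.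
have s2 (f : J -> T -> R) (l : J -> R) : (forall j, f j x @[x --> F] --> l j) ->
  \sum_j f j x ^+ 2 @[x --> F] --> \sum_j l j ^+ 2 by move=> H; apply: cvg_sum => j; exact: cvg_sqr.
have sp (f g : J -> T -> R) (l m : J -> R) : (forall j, f j x @[x --> F] --> l j) ->
  (forall j, g j x @[x --> F] --> m j) ->
  \sum_j f j x * g j x @[x --> F] --> \sum_j l j * m j.
  by move=> H H'; apply: cvg_sum => j; exact: cvg_prod2.
have cA := s2 _ _ cR; have cB := s2 _ _ cI; have cC := sp _ _ _ _ cR cI.
have cAC := sp _ _ _ _ cR cR'; have cBC := sp _ _ _ _ cI cR'.
have cAE := sp _ _ _ _ cR cI'; have cBE := sp _ _ _ _ cI cI'.
have cCC := s2 _ _ cR'; have cEE := s2 _ _ cI'; have cD := cvg_kr_det.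
have inv (f : T -> R) (l : R) : l != 0 -> f x @[x --> F] --> l -> (f x)^-1 @[x --> F] --> l^-1.
  by move=> l0 H; exact: cvgV.
have Dn0 : kr_det a != 0 by rewrite gt_eqF.
have sD0 : 2 * pi * Num.sqrt (kr_det a) != 0.
  by rewrite mulf_neq0 ?mulf_neq0// ?gt_eqF ?pi_gt0 ?sqrtr_gt0.
have cu : complex.Re K * \sum_j complex.Im (A x j) ^+ 2 -
    complex.Im K * \sum_j complex.Re (A x j) * complex.Im (A x j) @[x --> F] -->
    complex.Re K * \sum_j complex.Im (a j) ^+ 2 -
    complex.Im K * \sum_j complex.Re (a j) * complex.Im (a j).
  exact: (cvgB (cvg_prod2 (cst (complex.Re K)) cB) (cvg_prod2 (cst (complex.Im K)) cC)).
have cv : complex.Im K * \sum_j complex.Re (A x j) ^+ 2 -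
    complex.Re K * \sum_j complex.Re (A x j) * complex.Im (A x j) @[x --> F] -->
    complex.Im K * \sum_j complex.Re (a j) ^+ 2 -
    complex.Re K * \sum_j complex.Re (a j) * complex.Im (a j).
  exact: (cvgB (cvg_prod2 (cst (complex.Im K)) cA) (cvg_prod2 (cst (complex.Re K)) cC)).
have quad (f g : T -> R) (l m : R) : f x @[x --> F] --> l -> g x @[x --> F] --> m ->
  f x ^+ 2 * (\sum_j complex.Im (A x j) ^+ 2) - 2 * f x * g x *
     (\sum_j complex.Re (A x j) * complex.Im (A x j)) + g x ^+ 2 * \sum_j complex.Re (A x j) ^+ 2
  @[x --> F] --> l ^+ 2 * (\sum_j complex.Im (a j) ^+ 2) - 2 * l * m *
     (\sum_j complex.Re (a j) * complex.Im (a j)) + m ^+ 2 * \sum_j complex.Re (a j) ^+ 2.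
  move=> cf cg; apply: cvgD; first apply: cvgB.
  - by apply: cvg_prod2 cB; exact: cvg_sqr.
  - by apply: cvg_prod2 cC; apply: cvg_prod2 cg; exact: cvg_prod2 (cst 2) cf.
  - by apply: cvg_prod2 cA; exact: cvg_sqr.
pose k1 := complex.Re K; pose k2 := complex.Im K.
apply: cvg_prod2; first apply: cvg_prod2.
- apply: (inv _ _ sD0); apply: (cvg_prod2 (cst (2 * pi))).
  by apply: cvg_comp cD _; exact: sqrt_continuous.
- apply: cvg_comp; last exact: continuous_expR.
  apply: cvgN; apply: cvg_prod2; last first.
    by apply: inv; [rewrite mulf_neq0|exact: (cvg_prod2 (cst 2) cD)].
  exact: (cvgB (cvgD (cvg_prod2 (cst (k1 ^+ 2)) cB) (cvg_prod2 (cst (k2 ^+ 2)) cA))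
    (cvg_prod2 (cst (2 * k1 * k2)) cC)).
- apply: cvgD; first apply: cvgB.
  + exact: (cvgD cCC cEE).
  + exact: (cvg_prod2 (cvgD (quad _ _ _ _ cAC cBC) (quad _ _ _ _ cAE cBE)) (inv _ _ Dn0 cD)).
  + have Dn2 : kr_det a ^+ 2 != 0 by rewrite expf_neq0.
    apply: (cvg_prod2 _ (inv _ _ Dn2 (cvg_sqr cD))).
    apply: cvgD.
      by apply: cvg_sqr; exact: (cvgD (cvg_prod2 cAC cu) (cvg_prod2 cBC cv)).
    by apply: cvg_sqr; exact: (cvgD (cvg_prod2 cAE cu) (cvg_prod2 cBE cv)).
Qed.

End density_continuity.

(** * Riemann sums of the density *)
Section riemann.
Context d (Omega : measurableType d) (R : realType) (P : probability Omega R).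
Variable J : finType.
Local Notation Rm := (measurableTypeR R).
Local Notation plane := (Rm * Rm)%type.
Local Notation mu2 := ((@lebesgue_measure R) \x (@lebesgue_measure R))%E.
Local Notation cell n := ('I_n.+1 * 'I_n.+1)%type.
Variables (X : J -> Omega -> R) (a a' : J -> R[i] -> R[i]) (K : R[i]).
Hypothesis gX : gauss_family P X.
Hypothesis da : forall j z, cdiff (a j) z (a' j z).

Let H z := kr_density K (a^~ z) (a'^~ z).
Let det z := kr_det (a^~ z).

(** Neither bound needs the formula of the density: r^2 H is within O(r^3) of a
    probability, which lies between 0 and 1. Small r shows that H is nonnegative,
    and one fixed r bounds it. *)
Lemma kr_density_bounds (L delta : R) : 0 < delta ->
  exists M, forall z, in_box L z -> delta <= det z -> 0 <= H z <= M.
Proof.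
move=> delta0.
have [C [r0 [C0 r00 HC]]] := cell_probability K (L + 1 + 1) gX da delta0.
pose r1 := Num.min r0 (1 / 2).
have r1p : 0 < r1 by rewrite lt_min r00 divr_gt0.
have [r1r0 r1h] : r1 <= r0 /\ r1 <= 1 / 2 by rewrite /r1 !ge_min !lexx orbT.
exists ((1 + C * r1 ^+ 3) / r1 ^+ 2) => z zL dz.
have cl r z' : 0 < r <= r1 -> in_closed_cell z r z' -> in_box (L + 1 + 1) z'.
  move=> /andP[rp rr] zc; rewrite (_ : z' = z + (z' - z)); last by ring.
  have L1 : in_box (L + 1) z by case: zL => h1 h2; split; [move: h1|move: h2]; lra.
  apply: in_boxD => //; apply: le_trans (modulus_closed_cell zc) _; lra.
have mZ r := measurable_zero_in_cell K gX.1 da z r.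
have key r : 0 < r <= r1 -> 0 <= r ^+ 2 * H z + C * r ^+ 3 /\ r ^+ 2 * H z <= 1 + C * r ^+ 3.
  move=> rr; have rr0 : 0 < r <= r0 by case/andP: rr => -> /= h; exact: le_trans h r1r0.
  have [up lo _] := HC z r rr0 (fun z' => @cl r z' rr) dz; split.
    by rewrite -lee_fin; apply: le_trans (up (mZ r)); exact: measure_ge0.
  rewrite -lee_fin; apply: le_trans (lo (mZ r)) _; rewrite EFinD.
  by apply: leeD => //; apply: probability_le1; exact: mZ.
apply/andP; split; last first.
  rewrite ler_pdivlMr ?exprn_gt0// mulrC; apply: (key r1 _).2.
  by rewrite r1p lexx.
rewrite leNgt; apply/negP => Hneg.
have C1 : 0 < C + 1 by lra.
pose r := Num.min r1 (- H z / (C + 1)).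
have rp : 0 < r by rewrite lt_min r1p divr_gt0//; lra.
have [rr1 rh] : r <= r1 /\ r <= - H z / (C + 1).
  by split; rewrite /r ge_min lexx ?orbT.
have [|h _] := key r; first by rewrite rp.
rewrite ler_pdivlMr// in rh.
have : r ^+ 2 * (H z + C * r) < 0.
  by rewrite pmulr_rlt0 ?exprn_gt0//; move: rh; rewrite mulrDr mulr1; lra.
by rewrite (_ : r ^+ 2 * _ = r ^+ 2 * H z + C * r ^+ 3); [lra|ring].
Qed.

Lemma Re_coef_cvg (b b' : R[i] -> R[i]) (z : R[i]) (u : nat -> R[i]) :
  (forall z, cdiff b z (b' z)) -> modulus (u n - z) @[n --> \oo] --> (0 : R) ->
  [/\ complex.Re (b (u n)) @[n --> \oo] --> complex.Re (b z),
      complex.Im (b (u n)) @[n --> \oo] --> complex.Im (b z),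
      complex.Re (b' (u n)) @[n --> \oo] --> complex.Re (b' z) &
      complex.Im (b' (u n)) @[n --> \oo] --> complex.Im (b' z)].
Proof.
move=> db uz; pose L := `|complex.Re z| + `|complex.Im z|.
have [C [C0 _ _ l1 [l2 _]]] := entire_C11 (L + 1) db.
have zL0 : in_box L z by split; rewrite /L ?lerDl ?lerDr.
have zL : in_box (L + 1) z.
  by rewrite -(addr0 z); apply: in_boxD => //; rewrite modulus0.
have uL : \forall n \near \oo, in_box (L + 1) (u n).
  near=> n; have hn : modulus (u n - z) < 1 by near: n; exact: (cvgr_lt _ uz).
  by rewrite (_ : u n = z + (u n - z)); [apply: in_boxD => //; exact: ltW|ring].
have gen (f : R[i] -> R) : (forall w w', in_box (L + 1) w -> in_box (L + 1) w' ->
    `|f w - f w'| <= C * modulus (w - w')) -> f (u n) @[n --> \oo] --> f z.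
  move=> Hf; apply/cvgrPdist_le => e e0.
  have c1 : 0 < C + 1 by lra.
  have e1 : 0 < e / (C + 1) by rewrite divr_gt0.
  near=> n; have un : in_box (L + 1) (u n) by near: n.
  have hm : modulus (u n - z) < e / (C + 1) by near: n; exact: (cvgr_lt _ uz).
  rewrite distrC; apply: le_trans (Hf _ _ un zL) _; rewrite ltr_pdivlMr// in hm.
  by have := modulus_ge0 (u n - z); lra.
have ReB (v w : R[i]) : complex.Re v - complex.Re w = complex.Re (v - w) by case: v w => ? ? [].
have ImB (v w : R[i]) : complex.Im v - complex.Im w = complex.Im (v - w) by case: v w => ? ? [].
split.
- apply: (gen (fun w => complex.Re (b w))) => w w' wL w'L; rewrite ReB.
  exact: le_trans (modulus_Re _) (l1 _ _ wL w'L).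
- apply: (gen (fun w => complex.Im (b w))) => w w' wL w'L; rewrite ImB.
  exact: le_trans (modulus_Im _) (l1 _ _ wL w'L).
- apply: (gen (fun w => complex.Re (b' w))) => w w' wL w'L; rewrite ReB.
  exact: le_trans (modulus_Re _) (l2 _ _ wL w'L).
- apply: (gen (fun w => complex.Im (b' w))) => w w' wL w'L; rewrite ImB.
  exact: le_trans (modulus_Im _) (l2 _ _ wL w'L).
Unshelve. all: by end_near. Qed.

Lemma kr_density_cvg_seq z (u : nat -> R[i]) : 0 < det z ->
  modulus (u n - z) @[n --> \oo] --> (0 : R) -> H (u n) @[n --> \oo] --> H z.
Proof.
by move=> dz uz; apply: cvg_kr_density => // j; have [] := Re_coef_cvg (da j) uz.
Qed.

Section domain.
Variables (L delta : R) (G : set R[i]).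
Hypotheses (L0 : 0 < L) (delta0 : 0 < delta).
Hypothesis GL : forall z, G z -> `|complex.Re z| < L /\ `|complex.Im z| < L.
Hypothesis Gopen : forall z, G z -> exists2 e, 0 < e & forall z', modulus (z' - z) < e -> G z'.
Hypothesis Gdet : forall z, G z -> delta <= det z.

Definition plane_set (B : set R[i]) : set plane := [set p | B (p.1 +i* p.2)].

Local Notation inn n c := (`[< inner L G (n := n) c >]).
Definition cell_set n (c : cell n) : set plane :=
  plane_set (in_cell (corner L c) (mesh L n)).

Lemma cell_setE n (c : cell n) : cell_set c =
  `[- L + c.1%:R * mesh L n, - L + c.1%:R * mesh L n + mesh L n[ `*`
  `[- L + c.2%:R * mesh L n, - L + c.2%:R * mesh L n + mesh L n[.
Proof. by apply/seteqP; split=> -[x y]; rewrite /cell_set /plane_set /in_cell /= !in_itv. Qed.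

Lemma measurable_cell_set n (c : cell n) : measurable (cell_set c).
Proof. by rewrite cell_setE; exact: measurableX. Qed.

Lemma cell_set_area n (c : cell n) : mu2 (cell_set c) = (mesh L n ^+ 2)%:E.
Proof.
have m0 := mesh_gt0 L0 n; rewrite cell_setE.
have E (x1 x2 y1 y2 : R) : mu2 (`[x1, x2[ `*` `[y1, y2[) =
  ((@lebesgue_measure R) `[x1, x2[ * (@lebesgue_measure R) `[y1, y2[)%E.
  exact: product_measure1E.
by rewrite E !lebesgue_measure_itv /= !lte_fin !ltrDl m0 -!EFinD !(addrC _ (mesh L n)) !addrK -EFinM expr2.
Qed.

Let Gp := plane_set G.

Lemma plane_set_bigcup : Gp = \bigcup_n \bigcup_(c in [set c : cell n | inner L G c]) cell_set c.
Proof.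
apply/seteqP; split=> [[x y] Gxy|[x y] [n _ [c ci cc]]]; last exact: ci.
have [N _ HN] := near_inner L0 Gopen Gxy.
have [g1 g2] := GL Gxy; have [c cz] := cell_exists L0 N g1 g2.
by exists N => //; exists c => //; exact: HN (leqnn _) c cz.
Qed.

Lemma measurable_plane_set : measurable Gp.
Proof.
rewrite plane_set_bigcup; apply: bigcupT_measurable => n.
apply: fin_bigcup_measurable => [|c _]; first exact: finite_finset.
exact: measurable_cell_set.
Qed.

Lemma plane_set_area : (mu2 Gp < +oo)%E.
Proof.
have mb : measurable (`[- L, L] `*` `[- L, L] : set plane) by exact: measurableX.
apply: (@le_lt_trans _ _ (mu2 (`[- L, L] `*` `[- L, L]))).
  have mG := measurable_plane_set.
  apply: le_measure; [by apply/mem_set|by apply/mem_set|].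
  move=> [x y] /GL /=; rewrite !in_itv /= !ltr_norml => -[/andP[? ?] /andP[? ?]].
  by split; apply/andP; split; lra.
have E (x y : R) : mu2 (`[x, y] `*` `[x, y]) =
  ((@lebesgue_measure R) `[x, y] * (@lebesgue_measure R) `[x, y])%E.
  exact: product_measure1E.
rewrite E lebesgue_measure_itv /= lte_fin.
have -> : - L < L by have := L0; lra.
by rewrite -EFinB -EFinM ltry.
Qed.

Definition step_density n (p : plane) : R :=
  \sum_(c : cell n | inn n c) H (corner L c) * \1_(cell_set c) p.

Lemma measurable_step_density n : measurable_fun setT (step_density n : plane -> Rm).
Proof.
rewrite /step_density; apply: measurable_sum_cond => c _.
apply: measurable_funM; first exact: measurable_cst.
by apply: measurable_indic; exact: measurable_cell_set.
Qed.

Let G_bounds : exists M, forall z, G z -> 0 <= H z <= M.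
Proof.
have [M HM] := kr_density_bounds L delta0; exists M => z Gz.
have [g1 g2] := GL Gz; apply: HM; last exact: Gdet.
by split; exact: ltW.
Qed.

Lemma inner_corner n (c : cell n) : inner L G c -> G (corner L c).
Proof. by apply; exact: corner_in_cell. Qed.

Lemma step_densityE n (c : cell n) p : inner L G c -> cell_set c p ->
  step_density n p = H (corner L c).
Proof.
move=> ci cp; rewrite /step_density (bigD1 c)/=; last exact/asboolP.
rewrite indicE mem_set// mulr1 big1 ?addr0// => c' /andP[_ cc'].
rewrite indicE memNset ?mulr0// => c'p; move/eqP: cc'; apply.
by apply: (cell_unique L0 c'p cp).
Qed.

Lemma step_density_bounds M n p : (forall z, G z -> 0 <= H z <= M) -> 0 <= M ->
  0 <= step_density n p <= M.
Proof.
move=> HM M0; have [[c [ci cp]]|nc] := pselect (exists c : cell n, inner L G c /\ cell_set c p).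
  by rewrite (step_densityE ci cp); apply: HM; exact: inner_corner.
rewrite /step_density big1 ?lexx// => c /asboolP ci.
by rewrite indicE memNset ?mulr0// => cp; apply: nc; exists c.
Qed.

(** The corner of the cell that contains p converges to p, and the density is
    continuous. *)
Lemma cvg_step_density p : Gp p -> step_density n p @[n --> \oo] --> H (p.1 +i* p.2).
Proof.
move=> Gp_; have [g1 g2] := GL Gp_.
pose c n : cell n := xget (ord0, ord0) [set c | in_cell (corner L c) (mesh L n) (p.1 +i* p.2)].
have Hc n : in_cell (corner L (c n)) (mesh L n) (p.1 +i* p.2).
  exact: (xgetPex _ (cell_exists L0 n g1 g2)).
have cz : modulus (corner L (c n) - (p.1 +i* p.2)) @[n --> \oo] --> (0 : R).
  apply: (@squeeze_cvgr _ _ _ _ (fun=> 0) (fun n => 2 * mesh L n)).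
  - apply: nearW => n; rewrite modulus_ge0 modulus_distrC /=.
    exact: modulus_closed_cell (in_cell_closed (Hc n)).
  - exact: cvg_cst.
  - rewrite -[X in _ --> X](mulr0 (2 : R)); apply: cvgMl_tmp; exact: cvg_mesh.
have := kr_density_cvg_seq (lt_le_trans delta0 (Gdet Gp_)) cz.
apply: cvg_trans; apply: near_eq_cvg.
have := near_inner L0 Gopen Gp_; apply: filterS => n Hn.
by rewrite (step_densityE (Hn _ (Hc n)) (Hc n : cell_set (c n) p)).
Qed.

Lemma measurable_density : measurable_fun Gp (fun p : plane => (H (p.1 +i* p.2))%:E : \bar R).
Proof.
apply: (emeasurable_fun_cvg (fun n p => (step_density n p)%:E)) => [n|p Gp_].
  by apply: measurable_funTS; apply/measurable_EFinP; exact: measurable_step_density.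
by apply: cvg_EFin; [apply: nearW|exact: cvg_step_density].
Qed.

Lemma integral_step_density n : (\int[mu2]_(p in Gp) (step_density n p)%:E =
  (\sum_(c : cell n | inn n c) mesh L n ^+ 2 * H (corner L c))%:E)%E.
Proof.
have mG := measurable_plane_set.
have H0 c : inn n c -> 0 <= H (corner L c).
  by move=> /asboolP ci; have [M HM] := G_bounds; have /andP[] := HM _ (inner_corner ci).
transitivity (\int[mu2]_(p in Gp) (\sum_(c : cell n)
    (if inn n c then H (corner L c) else 0)%:E * (\1_(cell_set c) p)%:E))%E.
  apply: eq_integral => p _; rewrite /step_density big_mkcond -sumEFin.
  by apply: eq_bigr => c _; case: ifP => _; rewrite ?mul0e -?EFinM.
have Hc0 c : 0 <= (if inn n c then H (corner L c) else 0) by case: ifP => // /H0.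
rewrite ge0_integral_sum//; last first.
- by move=> c p _; rewrite mule_ge0// lee_fin.
- move=> c; apply: emeasurable_funM; first exact: measurable_cst.
  apply: measurable_funTS; apply/measurable_EFinP.
  by apply: measurable_indic; exact: measurable_cell_set.
rewrite -sumEFin [RHS]big_mkcond; apply: eq_bigr => c _.
rewrite ge0_integralZl_EFin//; last first.
  apply: measurable_funTS; apply/measurable_EFinP.
  by apply: measurable_indic; exact: measurable_cell_set.
case: ifPn => [/asboolP ci|_]; last by rewrite mul0e.
rewrite integral_indic//; last exact: measurable_cell_set.
have -> : cell_set c `&` Gp = cell_set c.
  by apply/seteqP; split=> [p []//|p cp]; split=> //; exact: ci.
transitivity ((H (corner L c))%:E * (mesh L n ^+ 2)%:E)%E; last by rewrite -EFinM mulrC.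
by congr mule; exact: cell_set_area.
Qed.

Lemma cvg_riemann : (\sum_(c : cell n | inn n c) mesh L n ^+ 2 * H (corner L c))%:E
  @[n --> \oo] --> (\int[mu2]_(p in Gp) (H (p.1 +i* p.2))%:E)%E /\
  mu2.-integrable Gp (fun p => (H (p.1 +i* p.2))%:E).
Proof.
have mG := measurable_plane_set.
have [M HM] := G_bounds.
pose M' := Num.max M 0.
have M'0 : 0 <= M' by rewrite /M' le_max lexx orbT.
have HM' z : G z -> 0 <= H z <= M'.
  by move=> /HM /andP[-> h] /=; rewrite /M' le_max h.
have [] := @dominated_convergence _ plane R mu2 Gp mG (fun n p => (step_density n p)%:E)
  (fun p => (H (p.1 +i* p.2))%:E) (cst M'%:E).
- by move=> n; apply: measurable_funTS; apply/measurable_EFinP; exact: measurable_step_density.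
- exact: measurable_density.
- by apply: aeW => p Gp_; apply: cvg_EFin; [apply: nearW|exact: cvg_step_density].
- apply/integrableP; split; first exact: measurable_cst.
  rewrite (_ : (fun _ => _) = cst M'%:E); last first.
    by apply/funext => p /=; rewrite ger0_norm.
  rewrite integral_cst//; apply: lte_mul_pinfty => //; exact: plane_set_area.
- apply: aeW => p n _; have /andP[h1 h2] := step_density_bounds n p HM' M'0.
  by rewrite gee0_abs lee_fin.
move=> hi _ hc; split=> //; apply: cvg_trans hc; apply: near_eq_cvg; apply: nearW => n.
exact: (integral_step_density n).
Qed.

End domain.
End riemann.

(** * Expected number of zeros in an open set *)
Lemma measure_seq_union_le d (T : measurableType d) (R : realType)
    (m : {measure set T -> \bar R}) (I : Type) (s : seq I) (Q : pred I) (E : I -> set T) :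
  (forall i, measurable (E i)) ->
  measurable (\big[setU/set0]_(i <- s | Q i) E i) /\
  (m (\big[setU/set0]_(i <- s | Q i) E i) <= \sum_(i <- s | Q i) m (E i))%E.
Proof.
move=> mE; elim: s => [|i s [IH1 IH2]]; first by rewrite !big_nil measure0.
rewrite !big_cons; case: ifP => // _; split; first exact: measurableU.
by apply: le_trans (measureU2 _ _ _) _ => //; apply: leeD.
Qed.

Section open_domain.
Context d (Omega : measurableType d) (R : realType) (P : probability Omega R).
Variable J : finType.
Local Notation Rm := (measurableTypeR R).
Local Notation plane := (Rm * Rm)%type.
Local Notation mu2 := ((@lebesgue_measure R) \x (@lebesgue_measure R))%E.
Local Notation cell n := ('I_n.+1 * 'I_n.+1)%type.
Variables (X : J -> Omega -> R) (a a' : J -> R[i] -> R[i]) (K : R[i]).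
Hypothesis gX : gauss_family P X.
Hypothesis da : forall j z, cdiff (a j) z (a' j z).

Let S w z := real_comb a (X^~ w) z.
Let S' w z := real_comb a' (X^~ w) z.
Let H z := kr_density K (a^~ z) (a'^~ z).
Let det z := kr_det (a^~ z).

Definition zeros (G : set R[i]) w : set R[i] := [set z | G z /\ S w z = K].
(** Zeros are counted without multiplicity; almost surely they are all simple. *)
Definition nb_zeros (G : set R[i]) w : \bar R := (\esum_(z in zeros G w) (1%E : \bar R))%E.

Variables (L delta : R) (G : set R[i]).
Hypotheses (L0 : 0 < L) (delta0 : 0 < delta).
Hypothesis GL : forall z, G z -> `|complex.Re z| < L /\ `|complex.Im z| < L.
Hypothesis Gopen : forall z, G z -> exists2 e, 0 < e & forall z', modulus (z' - z) < e -> G z'.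
Hypothesis Gdet : forall z, G z -> delta <= det z.

Local Notation inn n c := (`[< inner L G (n := n) c >]).
Let Z n (c : cell n) := zero_in_cell a X K (corner L c) (mesh L n).

Let mZ n (c : cell n) : measurable (Z c).
Proof. exact: (measurable_zero_in_cell K gX.1 da). Qed.

Let count n w : \bar R := ((#|occupied L G n (zeros G w)|%:R)%:E)%E.

Let countE n w : count n w = (\sum_(c : cell n | inn n c) (\1_(Z c) w)%:E)%E.
Proof.
rewrite /count -sum1_card natr_sum -sumEFin [LHS]big_mkcond [RHS]big_mkcond /=.
apply: eq_bigr => c _; rewrite in_occupied.
have [ci|ci] := asboolP (inner L G c); last by rewrite asboolF// => -[].
rewrite indicE; case: asboolP => [[_ [z [_ Sz] cz]]|h].
  by rewrite mem_set//; exists z.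
by rewrite memNset// => -[z cz Sz]; apply: h; split=> //; exists z => //; split=> //; exact: ci.
Qed.

Let m1Z n (c : cell n) : measurable_fun setT (fun w => (\1_(Z c) w)%:E : \bar R).
Proof. by apply/measurable_EFinP; apply: measurable_indic; exact: mZ. Qed.

Let mcount n : measurable_fun setT (count n).
Proof.
rewrite (_ : count n = fun w => (\sum_(c : cell n | inn n c) (\1_(Z c) w)%:E)%E); last first.
  by apply/funext => w; exact: countE.
under eq_fun do rewrite big_mkcond.
apply: emeasurable_sum => c; case: (inn n c); [exact: m1Z|exact: measurable_cst].
Qed.

Let cvg_count w : count n w @[n --> \oo] --> nb_zeros G w.
Proof. by apply: (cvg_occupied L0 GL Gopen) => z []. Qed.

Lemma measurable_nb_zeros : measurable_fun setT (nb_zeros G).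
Proof. by apply: (emeasurable_fun_cvg count) => [n|w _]; [exact: mcount|exact: cvg_count]. Qed.

Lemma nb_zeros_ge0 B w : (0 <= nb_zeros B w)%E.
Proof. exact: esum_ge0. Qed.

Let Ecount n : (\int[P]_w count n w = \sum_(c : cell n | inn n c) P (Z c))%E.
Proof.
transitivity (\int[P]_w (\sum_(c : cell n) if inn n c then (\1_(Z c) w)%:E else 0))%E.
  by apply: eq_integral => w _; rewrite countE big_mkcond.
rewrite ge0_integral_sum//; last first.
- by move=> c w _; case: ifP => // _; rewrite lee_fin.
- by move=> c; case: (inn n c); [exact: m1Z|exact: measurable_cst].
rewrite [RHS]big_mkcond; apply: eq_bigr => c _; case: (inn n c); last exact: integral0.
by rewrite integral_indic ?setIT//; exact: mZ.
Qed.

Let riemann n := \sum_(c : cell n | inn n c) mesh L n ^+ 2 * H (corner L c).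

(* There are (n + 1)^2 cells and (n + 1) times the mesh is 2 L. *)
Let cell_sum_le n (k : R) : 0 <= k ->
  \sum_(c : cell n | inn n c) k * mesh L n ^+ 2 <= k * (2 * L) ^+ 2.
Proof.
move=> k0; apply: (@le_trans _ _ (\sum_(c : cell n) k * mesh L n ^+ 2)).
  rewrite big_mkcond; apply: ler_sum => c _; case: ifP => // _.
  by rewrite mulr_ge0// sqr_ge0.
rewrite sumr_const card_prod !card_ord -[X in X <= _]mulr_natr natrM -(meshE L n).
by rewrite le_eqVlt; apply/orP; left; apply/eqP; ring.
Qed.

Let Ecount_bounds : exists2 C, 0 <= C & \forall n \near \oo,
  ((riemann n - C * mesh L n)%:E <= \int[P]_w count n w <= (riemann n + C * mesh L n)%:E)%E.
Proof.
have [C [r0 [C0 r00 HC]]] := cell_probability K L gX da delta0.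
exists (C * (2 * L) ^+ 2); first by rewrite mulr_ge0// sqr_ge0.
have := mesh_small L0 r00; apply: filterS => n hn.
have m0 := mesh_gt0 L0 n.
have mr : 0 < mesh L n <= r0 by rewrite m0 ltW.
have err : \sum_(c : cell n | inn n c) C * mesh L n ^+ 3 <= C * (2 * L) ^+ 2 * mesh L n.
  have -> : C * (2 * L) ^+ 2 * mesh L n = (C * mesh L n) * (2 * L) ^+ 2 by ring.
  apply: le_trans (cell_sum_le n _); last by rewrite mulr_ge0// ltW.
  by apply: ler_sum => c _; rewrite le_eqVlt; apply/orP; left; apply/eqP; ring.
have cellP c : inn n c -> (P (Z c) <= (mesh L n ^+ 2 * H (corner L c) + C * mesh L n ^+ 3)%:E)%E /\
   ((mesh L n ^+ 2 * H (corner L c))%:E <= P (Z c) + (C * mesh L n ^+ 3)%:E)%E.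
  move=> /asboolP ci; have [h1 h2 _] := HC (corner L c) _ mr
    (fun z => @grid_closed_cell_box _ _ L0 n c z) (Gdet (inner_corner L0 ci)).
  by split; [exact: h1 (mZ c)|exact: h2 (mZ c)].
rewrite Ecount; apply/andP; split.
  rewrite EFinB leeBlDr//.
  apply: (@le_trans _ _ (\sum_(c : cell n | inn n c) (P (Z c) + (C * mesh L n ^+ 3)%:E))%E).
    by rewrite /riemann -sumEFin; apply: lee_sum => c /cellP[].
  by rewrite big_split /=; apply: leeD => //; rewrite sumEFin lee_fin.
apply: (@le_trans _ _ (\sum_(c : cell n | inn n c)
    (mesh L n ^+ 2 * H (corner L c) + C * mesh L n ^+ 3)%:E)%E).
  by apply: lee_sum => c /cellP[].
by rewrite sumEFin lee_fin big_split /= lerD2l.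
Qed.

Let cvg_Ecount : (\int[P]_w count n w)%E @[n --> \oo] -->
  (\int[mu2]_(p in plane_set G) (H (p.1 +i* p.2))%:E)%E.
Proof.
have [C C0 HC] := Ecount_bounds.
have [cr ir] := cvg_riemann K gX da L0 delta0 GL Gopen Gdet.
have cm : (C * mesh L n)%:E @[n --> \oo] --> (0 : \bar R).
  apply: cvg_EFin; first exact: nearW.
  by rewrite -[X in _ --> X](mulr0 C); apply: cvgMl_tmp; exact: cvg_mesh.
apply: (squeeze_cvge HC).
  rewrite -[X in _ --> X]sube0; under eq_cvg do rewrite EFinB.
  by apply: cvgeB => //; rewrite fin_num_adde_defl.
rewrite -[X in _ --> X]adde0; under eq_cvg do rewrite EFinD.
by apply: cvgeD => //; rewrite fin_num_adde_defl.
Qed.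

(** The number of occupied cells is at most the number of zeros and converges to
    it, and its expectation converges to the integral of the density. Fatou's
    lemma gives one inequality and monotonicity the other. *)
Theorem expected_nb_zeros_open :
  (\int[P]_w nb_zeros G w = \int[mu2]_(p in plane_set G) (H (p.1 +i* p.2))%:E)%E.
Proof.
have count0 n w : [set: Omega] w -> (0 <= count n w)%E by rewrite /count lee_fin.
apply/eqP; rewrite eq_le; apply/andP; split.
  rewrite -(cvg_limn_einf_sup cvg_Ecount).1.
  have := @fatou _ _ _ P setT measurableT count mcount count0; apply: le_trans.
  rewrite le_eqVlt; apply/orP; left; apply/eqP; apply: eq_integral => w _.
  by rewrite (cvg_limn_einf_sup (@cvg_count w)).1.
apply: (cvge_to_le cvg_Ecount); apply: nearW => n.
apply: ge0_le_integral => //; first exact: (count0 n).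
  exact: measurable_nb_zeros.
by move=> w _; exact: (occupied_le_esum L0).
Qed.

Lemma integrable_nb_zeros : P.-integrable setT (nb_zeros G).
Proof.
have [_ ir] := cvg_riemann K gX da L0 delta0 GL Gopen Gdet.
apply/integrableP; split; first exact: measurable_nb_zeros.
under eq_integral do rewrite (gee0_abs (nb_zeros_ge0 _ _)).
rewrite expected_nb_zeros_open.
have /integrableP[mh] := ir; apply: le_lt_trans.
have mG := measurable_plane_set L0 GL Gopen.
by apply: le_trans (lee_abs _) _; exact: le_abse_integral.
Qed.

(** The probability of a double zero in a cell is of the order of the square of
    its area, hence the sum over all cells is of the order of the area of a single cell. *)
Lemma negligible_double_zero :
  P.-negligible [set w | exists z, [/\ G z, S w z = K & S' w z = 0]].
Proof.
have [C [r0 [C0 r00 HC]]] := cell_probability K L gX da delta0.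
have [n0 _ Hn0] := mesh_small L0 r00.
have /choice[E HE] n : exists E, [/\ measurable E,
    (forall w, (exists z (c : cell n), [/\ inner L G c, in_cell (corner L c) (mesh L n) z,
       S w z = K & S' w z = 0]) -> E w) &
    ((n0 <= n)%N -> (P E <= (C * (2 * L) ^+ 2 * mesh L n ^+ 2)%:E)%E)].
  have [nn|nn] := leqP n0 n; last first.
    by exists setT; split=> //; rewrite leqNgt nn.
  have m0 := mesh_gt0 L0 n.
  have mr : 0 < mesh L n <= r0 by rewrite m0 ltW// Hn0.
  have /choice[E HE] (c : cell n) : exists E, measurable E /\ (inn n c ->
      (forall w, (exists z, [/\ in_cell (corner L c) (mesh L n) z, S w z = K & S' w z = 0]) -> E w) /\
      (P E <= (C * mesh L n ^+ 4)%:E)%E).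
    have [ci|_] := asboolP (inner L G c); last by exists set0.
    have [_ _ [E [mE h1 h2]]] := HC (corner L c) _ mr
      (fun z => @grid_closed_cell_box _ _ L0 n c z) (Gdet (inner_corner L0 ci)).
    by exists E.
  have [m1 m2] := measure_seq_union_le P (enum {: cell n}) (fun c => inn n c) (fun c => (HE c).1).
  exists (\big[setU/set0]_(c <- enum {: cell n} | inn n c) E c); split=> //.
    move=> w [z [c [ci cz Sz S'z]]].
    have ci' : inn n c by exact/asboolP.
    rewrite -bigcup_seq_cond; exists c; first by rewrite /= mem_enum ci'.
    by apply: ((HE c).2 ci').1; exists z.
  move=> _; apply: le_trans m2 _; rewrite big_enum_cond /=.
  apply: (@le_trans _ _ (\sum_(c : cell n | inn n c) (C * mesh L n ^+ 4)%:E)%E).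
    by apply: lee_sum => c ci; exact: ((HE c).2 ci).2.
  rewrite sumEFin lee_fin.
  have -> : C * (2 * L) ^+ 2 * mesh L n ^+ 2 = (C * mesh L n ^+ 2) * (2 * L) ^+ 2 by ring.
  apply: le_trans (cell_sum_le n _); last by rewrite mulr_ge0// sqr_ge0.
  by apply: ler_sum => c _; rewrite le_eqVlt; apply/orP; left; apply/eqP; ring.
have mE n : measurable (E n) by have [] := HE n.
(* A point of G lies in an inner cell from some mesh on. *)
pose A m := \bigcap_(n in [set n | (m <= n)%N]) E n.
have mA m : measurable (A m) by apply: bigcap_measurable => //; exists m => /=.
apply: (@negligibleS _ _ _ _ (\bigcup_m A m)).
  move=> w [z [Gz Sz S'z]]; have [m _ Hm] := near_inner L0 Gopen Gz.
  exists m => // n /= mn; have [_ h _] := HE n; apply: h.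
  have [g1 g2] := GL Gz; have [c cz] := cell_exists L0 n g1 g2.
  by exists z, c; split=> //; exact: Hm n mn c cz.
apply: negligible_bigcup => m; apply/negligibleP => //.
apply/eqP; rewrite eq_le measure_ge0 andbT.
have c2 : (C * (2 * L) ^+ 2 * mesh L n ^+ 2)%:E @[n --> \oo] --> (0 : \bar R).
  apply: cvg_EFin; first exact: nearW.
  rewrite -[X in _ --> X](mulr0 (C * (2 * L) ^+ 2)); apply: cvgMl_tmp.
  rewrite -[X in _ --> X](mulr0 (0 : R)); under eq_cvg do rewrite expr2.
  by apply: cvgM; exact: cvg_mesh.
apply: (cvge_to_ge c2); exists (maxn m n0) => // n /=; rewrite geq_max => /andP[mn n0n].
have [_ _ h] := HE n; apply: le_trans (h n0n).
by apply: le_measure; [exact/mem_set/mA|exact/mem_set/mE|move=> w; apply].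
Qed.

End open_domain.

(** * Expected number of zeros in a compact set *)
Lemma le_integral_ge0 d (T : measurableType d) (R : realType) (m : {measure set T -> \bar R})
    (f g : T -> \bar R) : (forall x, (0 <= f x)%E) -> (forall x, (f x <= g x)%E) ->
  (\int[m]_x f x <= \int[m]_x g x)%E.
Proof.
move=> f0 fg; have g0 x : (0 <= g x)%E by apply: le_trans (f0 x) (fg x).
rewrite !ge0_integralTE//; apply: le_ereal_sup => _ [h hf <-]; exists h => //.
by move=> x; apply: le_trans (hf x) (fg x).
Qed.

(** The function f is not assumed to be measurable on all of T: the number of
    solutions with multiplicity is only known to be measurable off a null set. *)
Lemma integral_off_null d (T : measurableType d) (R : realType) (m : {measure set T -> \bar R})
    (f : T -> \bar R) (N : set T) : measurable N -> m N = 0%E -> (forall x, (0 <= f x)%E) ->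
  measurable_fun (~` N) f -> (\int[m]_x f x = \int[m]_(x in ~` N) f x)%E.
Proof.
move=> mN N0 f0 mf; have mC : measurable (~` N) by exact: measurableC.
have mr : measurable_fun setT (f \_ (~` N)) by exact/(measurable_restrictT _ mC).
have r0 x : (0 <= (f \_ (~` N)) x)%E by rewrite /patch; case: ifP.
rewrite [RHS]integral_mkcond; apply/eqP; rewrite eq_le; apply/andP; split; last first.
  by apply: le_integral_ge0 => // x; rewrite /patch; case: ifP.
pose g x := ((f \_ (~` N)) x + (cst +oo%E \_ N) x)%E.
have mg : measurable_fun setT g.
  by apply: emeasurable_funD => //; apply/(measurable_restrictT _ mN); exact: measurable_cst.
have g0 x : (0 <= g x)%E.
  by apply: adde_ge0 => //; rewrite /patch; case: ifP => //= _; exact: le0y.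
apply: (@le_trans _ _ (\int[m]_x g x)%E).
  apply: le_integral_ge0 => // x; rewrite /g /patch in_setC.
  by case: (x \in N) => /=; rewrite ?add0e ?adde0 ?leey.
rewrite (ge0_negligible_integral mN measurableT mg (fun x _ => g0 x) N0) setTD.
rewrite [leRHS](ge0_negligible_integral mN measurableT mr (fun x _ => r0 x) N0) setTD.
rewrite le_eqVlt; apply/orP; left; apply/eqP; apply: eq_integral => x.
by move=> /set_mem xN; rewrite /g [X in (_ + X)%E]/patch memNset// adde0.
Qed.

Section compact_domain.
Context d (Omega : measurableType d) (R : realType) (P : probability Omega R).
Variable J : finType.
Local Notation Rm := (measurableTypeR R).
Local Notation plane := (Rm * Rm)%type.
Local Notation mu2 := ((@lebesgue_measure R) \x (@lebesgue_measure R))%E.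
Variables (X : J -> Omega -> R) (a a' : J -> R[i] -> R[i]) (K : R[i]).
Hypothesis gX : gauss_family P X.
Hypothesis da : forall j z, cdiff (a j) z (a' j z).
Let S w z := real_comb a (X^~ w) z.
Let S' w z := real_comb a' (X^~ w) z.
Let H z := kr_density K (a^~ z) (a'^~ z).
Let det z := kr_det (a^~ z).
Local Notation nbz := (nb_zeros X a K).

Variables (L delta : R) (G T : set R[i]).
Hypotheses (L0 : 0 < L) (delta0 : 0 < delta).
Hypothesis GL : forall z, G z -> `|complex.Re z| < L /\ `|complex.Im z| < L.
Hypothesis Gopen : forall z, G z -> exists2 e, 0 < e & forall z', modulus (z' - z) < e -> G z'.
Hypothesis Gdet : forall z, G z -> delta <= det z.
Hypothesis TG : T `<=` G.
Hypothesis Topen : forall z, (G `\` T) z ->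
  exists2 e, 0 < e & forall z', modulus (z' - z) < e -> (G `\` T) z'.

(** A compact set T is the difference of the open sets G and G \ T, over which both
    sides are finite. The function f stands for any count of the zeros that agrees
    with the number of zeros off a null set when all zeros are simple. *)
Theorem expected_nb_zeros (f : Omega -> \bar R) (N0 : set Omega) :
  (forall w, (0 <= f w)%E) -> P.-negligible N0 ->
  (forall w, ~ N0 w -> (forall z, G z -> S w z = K -> S' w z != 0) -> f w = nbz T w) ->
  (\int[P]_w f w = \int[mu2]_(p in plane_set T) (H (p.1 +i* p.2))%:E)%E.
Proof.
move=> f0 nN0 fE.
have UL z : (G `\` T) z -> `|complex.Re z| < L /\ `|complex.Im z| < L by move=> -[/GL].
have Udet z : (G `\` T) z -> delta <= det z by move=> -[/Gdet].
have [iG iU] : P.-integrable setT (nbz G) /\ P.-integrable setT (nbz (G `\` T)).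
  split; first exact: (integrable_nb_zeros K gX da L0 delta0 GL Gopen Gdet).
  exact: (integrable_nb_zeros K gX da L0 delta0 UL Topen Udet).
have [mG mU] := (measurable_int P iG, measurable_int P iU).
have EG := expected_nb_zeros_open K gX da L0 delta0 GL Gopen Gdet.
have EU := expected_nb_zeros_open K gX da L0 delta0 UL Topen Udet.
have nD := negligible_double_zero K gX da L0 delta0 GL Gopen Gdet.
have nI : P.-negligible [set w | nbz G w \isn't a fin_num].
  have := integrable_ae measurableT iG; apply: negligibleS => w /= + /(_ I); move/negP; exact.
(* Off N all counts are finite, zeros are simple and f counts them. *)
have [N [mN N00 NN]] := negligibleU (negligibleU nN0 nD) nI.
pose D := ~` N.
have mD : measurable D by exact: measurableC.
have Dgood w : D w -> [/\ ~ N0 w, nbz G w \is a fin_num & f w = nbz T w].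
  move=> Dw; have n0 : ~ N0 w by move=> h; apply/Dw/NN; left; left.
  have n1 : nbz G w \is a fin_num by apply/negPn/negP => h; apply/Dw/NN; right.
  split=> //; apply: fE => // z Gz Sz; apply/eqP => S'z.
  by apply/Dw/NN; left; right; exists z.
have split_count w : nbz G w = (nbz T w + nbz (G `\` T) w)%E.
  rewrite /nb_zeros (esumID T)//; congr (_ + _)%E; congr esum; apply/seteqP.
    by split=> z; [move=> [[_ Sz] Tz]|move=> [Tz Sz]; split=> //; split=> //; exact: TG].
  by split=> z; [move=> [[Gz Sz] Tz]|move=> [[Gz Tz] Sz]].
have fin_le w : D w -> nbz (G `\` T) w \is a fin_num.
  move=> Dw; have [_ h _] := Dgood w Dw.
  rewrite ge0_fin_numE ?nb_zeros_ge0//; apply: le_lt_trans (_ : nbz G w < +oo)%E.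
    by rewrite split_count leeDr// nb_zeros_ge0.
  by rewrite -ge0_fin_numE ?nb_zeros_ge0.
have mT : measurable_fun D (nbz T).
  apply: (@eq_measurable_fun _ _ _ _ _ (fun w => nbz G w - nbz (G `\` T) w)%E).
    move=> w /set_mem Dw.
    by rewrite [nbz G w]split_count addeK// fin_le.
  by apply: emeasurable_funB; exact: measurable_funTS.
have mfD : measurable_fun D f.
  apply: (@eq_measurable_fun _ _ _ _ _ (nbz T)) => // w /set_mem Dw.
  by have [_ _ ->] := Dgood w Dw.
rewrite (integral_off_null mN N00 f0 mfD) -/D.
have -> : (\int[P]_(w in D) f w = \int[P]_(w in D) nbz T w)%E.
  by apply: eq_integral => w /set_mem Dw; have [_ _ ->] := Dgood w Dw.
have onD (g : Omega -> \bar R) : measurable_fun setT g -> (forall w, (0 <= g w)%E) ->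
    (\int[P]_w g w = \int[P]_(w in D) g w)%E.
  by move=> mg g0; apply: integral_off_null => //; exact: measurable_funTS.
have pU : plane_set T `|` plane_set (G `\` T) = plane_set G.
  by apply/seteqP; split=> p; [move=> [/TG|[]]|move=> Gp; have [|] := pselect (plane_set T p); [left|right]].
have mPG := measurable_plane_set L0 GL Gopen.
have mPU := measurable_plane_set L0 UL Topen.
have mPT : measurable (plane_set T).
  have -> : plane_set T = plane_set G `\` plane_set (G `\` T).
    apply/seteqP; split=> p; first by move=> Tp; split; [exact: TG|move=> []].
    by move=> [Gp h]; apply: contrapT => Tp; apply: h.
  exact: measurableD.
have [M HM] := kr_density_bounds K gX da L delta0.
have H0 p : plane_set G p -> (0 <= (H (p.1 +i* p.2))%:E)%E.
  move=> Gp; have [g1 g2] := GL Gp; rewrite lee_fin.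
  by have /andP[] := HM (p.1 +i* p.2) (conj (ltW g1) (ltW g2)) (Gdet Gp).
have mH := measurable_density K da L0 delta0 GL Gopen Gdet.
have H1 : (\int[mu2]_(p in plane_set G) (H (p.1 +i* p.2))%:E =
    \int[mu2]_(p in plane_set T) (H (p.1 +i* p.2))%:E +
    \int[mu2]_(p in plane_set (G `\` T)) (H (p.1 +i* p.2))%:E)%E.
  rewrite -{1}pU ge0_integral_setU// ?pU//.
  by apply/disj_setPS => p [Tp [_ ]].
have H2 : (\int[P]_(w in D) nbz G w =
    \int[P]_(w in D) nbz T w + \int[P]_(w in D) nbz (G `\` T) w)%E.
  rewrite -ge0_integralD//.
  - by apply: eq_integral => w _; exact: split_count.
  - by move=> w _; exact: nb_zeros_ge0.
  - by move=> w _; exact: nb_zeros_ge0.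
  - exact: measurable_funTS.
move: H1; rewrite -EG -EU (onD _ mG (nb_zeros_ge0 _ _ _ _)) (onD _ mU (nb_zeros_ge0 _ _ _ _)) H2.
have fU : (\int[P]_(w in D) nbz (G `\` T) w)%E \is a fin_num.
  rewrite -(onD _ mU (nb_zeros_ge0 _ _ _ _)); exact: integrable_fin_num.
move=> /(congr1 (fun x => x - (\int[P]_(w in D) nbz (G `\` T) w)%E)%E).
by rewrite !addeK.
Qed.

End compact_domain.

(** * Normalization of independent normal variables *)
Section normalization.
Context d (Omega : measurableType d) (R : realType) (P : probability Omega R).
Local Notation Rm := (measurableTypeR R).
Local Notation mu := (@lebesgue_measure R).

Lemma normal_prob_scale (s : R) (E : set Rm) : 0 < s -> measurable E ->
  normal_prob 0 s ((fun x => x / s) @^-1` E) = gauss E.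
Proof.
move=> s0 mE; have sn0 : s != 0 by rewrite gt_eqF.
pose T (x : Rm) : Rm := s^-1 * x + 0.
have mT : measurable_fun setT T by exact: measurable_affine.
have TE : (fun x => x / s) = T by apply/funext => x; rewrite /T addr0 mulrC.
have pdfE x : normal_pdf 0 s x = s^-1 * gauss_pdf (T x).
  apply: (mulfI sn0); rewrite mulVKf// /T addr0.
  rewrite scaled_normal_pdfE// !gauss_pdfE -[LHS]mulrA -expRD; congr (_ * expR _).
  by field.
transitivity (\int[mu]_(x in T @^-1` E) (normal_pdf 0 s x)%:E)%E; first by rewrite TE.
transitivity (\int[mu]_(x in T @^-1` E) ((fun y => (s^-1 * gauss_pdf y)%:E) \o T) x)%E.
  by apply: eq_integral => x _; rewrite /= pdfE.
have mg : measurable_fun E (fun y : Rm => (s^-1 * gauss_pdf y)%:E : \bar R).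
  apply: measurable_funTS; apply/measurable_EFinP; apply: measurable_funM.
    exact: measurable_cst.
  exact: measurable_gauss_pdf.
have g0 (y : R) : (0 <= (s^-1 * gauss_pdf y)%:E)%E.
  by rewrite lee_fin mulr_ge0 ?invr_ge0 ?(ltW s0)// normal_pdf_ge0.
rewrite -(ge0_integral_pushforward mT mu mE mg (fun y _ => g0 y)).
have sN : 0 <= s by exact: ltW.
rewrite (eq_measure_integral (mscale (NngNum sN) mu)); last first.
  move=> A mA _; rewrite [LHS](lebesgue_measure_affine _ _ mA) ?invr_eq0//.
  by rewrite /mscale /= normfV invrK gtr0_norm.
rewrite ge0_integral_mscale//.
transitivity (\int[mu]_(x in E) (gauss_pdf x)%:E)%E; last by [].
rewrite -ge0_integralZl_EFin//.
- by apply: eq_integral => y _; rewrite -EFinM mulVKf.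
Qed.

Variables (I : finType) (X : I -> {RV P >-> R}) (s : I -> R).
Hypothesis indep : mutually_independent X.
Hypothesis s0 : forall i, 0 <= s i.
Hypothesis law : forall i, has_centered_normal_law (X i) (s i).

(** Increments of zero variance cannot be normalized and are left out of the
    family. *)
Lemma normalized_gauss_family :
  gauss_family P (fun (j : {i | s i != 0}) w => X (val j) w / s (val j)).
Proof.
have mX i : measurable_fun setT (X i : Omega -> Rm) by exact: (@measurable_funPT _ _ _ _ (X i)).
have mdiv (k : R) : measurable_fun setT (fun x : Rm => x / k : Rm).
  by apply: measurable_funM => //; exact: measurable_cst.
split=> [j|E mE]; first exact: (measurableT_comp (mdiv _) (mX _)).
pose E' i : set R := if insub i is Some j then (fun x => x / s i) @^-1` E j else setT.
have mE' i : measurable (E' i : set Rm).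
  by rewrite /E'; case: insubP => // j _ _; exact: (measurable_preim (mdiv _) (mE j)).
have E'E (j : {i | s i != 0}) : E' (val j) = (fun x => x / s (val j)) @^-1` E j.
  by rewrite /E' valK.
have := indep (J := finset (fun i => s i != 0)) (fun i _ => mE' i).
have -> : \bigcap_(i in [set i | i \in finset (fun i => s i != 0)]) X i @^-1` E' i =
    \bigcap_(j in setT) (fun w => X (val j) w / s (val j)) @^-1` E j.
  apply/seteqP; split=> w Hw.
    by move=> j _; have := Hw (val j); rewrite /= inE (valP j) E'E; apply.
  move=> i /=; rewrite inE => si; have := Hw (Sub i si) Logic.I; rewrite /= => h.
  by have := E'E (Sub i si); rewrite /= => ->.
move=> ->; rewrite (eq_bigl (fun i => i \in [pred i | s i != 0])); last first.
  by move=> i; rewrite !inE.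
rewrite big_sub; apply: eq_bigr => j _.
transitivity (distribution P (X (val j)) (E' (val j))); first by [].
have sj : s (val j) != 0 := valP j.
rewrite (@law (val j) _ (mE' (val j))) /centered_normal (negbTE sj) E'E normal_prob_scale//.
by rewrite lt_neqAle eq_sym sj s0.
Qed.

(** The law of an increment of zero variance is the point mass at 0. *)
Lemma negligible_null_coords : P.-negligible [set w | exists2 i, s i = 0 & X i w != 0].
Proof.
have mX i : measurable_fun setT (X i : Omega -> Rm) by exact: (@measurable_funPT _ _ _ _ (X i)).
pose A (i : I) : set Omega := X i @^-1` (~` [set 0]).
have mC : measurable (~` [set 0] : set Rm) by exact: measurableC.
have mA i : measurable (A i) by exact: (measurable_preim (mX i) mC).
have nA i : s i = 0 -> P.-negligible (A i).
  move=> si; apply/negligibleP => //.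
  transitivity (distribution P (X i) (~` [set 0])); first by [].
  rewrite (@law i _ mC) /centered_normal si eqxx diracE memNset//=.
apply: (@negligibleS _ _ _ _ (\big[setU/set0]_(i <- enum I | s i == 0) A i)).
  move=> w [i si Xi]; rewrite -bigcup_seq_cond; exists i.
    by rewrite /= mem_enum inE; apply/eqP.
  by move/eqP: Xi.
elim: (enum I) => [|i r IH]; first by rewrite big_nil; exact: negligible_set0.
by rewrite big_cons; case: eqP => // si; apply: negligibleU => //; exact: nA.
Qed.

End normalization.

(** * The random sum as a combination of its normalized increments *)
Definition backward_diff (V : zmodType) (c : nat -> V) (k : nat) : V :=
  if k is k'.+1 then c k - c k' else c 0%N.

Lemma sum_backward_diff (V : zmodType) (c : nat -> V) n :
  \sum_(0 <= k < n.+1) backward_diff c k = c n.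
Proof.
elim: n => [|n IH]; first by rewrite big_nat1.
by rewrite big_nat_recr//= IH addrC subrK.
Qed.

(** Each c j is the sum of its increments up to j. *)
Lemma abel_summation (V : pzRingType) (c f : nat -> V) n :
  \sum_(0 <= k < n) backward_diff c k * \sum_(k <= j < n) f j = \sum_(0 <= j < n) c j * f j.
Proof.
elim: n => [|n IH]; first by rewrite !big_nil.
rewrite [RHS]big_nat_recr//= -IH -sum_backward_diff mulr_suml big_nat_recr//=.
rewrite [X in _ = _ + X]big_nat_recr//= addrA big_nat1; congr (_ + _).
rewrite -big_split; apply: eq_big_nat => k /andP[_ kn] /=.
by rewrite (big_nat_recr _ _ _ (ltnW kn)) mulrDr.
Qed.

Section coefficients.
Context {R : realType} (N : nat) (sa sb : nat -> R).
Local Notation index := ('I_N.+1 + 'I_N.+1)%type.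

Definition deviation (i : index) : R := match i with inl k => sa k | inr k => sb k end.

(** Coefficients of the normalized increments of the two parts: division by the
    deviation is compensated here, and the imaginary part carries a factor i. *)
Definition coef (F : nat -> R[i]) (i : index) : R[i] :=
  match i with inl k => F k * (sa k)%:C | inr k => 'i%C * F k * (sb k)%:C end.

Lemma sum_support (V : nmodType) (g : index -> V) :
  (forall i, deviation i = 0 -> g i = 0) ->
  \sum_(j : {i | deviation i != 0}) g (val j) = \sum_(k < N.+1) (g (inl k) + g (inr k)).
Proof.
move=> g0; transitivity (\sum_(i in [pred i | deviation i != 0]) g i).
  by rewrite [RHS]big_sub; apply: eq_bigr.
rewrite big_mkcond /= (eq_bigr g); last first.
  by move=> i _; rewrite inE; case: eqP => //= /g0.
by rewrite big_sumType big_split.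
Qed.

Lemma ReIm_eta (z : R[i]) : z = complex.Re z +i* complex.Im z.
Proof. by case: z. Qed.

Lemma ReM (z w : R[i]) : complex.Re (z * w) =
  complex.Re z * complex.Re w - complex.Im z * complex.Im w.
Proof. by case: z w => ? ? []. Qed.

Lemma ImM (z w : R[i]) : complex.Im (z * w) =
  complex.Re z * complex.Im w + complex.Im z * complex.Re w.
Proof. by case: z w => ? ? []. Qed.

Lemma ReIm_sum (I : Type) (r : seq I) (F : I -> R[i]) :
  complex.Re (\sum_(i <- r) F i) = \sum_(i <- r) complex.Re (F i) /\
  complex.Im (\sum_(i <- r) F i) = \sum_(i <- r) complex.Im (F i).
Proof.
elim: r => [|i r [IH1 IH2]]; first by rewrite !big_nil.
by rewrite !big_cons -IH1 -IH2; case: (F i) (\sum_(j <- r) F j) => ? ? [].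
Qed.

Section density.
Variables (f : nat -> cplx R -> cplx R).
Hypothesis df : forall j z, (j <= N)%N -> cdiff (f j) z (derive1 (f j) z).

Definition tail k z : R[i] := \sum_(k <= j < N.+1) f j z.
Definition tail' k z : R[i] := \sum_(k <= j < N.+1) derive1 (f j : cplx R -> cplx R) z.

Lemma cdiff_tail k z : cdiff (tail k) z (tail' k z).
Proof.
pose g j w := if (j <= N)%N then f j w else 0.
pose g' j w := if (j <= N)%N then derive1 (f j : cplx R -> cplx R) w else 0.
have -> : tail k = fun w => \sum_(j <- index_iota k N.+1) g j w.
  by apply/funext => w; apply: eq_big_nat => j /andP[_ jN]; rewrite /g -ltnS jN.
have -> : tail' k z = \sum_(j <- index_iota k N.+1) g' j z.
  by apply: eq_big_nat => j /andP[_ jN]; rewrite /g' -ltnS jN.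
apply: cdiff_sum => j; rewrite /g /g'; case: leqP => jN; first exact: df.
exact: cdiff_cst.
Qed.

Lemma cdiff_coef (i : index) z : cdiff (fun w => coef (tail^~ w) i) z (coef (tail'^~ z) i).
Proof.
have H k (u : R[i]) : cdiff (fun w => u * tail k w) z (u * tail' k z).
  exact: cdiffMl (cdiff_tail k z).
case: i => k /=.
  have -> : (fun w => tail k w * (sa k)%:C) = (fun w => (sa k)%:C * tail k w).
    by apply/funext => w; rewrite mulrC.
  by rewrite mulrC; exact: H.
have -> : (fun w => 'i%C * tail k w * (sb k)%:C) = (fun w => ('i%C * (sb k)%:C) * tail k w).
  by apply/funext => w; rewrite mulrAC.
by rewrite mulrAC; exact: H.
Qed.

Lemma tailE k x y : tail k (x +i* y) = U N f k x y +i* V N f k x y.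
Proof.
have [h1 h2] := ReIm_sum (index_iota k N.+1) (fun j => f j (x +i* y)).
by rewrite [LHS]ReIm_eta /tail h1 h2.
Qed.

Lemma partial_x j x y : (j <= N)%N ->
  dux f j x y = complex.Re (derive1 (f j) (x +i* y)) /\
  dvx f j x y = complex.Im (derive1 (f j) (x +i* y)).
Proof.
move=> jN; pose w : R[i] := 0 +i* y.
have wE (t : R) : w + t%:C * 1 = t +i* y by rewrite mulr1; apply/eqP; rewrite eq_complex /= add0r addr0 !eqxx.
have dw : cdiff (f j) (w + x%:C * 1) (derive1 (f j) (x +i* y)) by rewrite wE; exact: df.
have [h1 h2] := cdiff_Re_path dw; rewrite mulr1 in h1 h2.
split.
  rewrite /dux derive1E -(@derive_val _ _ _ _ _ _ _ h1).
  by congr (derive _ x 1); apply/funext => t; rewrite wE.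
rewrite /dvx derive1E -(@derive_val _ _ _ _ _ _ _ h2).
by congr (derive _ x 1); apply/funext => t; rewrite wE.
Qed.

(** The complex derivative is the partial derivative in x. *)
Lemma tail'E k x y : tail' k (x +i* y) = Ux N f k x y +i* Vx N f k x y.
Proof.
have [h1 h2] := ReIm_sum (index_iota k N.+1) (fun j => derive1 (f j : cplx R -> cplx R) (x +i* y)).
rewrite [LHS]ReIm_eta /tail' h1 h2 /Ux /Vx; congr (_ +i* _).
  by apply: eq_big_nat => j /andP[_ jN]; have [-> _] := partial_x x y (jN : (j <= N)%N).
by apply: eq_big_nat => j /andP[_ jN]; have [_ ->] := partial_x x y (jN : (j <= N)%N).
Qed.

Variables x y : R.
Local Notation J := {i : index | deviation i != 0}.
Let a (j : J) := coef (tail^~ (x +i* y)) (val j).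
Let a' (j : J) := coef (tail'^~ (x +i* y)) (val j).
Let UU k := U N f k x y.
Let VV k := V N f k x y.
Let UUx k := Ux N f k x y.
Let VVx k := Vx N f k x y.

(* A linear form p of the real and imaginary parts of the coefficients, divided by
   the deviations; p = (1, 0) is the real part and p = (0, 1) the imaginary one. *)
Let q (p : R * R) (i : index) : R := match i with
  inl k => p.1 * UU k + p.2 * VV k | inr k => p.2 * UU k - p.1 * VV k end.
Let q' (p : R * R) (i : index) : R := match i with
  inl k => p.1 * UUx k + p.2 * VVx k | inr k => p.2 * UUx k - p.1 * VVx k end.

Let coefRI : (forall j, complex.Re (a j) = q (1, 0) (val j) * deviation (val j)) /\
  (forall j, complex.Im (a j) = q (0, 1) (val j) * deviation (val j)).
Proof.
by split=> j; rewrite /a /q; case: (val j) => k /=; rewrite !(ReM, ImM) tailE /= /UU /VV; ring.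
Qed.

Let coefRI' : (forall j, complex.Re (a' j) = q' (1, 0) (val j) * deviation (val j)) /\
  (forall j, complex.Im (a' j) = q' (0, 1) (val j) * deviation (val j)).
Proof.
by split=> j; rewrite /a' /q'; case: (val j) => k /=; rewrite !(ReM, ImM) tail'E /= /UUx /VVx; ring.
Qed.

Let sum_parts (g h : index -> R) (G : J -> R) :
  (forall j, G j = (g (val j) * deviation (val j)) * (h (val j) * deviation (val j))) ->
  \sum_j G j = \sum_(k < N.+1) (sa k ^+ 2 * (g (inl k) * h (inl k)) + sb k ^+ 2 * (g (inr k) * h (inr k))).
Proof.
move=> HG; rewrite (eq_bigr _ (fun j _ => HG j)).
rewrite (sum_support (g := fun i => g i * deviation i * (h i * deviation i))).
  by apply: eq_bigr => k _ /=; ring.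
by move=> i ->; rewrite mulr0 mul0r.
Qed.

Lemma kr_sums :
  [/\ \sum_j complex.Re (a j) ^+ 2 = Y1 N sa sb f x y,
      \sum_j complex.Im (a j) ^+ 2 = Y3 N sa sb f x y,
      \sum_j complex.Re (a j) * complex.Im (a j) = Y2 N sa sb f x y &
      \sum_j complex.Re (a' j) ^+ 2 + \sum_j complex.Im (a' j) ^+ 2 = D3 N sa sb f x y].
Proof.
have [hR hI] := coefRI; have [hR' hI'] := coefRI'.
split.
- rewrite /Y1 big_mkord (sum_parts (g := q (1, 0)) (h := q (1, 0))) => [|j]; last by rewrite hR expr2.
  by apply: eq_bigr => k _; rewrite /q /= /UU /VV; ring.
- rewrite /Y3 big_mkord (sum_parts (g := q (0, 1)) (h := q (0, 1))) => [|j]; last by rewrite hI expr2.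
  by apply: eq_bigr => k _; rewrite /q /= /UU /VV; ring.
- rewrite /Y2 big_mkord (sum_parts (g := q (1, 0)) (h := q (0, 1))) => [|j]; last by rewrite hR hI.
  by apply: eq_bigr => k _; rewrite /q /= /UU /VV; ring.
- rewrite /D3 big_mkord (sum_parts (g := q' (1, 0)) (h := q' (1, 0))) => [|j]; last by rewrite hR' expr2.
  rewrite (sum_parts (g := q' (0, 1)) (h := q' (0, 1))) => [|j]; last by rewrite hI' expr2.
  by rewrite -big_split; apply: eq_bigr => k _; rewrite /q' /= /UUx /VVx; ring.
Qed.

Lemma kr_cross_sums :
  D1 N sa sb f x y = (\sum_j complex.Re (a j) * complex.Re (a' j)) +i*
    (\sum_j complex.Re (a j) * complex.Im (a' j)) /\
  D2 N sa sb f x y = (\sum_j complex.Im (a j) * complex.Im (a' j)) -i*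
    (\sum_j complex.Im (a j) * complex.Re (a' j)).
Proof.
have [hR hI] := coefRI; have [hR' hI'] := coefRI'.
rewrite (sum_parts (g := q (1, 0)) (h := q' (1, 0))) => [|j]; last by rewrite hR hR'.
rewrite (sum_parts (g := q (1, 0)) (h := q' (0, 1))) => [|j]; last by rewrite hR hI'.
rewrite (sum_parts (g := q (0, 1)) (h := q' (0, 1))) => [|j]; last by rewrite hI hI'.
rewrite (sum_parts (g := q (0, 1)) (h := q' (1, 0))) => [|j]; last by rewrite hI hR'.
rewrite /q /q' /UU /VV /UUx /VVx /D1 /D2 !big_mkord.
have [h1 h2] := ReIm_sum (index_enum 'I_N.+1) (fun k : 'I_N.+1 =>
  ((sa k ^+ 2 * U N f k x y) -i* (sb k ^+ 2 * V N f k x y)) * (Ux N f k x y +i* Vx N f k x y)).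
have [h3 h4] := ReIm_sum (index_enum 'I_N.+1) (fun k : 'I_N.+1 =>
  ((sb k ^+ 2 * U N f k x y) -i* (sa k ^+ 2 * V N f k x y)) * (Ux N f k x y +i* Vx N f k x y)).
split; rewrite [LHS]ReIm_eta ?h1 ?h2 ?h3 ?h4; congr (_ +i* _); rewrite -?sumrN;
  by apply: eq_bigr => k _ /=; ring.
Qed.

Lemma kr_detE : kr_det a = Y1 N sa sb f x y * Y3 N sa sb f x y - Y2 N sa sb f x y ^+ 2.
Proof. by have [h1 h2 h3 _] := kr_sums; rewrite /kr_det h1 h2 h3. Qed.

(** With the covariances of S and S' as entries of D1 and D2, the three terms in
    |D1|^2, |D2|^2, |D1 + i D2|^2 regroup into the conditional variance and the
    square of the conditional mean: an identity of rational functions. *)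
Lemma zero_densityE (K1 K2 : R) : 0 < D0 N sa sb f x y ->
  zero_density N sa sb f K1 K2 x y = kr_density (K1 +i* K2) a a'.
Proof.
move=> d0; have [h1 h2 h3 h4] := kr_sums; have [h5 h6] := kr_cross_sums.
have dE : D0 N sa sb f x y = Num.sqrt (kr_det a) by rewrite kr_detE.
have dd : D0 N sa sb f x y ^+ 2 = kr_det a.
  by rewrite dE sqr_sqrtr//; apply: ltW; rewrite -sqrtr_gt0 -dE.
rewrite /zero_density /kr_density /= h1 h2 h3 h4 -dE -dd h5 h6.
have normE (z : R[i]) : Normc.normc z ^+ 2 = complex.Re z ^+ 2 + complex.Im z ^+ 2.
  by case: z => ? ? /=; rewrite sqr_sqrtr// addr_ge0 ?sqr_ge0.
rewrite !normE; congr (_ * _).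
move: (\sum_j complex.Re (a j) * complex.Re (a' j)) => AC.
move: (\sum_j complex.Re (a j) * complex.Im (a' j)) => AE.
move: (\sum_j complex.Im (a j) * complex.Re (a' j)) => BC.
move: (\sum_j complex.Im (a j) * complex.Im (a' j)) => BE.
have -> : (AC +i* AE) + 'i%C * (BE -i* BC) = (AC + BC) +i* (AE + BE).
  by apply/eqP; rewrite eq_complex /=; apply/andP; split; apply/eqP; ring.
rewrite /=; move: d0; move: (D0 _ _ _ _ _ _) => D d0; field.
by rewrite gt_eqF.
Qed.

End density.
End coefficients.

(** * Neighborhoods of complex numbers *)
Section complex_topology.
Context {R : realType}.

(** The radii of balls are complex numbers in the ambient structure; this is the
    form with real radii. *)
Lemma nbhs_discP (z : cplx R) (B : set (cplx R)) :
  nbhs z B <-> exists2 e : R, 0 < e & forall z', modulus (z' - z) < e -> B z'.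
Proof.
split=> [/nbhs_ballP[e /= e0 H]|[e e0 H]].
  have [er ei] : 0 < complex.Re e /\ e = (complex.Re e)%:C.
    by move: e0; rewrite ltcE /= => /andP[/eqP i0 r0]; split=> //; case: (e) i0 => ? ? /= ->.
  exists (complex.Re e) => // z' hz; apply: H; rewrite /ball /= ei.
  by rewrite normC_modulus modulus_distrC ltcR.
apply/nbhs_ballP; exists e%:C => /=; first by rewrite ltcR.
move=> z'; rewrite /ball /= normC_modulus ltcR modulus_distrC; exact: H.
Qed.

Lemma cvg_of_cdiff (f : R[i] -> R[i]) (z : cplx R) c : cdiff f z c ->
  ((fun w => complex.Re (f w)) : cplx R -> R) @ z --> complex.Re (f z) /\
  ((fun w => complex.Im (f w)) : cplx R -> R) @ z --> complex.Im (f z).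
Proof.
move=> fz; have [del d0 H] := cdiff_lip fz.
have gen (p : R[i] -> R) : (forall v w, `|p v - p w| <= modulus (v - w)) ->
    ((fun w => p (f w)) : cplx R -> R) @ z --> p (f z).
  move=> pL; apply/(@cvgrPdist_lt _ _ _ (nbhs z) (nbhs_filter z)) => e e0.
  have c1 : 0 < modulus c + 1 by have := modulus_ge0 c; lra.
  apply/nbhs_discP; exists (Num.min del (e / (modulus c + 1))).
    by rewrite lt_min d0 divr_gt0.
  move=> w; rewrite lt_min => /andP[h1 h2]; rewrite distrC.
  apply: le_lt_trans (pL _ _) _.
  rewrite (_ : w = z + (w - z)); last by ring.
  apply: le_lt_trans (H _ h1) _.
  by rewrite mulrC -ltr_pdivlMr.
split; apply: gen => v w; apply: le_trans (_ : _ <= modulus (v - w)) => //.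
  by rewrite (_ : complex.Re v - complex.Re w = complex.Re (v - w)) ?modulus_Re//; case: v w => ? ? [].
by rewrite (_ : complex.Im v - complex.Im w = complex.Im (v - w)) ?modulus_Im//; case: v w => ? ? [].
Qed.

Lemma closed_complement_disc (T : set (cplx R)) z : compact T -> ~ T z ->
  exists2 e : R, 0 < e & forall z', modulus (z' - z) < e -> ~ T z'.
Proof.
move=> cT Tz; apply/(nbhs_discP z (~` T)).
have : open (~` T) by apply: closed_openC; apply: compact_closed => //; exact: norm_hausdorff.
by move=> oT; exact: open_nbhs_nbhs.
Qed.

(** Continuous functions are bounded and attain their minimum on a compact set. *)
Lemma compact_bounds (T : set (cplx R)) (det : cplx R -> R) : compact T ->
  (forall z : cplx R, det @ z --> det z) -> (forall z, T z -> 0 < det z) ->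
  exists L delta : R, [/\ 0 < L, 0 < delta & forall z, T z ->
    [/\ `|complex.Re z| < L, `|complex.Im z| < L & delta < det z]].
Proof.
move=> cT cd d0; have [[z0 Tz0]|nT] := pselect (T !=set0); last first.
  by exists 1, 1; split=> // z Tz; case: nT; exists z.
have T0 : T !=set0 by exists z0.
have cdT : {within T, continuous det} by apply: continuous_subspaceT => z; exact: cd.
have [z1 /set_mem Tz1 m1] := compact_EVT_min T0 cT cdT.
have cRI (z : cplx R) := cvg_of_cdiff (cdiff_id z).
have cb (p : cplx R -> R) : (forall z : cplx R, p @ z --> p z) ->
    exists M, forall z, T z -> `|p z| <= M.
  move=> cp; have cpT : {within T, continuous (fun z => `|p z|)}.
    by apply: continuous_subspaceT => z; exact: (cvg_norm (cp z)).
  have [z2 _ m2] := compact_EVT_max T0 cT cpT.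
  by exists `|p z2| => z Tz; apply: m2; exact/mem_set.
have [M1 H1] := cb _ (fun z => (cRI z).1); have [M2 H2] := cb _ (fun z => (cRI z).2).
exists (`|M1| + `|M2| + 1), (det z1 / 2).
have := normr_ge0 M1; have := normr_ge0 M2; have := ler_norm M1; have := ler_norm M2.
move=> a1 a2 a3 a4; split; [lra|by rewrite divr_gt0// d0|move=> z Tz].
have := H1 z Tz; have := H2 z Tz; have := m1 z (mem_set Tz).
by have := d0 _ Tz1 => *; split; lra.
Qed.

(** At a simple zero the first derivative is the first one not to vanish. *)
Lemma multiplicity_simple (g : cplx R -> cplx R) (z : cplx R) :
  g z = 0 -> derive1 g z != 0 -> multiplicity g z = 1%E.
Proof.
move=> gz g'z; apply/eqP; rewrite eq_le; apply/andP; split; last first.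
  by apply: ereal_sup_ubound; exists 1%N => // -[].
apply: ge_ereal_sup => _ [n Hn <-]; rewrite lee_fin (ler_nat R n 1) leqNgt; apply/negP => n1.
by move/eqP: g'z; apply; have := Hn 1%N n1.
Qed.

End complex_topology.

(** * The expected number of solutions *)
Lemma cdiff_real_comb (R : realType) (J : finType) (a a' : J -> R[i] -> R[i])
    (zeta : J -> R) z : (forall j, cdiff (a j) z (a' j z)) ->
  cdiff (real_comb a zeta) z (real_comb a' zeta z).
Proof.
move=> da.
have H j : cdiff (fun w => a j w * (zeta j)%:C) z (a' j z * (zeta j)%:C).
  rewrite mulrC (_ : (fun _ => _) = fun w => (zeta j)%:C * a j w); first exact: cdiffMl.
  by apply/funext => w; rewrite mulrC.
exact: (cdiff_sum (index_enum J) H).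
Qed.

Section random_sum_comb.
Context d (Omega : measurableType d) (R : realType) (P : probability Omega R).
Variables (N : nat) (A B : nat -> {RV P >-> R}) (f : nat -> cplx R -> cplx R) (sa sb : nat -> R).
Local Notation s := (@deviation R N sa sb).
Local Notation X := (@increments _ _ _ P N A B).

Lemma random_sum_increments w z : random_sum N A B f w z =
  \sum_(0 <= k < N.+1) (increment A k w +i* increment B k w) * tail N f k z.
Proof.
rewrite /random_sum -(abel_summation (fun j => A j w +i* B j w) (fun j => f j z)).
by apply: eq_bigr => -[|k] _ //=; congr (_ * _).
Qed.

Lemma random_sumE w : (forall i, s i = 0 -> X i w = 0) ->
  random_sum N A B f w =
  real_comb (fun (j : {i | s i != 0}) z => coef sa sb (tail N f ^~ z) (val j))
    (fun j => X (val j) w / s (val j)).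
Proof.
move=> X0; apply/funext => z; rewrite random_sum_increments /real_comb.
rewrite (sum_support (g := fun i => coef sa sb (tail N f ^~ z) i * (X i w / s i)%:C)); last first.
  by move=> [] k /= ->; rewrite rmorph0 ?mulr0 mul0r.
rewrite big_mkord; apply: eq_bigr => k _ /=.
have simp (c x : R) (F : R[i]) : (c = 0 -> x = 0) -> F * c%:C * (x / c)%:C = F * x%:C.
  move=> h; have [c0|c0] := eqVneq c 0; first by rewrite h// c0 rmorph0 !mulr0 mul0r.
  by rewrite -mulrA -rmorphM mulrC /= [c * _]mulrC divfK// mulrC.
rewrite !simp; [|exact: (X0 (inr k))|exact: (X0 (inl k))].
rewrite mulrC -mulrA mulrCA -mulrDr; congr (_ * _).
by apply/eqP; rewrite eq_complex /=; apply/andP; split; apply/eqP; ring.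
Qed.

End random_sum_comb.

Theorem theorem5 (R : realType) (d : measure_display)
  (Omega : measurableType d) (P : probability Omega R)
  (N : nat) (hN : (1 < N)%N) (K1 K2 : R)
  (f : nat -> cplx R -> cplx R)
  (f_holo : forall j, (j <= N)%N -> holomorphic (f j))
  (f_real : forall j, (j <= N)%N -> forall x : R, complex.Im (f j (x%:C)) = 0)
  (sa sb : nat -> R)
  (sa_ge0 : forall k, (k <= N)%N -> 0 <= sa k)
  (sb_ge0 : forall k, (k <= N)%N -> 0 <= sb k)
  (A B : nat -> {RV P >-> R})
  (indep : mutually_independent (@increments _ _ _ P N A B))
  (A_law : forall k, (k <= N)%N -> has_centered_normal_law (increment A k) (sa k))
  (B_law : forall k, (k <= N)%N -> has_centered_normal_law (increment B k) (sb k))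
  (T : set (cplx R)) (T_compact : compact T)
  (D0_gt0 : forall x y : R, T (x +i* y) -> 0 < D0 N sa sb f x y) :
  (\int[P]_w nb_solutions (random_sum N A B f w) (K1 +i* K2) T =
   \int[lebesgue_measure \x lebesgue_measure]_(p in
       [set p : R * R | T (p.1 +i* p.2)])
     (zero_density N sa sb f K1 K2 p.1 p.2)%:E)%E.
Proof.
pose s := @deviation R N sa sb.
have s0 i : 0 <= s i by case: i => k; [exact: sa_ge0 (ltn_ord k)|exact: sb_ge0 (ltn_ord k)].
have law i : has_centered_normal_law (@increments _ _ _ P N A B i) (s i).
  by case: i => k; [exact: A_law (ltn_ord k)|exact: B_law (ltn_ord k)].
have df j z : (j <= N)%N -> cdiff (f j) z (derive1 (f j) z).
  by move=> jN; apply: derivable_cdiff; exact: f_holo.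
have gX := normalized_gauss_family indep s0 law.
have nX := negligible_null_coords law.
pose J : finType := {i | s i != 0}.
pose X (j : J) w := increments A B (val j) w / s (val j).
pose a (j : J) z := coef sa sb (tail N f ^~ z) (val j).
pose a' (j : J) z := coef sa sb (tail' N f ^~ z) (val j).
pose K : R[i] := K1 +i* K2.
have da j z : cdiff (a j) z (a' j z) by exact: cdiff_coef.
pose det (z : cplx R) : R := kr_det (a^~ z).
have detE x y : D0 N sa sb f x y = Num.sqrt (det (x +i* y)) by rewrite /det kr_detE.
have cdet (z : cplx R) : det @ z --> det z.
  by apply: (@cvg_kr_det _ _ _ (nbhs z) (nbhs_filter z)) => j; have [] := cvg_of_cdiff (da j z).
have det0 z : T z -> 0 < det z.
  by case: z => x y Tz; rewrite -sqrtr_gt0 -detE; exact: D0_gt0.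
have [L [delta [L0 delta0 HT]]] := compact_bounds T_compact cdet det0.
(* An open neighborhood of T on which the determinant stays bounded below. *)
pose G : set R[i] := [set z | [/\ `|complex.Re z| < L, `|complex.Im z| < L & delta < det z]].
have Gopen (z : cplx R) : G z -> exists2 e, 0 < e & forall z', modulus (z' - z) < e -> G z'.
  move=> [g1 g2 g3]; apply/(nbhs_discP z G).
  have [cR cI] := cvg_of_cdiff (cdiff_id z); have FF := nbhs_filter z.
  have n1 := cvgr_lt _ (cvg_norm cR) _ g1.
  have n2 := cvgr_lt _ (cvg_norm cI) _ g2.
  have n3 := cvgr_gt _ (cdet z) _ g3.
  by apply: (@filterS3 _ _ FF _ _ _ _ _ (n1 FF FF) (n2 FF FF) (n3 FF)) => w h1 h2 h3; split.
have Topen z : (G `\` T) z -> exists2 e, 0 < e & forall z', modulus (z' - z) < e -> (G `\` T) z'.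
  move=> [Gz Tz]; have [e1 e10 H1] := Gopen z Gz.
  have [e2 e20 H2] := closed_complement_disc T_compact Tz.
  exists (Num.min e1 e2); first by rewrite lt_min e10.
  by move=> z'; rewrite lt_min => /andP[/H1 h1 /H2 h2].
have TG : T `<=` G by move=> z /HT.
have GL z : G z -> `|complex.Re z| < L /\ `|complex.Im z| < L by case.
have Gdet z : G z -> delta <= kr_det (a^~ z) by case=> _ _ /ltW.
have mult0 (g : cplx R -> cplx R) z : (0 <= multiplicity g z)%E.
  by apply: ereal_sup_ubound; exists 0%N.
rewrite (expected_nb_zeros (K := K) gX da L0 delta0 GL Gopen Gdet TG Topen
  (f := fun w => nb_solutions (random_sum N A B f w) K T) _ nX); last 2 first.
- by move=> w; exact: esum_ge0.
- move=> w Nw simple.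
  have SE := @random_sumE _ _ _ _ N A B f sa sb w _.
  rewrite /nb_solutions SE => [|i si]; last first.
    by apply/eqP/negPn/negP => Xi; apply: Nw; exists i.
  apply: eq_esum => z [Tz Sz]; apply: multiplicity_simple; first by rewrite Sz subrr.
  rewrite (@cdiff_derive1 _ _ _ (real_comb a' (X^~ w) z)).
    exact: simple z (TG _ Tz) Sz.
  rewrite -[real_comb a' _ _]addr0; apply: cdiffD; last exact: cdiff_cst.
  exact: (cdiff_real_comb _ (fun j => da j z)).
apply: eq_integral => -[x y] /set_mem Txy.
by rewrite /= (zero_densityE df)//; exact: D0_gt0.
Qed.
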